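(* Let $(M^7,\varphi_i,\xi_i,\eta_i,g)$, $i=1,2,3$, be a simply connected $7$-dimensional $3$-$(\alpha,\delta)$-Sasaki manifold with Levi-Civita connection $\nabla^g$, and let $\psi_0$ be its canonical spinor field. 1) $\psi_0$ is a generalized Killing spinor: $$\nabla^g_X\psi_0=-\frac{3\alpha}{2}X\cdot\psi_0\ \text{ for }X\in\mathcal H,\qquad \nabla^g_Y\psi_0=\frac{2\alpha-\delta}{2}\,Y\cdot\psi_0\ \text{ for }Y\in\mathcal V.$$ The two generalized Killing numbers coincide if and only if $\delta=5\alpha$; in this case, the canonical $G_2$-form $\omega$ defines a nearly parallel $G_2$-structure (Fernández–Gray type $W_1$). 2) The Clifford products $\psi_i:=\xi_i\cdot\psi_0$, $i=1,2,3$, are generalized Killing spinors: $$\nabla^g_{\xi_i}\psi_i=\frac{2\alpha-\delta}{2}\,\xi_i\cdot\psi_i,\qquad \nabla^g_{\xi_j}\psi_i=\frac{3\delta-2\alpha}{2}\,\xi_j\cdot\psi_i\ (i\neq j),\qquad \nabla^g_X\psi_i=\frac{\alpha}{2}\,X\cdot\psi_i\ \text{ for }X\in\mathcal H.$$ Any two of the generalized Killing numbers coincide if and only if $\alpha=\delta$, i.e. if $M^7$ is $3$-$\alpha$-Sasakian.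
   Context: An almost contact metric structure $(\varphi,\xi,\eta,g)$ consists of a $(1,1)$-tensor field $\varphi$, a vector field $\xi$, a $1$-form $\eta$ and a Riemannian metric $g$ with $\varphi^2=-I+\eta\otimes\xi$, $\eta(\xi)=1$, $g(\varphi X,\varphi Y)=g(X,Y)-\eta(X)\eta(Y)$. Its fundamental form is $\Phi(X,Y)=g(X,\varphi Y)$. An almost $3$-contact metric manifold $(M,\varphi_i,\xi_i,\eta_i,g)$, $i=1,2,3$, is a manifold of dimension $4n+3$ with three almost contact metric structures with the same $g$ such that, for every even permutation $(i,j,k)$ of $(1,2,3)$, $\varphi_k=\varphi_i\varphi_j-\eta_j\otimes\xi_i=-\varphi_j\varphi_i+\eta_i\otimes\xi_j$, $\xi_k=\varphi_i\xi_j=-\varphi_j\xi_i$, $\eta_k=\eta_i\circ\varphi_j=-\eta_j\circ\varphi_i$. Set $\mathcal H=\bigcap_i\ker\eta_i$, $\mathcal V=\langle\xi_1,\xi_2,\xi_3\rangle$. It is $3$-$(\alpha,\delta)$-Sasaki if $d\eta_i=2\alpha\Phi_i+2(\alpha-\delta)\eta_j\wedge\eta_k$ for every even permutation $(i,j,k)$ of $(1,2,3)$, with real constants $\alpha\neq0$, $\delta$; for $\alpha=\delta$ it is $3$-$\alpha$-Sasakian. It is spin. The canonical connection is the unique metric connection $\nabla$ with skew torsion ($g(T(X,Y),Z)$ a $3$-form) such that $\nabla_X\varphi_i=\beta(\eta_k(X)\varphi_j-\eta_j(X)\varphi_k)$ for all $X$ and every even permutation $(i,j,k)$, where $\beta=2(\delta-2\alpha)$.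 On a $7$-dimensional $3$-$(\alpha,\delta)$-Sasaki manifold the $3$-form $\omega=\sum_{i=1}^3\eta_i\wedge\Phi_i^{\mathcal H}+\eta_1\wedge\eta_2\wedge\eta_3$, where $\Phi_i^{\mathcal H}=\Phi_i+\eta_j\wedge\eta_k$ for even permutations $(i,j,k)$, defines the canonical $G_2$-structure; it satisfies $d{*}\omega=0$ and $\nabla\omega=0$. A $G_2$-structure is nearly parallel (type $W_1$) if $d\omega=\lambda{*}\omega$ for a nonzero constant $\lambda$. Let $\Sigma$ be the real (rank $8$) spin bundle of $M^7$, with Clifford multiplication satisfying $X\cdot X=-|X|^2$ and normalized such that $\omega$ acts by Clifford multiplication as a symmetric endomorphism with eigenvalues $-7$ (multiplicity $1$) and $+1$ (multiplicity $7$). The canonical spinor field $\psi_0$ is the section of $\Sigma$ (unique up to sign) with $\nabla\psi_0=0$, $\omega\cdot\psi_0=-7\psi_0$, $|\psi_0|=1$, where $\nabla$ acts on spinors by the lift of the canonical connection, $\nabla_X\psi=\nabla^g_X\psi+\frac14(X\lrcorner T)\cdot\psi$. A spinor field $\psi$ is a generalized Killing spinor if there is a symmetric endomorphism field $S$ of $TM$ with $\nabla^g_X\psi=S(X)\cdot\psi$ for all $X$; the eigenvalues of $S$ are the generalized Killing numbers of $\psi$. Conventions: $d\eta(X,Y)=X(\eta(Y))-Y(\eta(X))-\eta([X,Y])$, $(\eta\wedge\zeta)(X,Y)=\eta(X)\zeta(Y)-\eta(Y)\zeta(X)$, and analogously in higher degree. *)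

(* Defs.v *)
From HB Require Import structures.
From mathcomp Require Import all_boot all_order all_algebra.
From mathcomp Require Import all_classical all_reals all_analysis.

Set Implicit Arguments.
Unset Strict Implicit.
Unset Printing Implicit Defensive.

Import Order.TTheory GRing.Theory Num.Theory.
Import numFieldNormedType.Exports.
Local Open Scope classical_set_scope.
Local Open Scope ring_scope.

Section Smooth.
Variable R : realType.

Definition iterD (vs : seq 'cV[R]_7) (f : 'cV[R]_7 -> R^o) : 'cV[R]_7 -> R^o :=
  foldr (fun v (h : 'cV[R]_7 -> R^o) x => 'D_v h x) f vs.

(* f is C^oo on a neighbourhood of x *)
Definition smooth_near (f : 'cV[R]_7 -> R^o) (x : 'cV[R]_7) : Prop :=
  \forall y \near x, forall vs, differentiable (iterD vs f) y.

End Smooth.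

Section Topology.
Variables (R : realType) (M : topologicalType).

Definition path_connected : Prop :=
  forall x y : M, exists f : R -> M,
    [/\ {within `[0, 1], continuous f}, f 0 = x & f 1 = y].

Definition simply_connected : Prop :=
  [/\ exists x : M, True, path_connected &
   forall (x : M) (f : R -> M),
     {within `[0, 1], continuous f} -> f 0 = x -> f 1 = x ->
     exists H : R * R -> M,
       [/\ {within `[0, 1] `*` `[0, 1], continuous H},
           {in `[0, 1], forall t, H (t, 0) = f t /\ H (t, 1) = x} &
           {in `[0, 1], forall s, H (0, s) = x /\ H (1, s) = x}]].

(* A smooth manifold of dimension 7. The atlas is indexed by the points of M:
   [chart p] is a chart defined on a neighbourhood [dom p] of p, with inverse
   [param p]. Every smooth structure is given by such an atlas. *)
Record manifold7 := Manifold7 {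
  dom : M -> set M;
  chart : M -> M -> 'cV[R]_7;
  param : M -> 'cV[R]_7 -> M;
  M_hausdorff : hausdorff_space M;
  M_second_countable : @second_countable M;
  dom_open : forall p, open (dom p);
  dom_self : forall p, dom p p;
  chart_open : forall p, open (chart p @` dom p);
  chartK : forall p q, dom p q -> param p (chart p q) = q;
  chart_continuous : forall p q, dom p q -> {for q, continuous (chart p)};
  param_continuous : forall p q, dom p q ->
    {for chart p q, continuous (param p)};
  transition_smooth : forall p q r i, dom p r -> dom q r ->
    smooth_near (fun x => chart q (param p x) i 0) (chart p r)
}.

End Topology.

Arguments manifold7 R M : clear implicits.

Section Geometry.
Variables (R : realType) (M : topologicalType) (A : manifold7 R M).

(* The tangent space T_pM is identified with R^7 through the preferred chart
   [chart A p], so that a vector field is a function M -> R^7, a field of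
   endomorphisms is a field of matrices acting on columns and a 1-form is a
   field of row vectors. *)
Local Notation vec := 'cV[R]_7.
Local Notation vfield := (M -> 'cV[R]_7).

Definition smooth_fun (f : M -> R) (p : M) : Prop :=
  smooth_near (fun x => f (param A p x)) (chart A p p).

(* df_p(u), also written u(f) *)
Definition dfun (f : M -> R) (p : M) (u : vec) : R :=
  'D_u (fun x => f (param A p x) : R^o) (chart A p p).

(* A vector bundle of rank m is given by fibres R^m together with, for each
   point p, a local trivialization: [coord p q] is the matrix giving the
   coordinates of the elements of the fibre at q, for q near p. *)
Definition smooth_section m (coord : M -> M -> 'M[R]_m) (s : M -> 'cV[R]_m)
    (p : M) : Prop :=
  forall a, smooth_fun (fun q => (coord p q *m s q) a 0) p.

(* For the tangent bundle: the Jacobian at q of the change from the preferred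
   chart at q to the preferred chart at p. *)
Definition tcoord (p q : M) : 'M[R]_7 :=
  \matrix_(i, j) dfun (fun r => chart A p r i 0) q (delta_mx j 0).

Definition smooth_vf (X : vfield) (p : M) : Prop := smooth_section tcoord X p.

(* The Lie bracket at p, computed in the preferred chart at p *)
Definition lie (X Y : vfield) (p : M) : vec :=
  \col_i (dfun (fun q => (tcoord p q *m Y q) i 0) p (X p)
          - dfun (fun q => (tcoord p q *m X q) i 0) p (Y p)).

Definition smooth_endo (S : M -> 'M[R]_7) : Prop :=
  forall p X, smooth_vf X p -> smooth_vf (fun q => S q *m X q) p.

Definition ev (a : 'rV[R]_7) (u : vec) : R := (a *m u) 0 0.

Definition smooth_form1 (a : M -> 'rV[R]_7) : Prop :=
  forall p X, smooth_vf X p -> smooth_fun (fun q => ev (a q) (X q)) p.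

Definition inner (g : M -> 'M[R]_7) (p : M) (u v : vec) : R :=
  (u^T *m g p *m v) 0 0.

Record riemannian (g : M -> 'M[R]_7) : Prop := Riemannian {
  metric_sym : forall p u v, inner g p u v = inner g p v u;
  metric_pos : forall p u, u != 0 -> 0 < inner g p u u;
  metric_smooth : forall p X Y, smooth_vf X p -> smooth_vf Y p ->
    smooth_fun (fun q => inner g q (X q) (Y q)) p
}.

Definition wedge11 (a b : vec -> R) (u v : vec) : R := a u * b v - a v * b u.

Definition wedge12 (a : vec -> R) (B : vec -> vec -> R) (u v w : vec) : R :=
  a u * B v w + a v * B w u + a w * B u v.

Definition wedge111 (a b c : vec -> R) : vec -> vec -> vec -> R :=
  wedge12 a (wedge11 b c).

Definition d1 (a : M -> 'rV[R]_7) (X Y : vfield) (p : M) : R :=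
  dfun (fun q => ev (a q) (Y q)) p (X p)
  - dfun (fun q => ev (a q) (X q)) p (Y p)
  - ev (a p) (lie X Y p).

Definition d3 (w : M -> vec -> vec -> vec -> R) (X0 X1 X2 X3 : vfield) (p : M)
    : R :=
  dfun (fun q => w q (X1 q) (X2 q) (X3 q)) p (X0 p)
  - dfun (fun q => w q (X0 q) (X2 q) (X3 q)) p (X1 p)
  + dfun (fun q => w q (X0 q) (X1 q) (X3 q)) p (X2 p)
  - dfun (fun q => w q (X0 q) (X1 q) (X2 q)) p (X3 p)
  - w p (lie X0 X1 p) (X2 p) (X3 p)
  + w p (lie X0 X2 p) (X1 p) (X3 p)
  - w p (lie X0 X3 p) (X1 p) (X2 p)
  - w p (lie X1 X2 p) (X0 p) (X3 p)
  + w p (lie X1 X3 p) (X0 p) (X2 p)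
  - w p (lie X2 X3 p) (X0 p) (X1 p).

(* [nabla s p u] is the covariant derivative of the section s at p in the
   direction u. The sections in the axioms need only be smooth near p (local
   sections extended arbitrarily); locality follows from the Leibniz rule. *)
Record connection m (coord : M -> M -> 'M[R]_m)
    (nabla : (M -> 'cV[R]_m) -> M -> vec -> 'cV[R]_m) : Prop := Connection {
  nabla_lin : forall s p (c : R) u v, smooth_section coord s p ->
    nabla s p (c *: u + v) = c *: nabla s p u + nabla s p v;
  nablaD : forall s t p u,
    smooth_section coord s p -> smooth_section coord t p ->
    nabla (fun q => s q + t q) p u = nabla s p u + nabla t p u;
  nabla_leibniz : forall (f : M -> R) s p u,
    smooth_fun f p -> smooth_section coord s p ->
    nabla (fun q => f q *: s q) p u = dfun f p u *: s p + f p *: nabla s p u;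
  nabla_smooth : forall X s p, smooth_vf X p -> smooth_section coord s p ->
    smooth_section coord (fun q => nabla s q (X q)) p
}.

Definition metric_connection (g : M -> 'M[R]_7)
    (nabla : vfield -> M -> vec -> vec) : Prop :=
  connection tcoord nabla /\
  forall X Y p u, smooth_vf X p -> smooth_vf Y p ->
    dfun (fun q => inner g q (X q) (Y q)) p u =
    inner g p (nabla X p u) (Y p) + inner g p (X p) (nabla Y p u).

Definition has_torsion (nabla : vfield -> M -> vec -> vec)
    (T : M -> vec -> vec -> vec) : Prop :=
  forall X Y p, smooth_vf X p -> smooth_vf Y p ->
    T p (X p) (Y p) = nabla Y p (X p) - nabla X p (Y p) - lie X Y p.

Definition levi_civita (g : M -> 'M[R]_7)
    (nabla : vfield -> M -> vec -> vec) : Prop :=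
  metric_connection g nabla /\ has_torsion nabla (fun _ _ _ => 0).

(* The indices 1, 2, 3 are the elements of 'I_3. The even permutations of three
   letters are the cyclic ones, (i, j, k) = (i, ordS i, ordS (ordS i)). *)

Record almost_contact_metric (phi : M -> 'M[R]_7) (xi : vfield)
    (eta : M -> 'rV[R]_7) (g : M -> 'M[R]_7) : Prop := AlmostContactMetric {
  phi_smooth : smooth_endo phi;
  xi_smooth : forall p, smooth_vf xi p;
  eta_smooth : smooth_form1 eta;
  phi_sqr : forall p, phi p *m phi p = - 1%:M + xi p *m eta p;
  eta_xi : forall p, ev (eta p) (xi p) = 1;
  phi_metric : forall p u v,
    inner g p (phi p *m u) (phi p *m v) =
    inner g p u v - ev (eta p) u * ev (eta p) v
}.

Record almost_3contact_metric (phi : 'I_3 -> M -> 'M[R]_7)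
    (xi : 'I_3 -> vfield) (eta : 'I_3 -> M -> 'rV[R]_7) (g : M -> 'M[R]_7)
    : Prop := Almost3ContactMetric {
  acm_each : forall i, almost_contact_metric (phi i) (xi i) (eta i) g;
  acm_phi : forall i p, let j := ordS i in let k := ordS j in
    phi k p = phi i p *m phi j p - xi i p *m eta j p /\
    phi k p = - (phi j p *m phi i p) + xi j p *m eta i p;
  acm_xi : forall i p, let j := ordS i in let k := ordS j in
    xi k p = phi i p *m xi j p /\ xi k p = - (phi j p *m xi i p);
  acm_eta : forall i p, let j := ordS i in let k := ordS j in
    eta k p = eta i p *m phi j p /\ eta k p = - (eta j p *m phi i p)
}.

Section ThreeContact.
Variables (phi : 'I_3 -> M -> 'M[R]_7) (xi : 'I_3 -> vfield).
Variables (eta : 'I_3 -> M -> 'rV[R]_7) (g : M -> 'M[R]_7).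

Definition horizontal (p : M) (u : vec) : Prop := forall i, ev (eta i p) u = 0.

Definition vertical (p : M) (u : vec) : Prop :=
  exists c : 'I_3 -> R, u = \sum_i c i *: xi i p.

Definition Phi (i : 'I_3) (p : M) (u v : vec) : R := inner g p u (phi i p *m v).

Definition sasaki_3ad (alpha delta : R) : Prop :=
  [/\ alpha != 0, almost_3contact_metric phi xi eta g &
   forall i p X Y, let j := ordS i in let k := ordS j in
     smooth_vf X p -> smooth_vf Y p ->
     d1 (eta i) X Y p =
     2 * alpha * Phi i p (X p) (Y p)
     + 2 * (alpha - delta) * wedge11 (ev (eta j p)) (ev (eta k p)) (X p) (Y p)].

(* T is the torsion of the canonical connection nabla *)
Definition canonical_connection (alpha delta : R)
    (nabla : vfield -> M -> vec -> vec) (T : M -> vec -> vec -> vec) : Prop :=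
  let beta := 2 * (delta - 2 * alpha) in
  [/\ metric_connection g nabla, has_torsion nabla T,
   forall p u v w, inner g p (T p u v) w = - inner g p (T p v u) w /\
                   inner g p (T p u v) w = - inner g p (T p u w) v &
   forall i p u Y, let j := ordS i in let k := ordS j in
     smooth_vf Y p ->
     nabla (fun q => phi i q *m Y q) p u - phi i p *m nabla Y p u =
     beta *: (ev (eta k p) u *: (phi j p *m Y p)
              - ev (eta j p) u *: (phi k p *m Y p))].

Definition PhiH (i : 'I_3) (p : M) (u v : vec) : R :=
  let j := ordS i in let k := ordS j in
  Phi i p u v + wedge11 (ev (eta j p)) (ev (eta k p)) u v.

Definition omega (p : M) (u v w : vec) : R :=
  \sum_i wedge12 (ev (eta i p)) (PhiH i p) u v w
  + wedge111 (ev (eta 0 p)) (ev (eta 1 p)) (ev (eta 2 p)) u v w.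

End ThreeContact.

Section G2.
Variable g : M -> 'M[R]_7.

Definition onb (p : M) (e : 'I_7 -> vec) : Prop :=
  forall a b, inner g p (e a) (e b) = (a == b)%:R.

(* The standard form
   e^123 + e^145 + e^167 + e^246 - e^257 - e^347 - e^356 of the frame e *)
Definition std_form (p : M) (e : 'I_7 -> vec) (u v w : vec) : R :=
  let t (a : nat) (x : vec) := inner g p (e (inord a.-1)) x in
  let m a b c := wedge111 (t a) (t b) (t c) u v w in
  m 1%N 2%N 3%N + m 1%N 4%N 5%N + m 1%N 6%N 7%N + m 2%N 4%N 6%N
  - m 2%N 5%N 7%N - m 3%N 4%N 7%N - m 3%N 5%N 6%N.

(* Orthonormal frames in which w is standard. They all induce the same
   orientation, since G_2 is contained in SO(7). *)
Definition adapted (w : M -> vec -> vec -> vec -> R) (p : M) (e : 'I_7 -> vec)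
    : Prop :=
  onb p e /\ forall u v z, w p u v z = std_form p e u v z.

(* The Hodge dual of the 3-form w at p for the orientation making the
   orthonormal frame e positive: as e^abc /\ *e^abc = vol, *e^abc is the
   contraction of vol with e_a, e_b, e_c. *)
Definition hodge3 (p : M) (e : 'I_7 -> vec) (w : vec -> vec -> vec -> R)
    (x0 x1 x2 x3 : vec) : R :=
  let vol (U : 7.-tuple vec) :=
    \det (\matrix_(a < 7, b < 7) inner g p (e a) (tnth U b)) in
  6^-1 * \sum_a \sum_b \sum_c
    w (e a) (e b) (e c) * vol [tuple e a; e b; e c; x0; x1; x2; x3].

Definition nearly_parallel_G2 (w : M -> vec -> vec -> vec -> R) : Prop :=
  exists2 lambda : R, lambda != 0 &
  forall p, exists2 e, adapted w p e &
  forall X0 X1 X2 X3, smooth_vf X0 p -> smooth_vf X1 p ->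
    smooth_vf X2 p -> smooth_vf X3 p ->
    d3 w X0 X1 X2 X3 p =
    lambda * hodge3 p e (w p) (X0 p) (X1 p) (X2 p) (X3 p).

End G2.

(* A spin structure, through its real spinor bundle P_Spin x_gamma R^8, where
   gamma is a representation of Cl_7 on R^8 (necessarily irreducible). Near
   each p, [sframe p] is a local orthonormal frame and [scoord p] gives
   coordinates with respect to the local frame of spinors covering it, so that
   e_i acts by the constant matrix gamma i. Two such frames of spinors differ
   by an element of O(8) covering the change of orthonormal frame, that is, by
   an element of Spin(7), because the commutant of gamma in O(8) is {1, -1}.
   All orthonormal frames [sframe p] define the same orientation: the product
   of the gamma i is a scalar, and changes sign with the orientation.
   The fibre metric is the standard inner product of R^8. *)
Record spin_bundle (g : M -> 'M[R]_7) := SpinBundle {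
  gamma : 'I_7 -> 'M[R]_8;
  sframe : M -> 'I_7 -> vfield;
  scoord : M -> M -> 'M[R]_8;
  clif : M -> vec -> 'M[R]_8;
  gamma_clifford : forall i j,
    gamma i *m gamma j + gamma j *m gamma i = (- 2 * (i == j)%:R)%:M;
  gamma_skew : forall i, (gamma i)^T = - gamma i;
  clif_linear : forall p (c : R) u v,
    clif p (c *: u + v) = c *: clif p u + clif p v;
  sframe_smooth : forall p i, smooth_vf (sframe p i) p;
  sframe_onb : forall p, \forall q \near p, onb g q (fun i => sframe p i q);
  scoord_orth : forall p, \forall q \near p,
    scoord p q *m (scoord p q)^T = 1%:M;
  scoord_smooth : forall p, \forall q \near p, forall a b,
    smooth_fun (fun r => (scoord p r *m (scoord q r)^T) a b) q;
  clif_frame : forall p, \forall q \near p, forall i,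
    scoord p q *m clif q (sframe p i q) = gamma i *m scoord p q
}.

Section Spinors.
Variables (g : M -> 'M[R]_7) (Sigma : spin_bundle g).
Local Notation spinor := (M -> 'cV[R]_8).

Definition smooth_spinor (psi : spinor) : Prop :=
  forall p, smooth_section (scoord Sigma) psi p.

(* The covariant derivative on spinors induced by the Levi-Civita connection
   nablag: in the local frame of spinors s_a covering the orthonormal frame
   e_i, nabla_u s_a = 1/4 sum_ij g(nablag_u e_i, e_j) e_i . e_j . s_a *)
Definition spin_connection (nablag : vfield -> M -> vec -> vec)
    (nablaS : spinor -> M -> vec -> 'cV[R]_8) : Prop :=
  connection (scoord Sigma) nablaS /\
  forall p, \forall q \near p, forall u (a : 'I_8),
    let e i := sframe Sigma p i in
    let s r := (scoord Sigma p r)^T *m delta_mx a 0 in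
    nablaS s q u =
    4^-1 *: \sum_i \sum_j inner g q (nablag (e i) q u) (e j q)
      *: (clif Sigma q (e i q) *m clif Sigma q (e j q) *m s q).

(* The basis of T_pM dual to the coordinate basis with respect to g *)
Definition dual_basis (p : M) (a : 'I_7) : vec := col a (invmx (g p)).

Definition clif_basis (p : M) (a : 'I_7) : 'M[R]_8 :=
  clif Sigma p (delta_mx a 0).

(* Clifford actions of forms. By alternation these do not depend on the basis;
   for an orthonormal basis they are sum_{a<b} s(e_a,e_b) e_a . e_b and
   sum_{a<b<c} w(e_a,e_b,e_c) e_a . e_b . e_c. *)
Definition clif2 (p : M) (s : vec -> vec -> R) : 'M[R]_8 :=
  let E := dual_basis p in let c := clif_basis p in
  2^-1 *: \sum_a \sum_b s (E a) (E b) *: (c a *m c b).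

Definition clif3 (p : M) (w : vec -> vec -> vec -> R) : 'M[R]_8 :=
  let E := dual_basis p in let c := clif_basis p in
  6^-1 *: \sum_a \sum_b \sum_d w (E a) (E b) (E d) *: (c a *m c b *m c d).

(* Selects the one of the two representations of Cl_7 *)
Definition clif_normalized (w : M -> vec -> vec -> vec -> R) : Prop :=
  forall p, let W := clif3 p (w p) in
  [/\ W^T = W, \rank (eigenspace W (- 7)) = 1%N & \rank (eigenspace W 1) = 7%N].

(* The lift of the metric connection with skew torsion T *)
Definition spin_torsion (nablaS : spinor -> M -> vec -> 'cV[R]_8)
    (T : M -> vec -> vec -> vec) (psi : spinor) (p : M) (u : vec) : 'cV[R]_8 :=
  nablaS psi p u
  + 4^-1 *: (clif2 p (fun v w => inner g p (T p u v) w) *m psi p).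

Definition canonical_spinor (nablaS : spinor -> M -> vec -> 'cV[R]_8)
    (T : M -> vec -> vec -> vec) (w : M -> vec -> vec -> vec -> R)
    (psi : spinor) : Prop :=
  [/\ smooth_spinor psi,
   forall p u, spin_torsion nablaS T psi p u = 0,
   forall p, clif3 p (w p) *m psi p = (- 7) *: psi p &
   forall p, ((psi p)^T *m psi p) 0 0 = 1].

Definition killing_endo (nablaS : spinor -> M -> vec -> 'cV[R]_8)
    (psi : spinor) (S : M -> 'M[R]_7) : Prop :=
  [/\ smooth_endo S,
   forall p u v, inner g p (S p *m u) v = inner g p u (S p *m v) &
   forall p u, nablaS psi p u = clif Sigma p (S p *m u) *m psi p].

Definition generalized_killing (nablaS : spinor -> M -> vec -> 'cV[R]_8)
    (psi : spinor) : Prop :=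
  smooth_spinor psi /\ exists S, killing_endo nablaS psi S.

Definition killing_number (nablaS : spinor -> M -> vec -> 'cV[R]_8)
    (psi : spinor) (a : R) : Prop :=
  exists2 S, killing_endo nablaS psi S &
  exists p (u : vec), u != 0 /\ S p *m u = a *: u.

End Spinors.

End Geometry.

(* Main.v *)
Require Import Defs.
From HB Require Import structures.
From mathcomp Require Import all_boot all_order all_algebra.
From mathcomp Require Import all_classical all_reals all_analysis.
From mathcomp Require Import ring lra.

Set Implicit Arguments.
Unset Strict Implicit.
Unset Printing Implicit Defensive.

Import Order.TTheory GRing.Theory Num.Theory.
Import numFieldNormedType.Exports.
Local Open Scope classical_set_scope.
Local Open Scope ring_scope.

(* Let T be the torsion of the canonical connection nabla. The formulas for
   nabla xi_i and d eta_i determine g(T(X,Y),Z) as soon as one argument is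
   vertical. On H, where nabla phi_1 vanishes in horizontal directions,
   d(d eta_1) = 0 says that the cyclic sum of g(T(X,Y),phi_1 Z) is zero; since
   dim H = 4, this forces T = 0 on H. Hence
     T = 2 alpha omega + 2 (delta - 5 alpha) eta_1 /\ eta_2 /\ eta_3.
   In an orthonormal frame (xi_1, xi_2, xi_3, x, -phi_1 x, -phi_2 x, phi_3 x)
   the form omega is a signed sum of seven decomposable 3-forms. They act on
   spinors by symmetric involutions, so omega psi_0 = -7 psi_0 means that each
   signed one maps psi_0 to -psi_0. This gives (u _| omega) psi_0 = 3 u psi_0,
   hence nabla^g psi_0, and the products xi_i v psi_0, hence nabla^g psi_i by
   the Leibniz rule. Finally nabla omega = 0 expresses d omega through T; for
   delta = 5 alpha, T = 2 alpha omega and d omega = 12 alpha *omega. *)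

(** * Calculus in a chart *)

(** What the first-order equations leave open is T on three horizontal vectors; for it an
    integrability condition must be extracted from d(d eta_1) = 0. Only there do second derivatives
    of the data enter, which calls for their symmetry and for fields that commute near p: the
    coordinate fields of the chart at p. Once T is known, everything is linear algebra at one point,
    in a frame whose signs make omega the standard form.

    The seven triples of omega form a Fano plane: every index lies in three of them, whence the
    factor 3 and the Killing number -(1/4)(2 alpha) 3 = -3 alpha/2 on H. The extra term eta_1 /\
    eta_2 /\ eta_3 involves one triple only and adds -(1/4) 2 (delta - 5 alpha) on V, giving (2
    alpha - delta)/2.

    The list of Killing numbers is complete because u -> u psi is injective for psi nonzero, so that
    the spinor determines S.

    The constant 12 alpha is 2 alpha times 2 times 3: d omega has six terms, equal in pairs, and the
    alternated sum of the products of cross products is three times the Hodge dual. *)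

Lemma near_eq_differentiable (R : realType) (V W : normedModType R)
    (f g : V -> W) (x : V) : (\near x, f x = g x) ->
  differentiable f x -> differentiable g x.
Proof.
move=> fg df.
have fgx : f x = g x := nbhs_singleton fg.
have [dc Hf] := (diff_locallyP _ _).1 df.
have E : g \o shift x = cst (g x) + 'd f x +o_ 0 id.
  apply/eqaddoP => eps e0.
  have /eqaddoP/(_ eps e0) Hf' := Hf.
  have fg0 : \forall h \near (0 : V), f (h + x) = g (h + x).
    by have := fg; rewrite (near_shift 0 x) subr0.
  apply: filterS2 fg0 Hf' => h.
  by rewrite !fctE /= fgx => ->.
have E2 : 'd g x = 'd f x :> (V -> W) by apply: diff_unique.
by apply/diff_locallyP; rewrite E2; split.
Qed.

Lemma derive_comp (R : realType) (V W Z : normedModType R) (h : V -> W)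
    (f : W -> Z) (x v : V) :
  differentiable h x -> differentiable f (h x) ->
  'D_v (fun y => f (h y)) x = 'D_('D_v h x) f (h x).
Proof.
move=> dh df; rewrite (deriveE v dh) (deriveE _ df).
by rewrite (deriveE v (differentiable_comp dh df)) (diff_comp dh df).
Qed.

Lemma nbhs_open (T : topologicalType) (x : T) (A : set T) :
  nbhs x A -> exists2 B, open_nbhs x B & B `<=` A.
Proof. by rewrite nbhsE. Qed.

Section Calculus.
Variable R : realType.
Local Notation V := 'cV[R]_7.
Local Notation iterD := (@Defs.iterD R).
Implicit Types (f g : V -> R^o) (U W : set V) (x y u v : V).

(** Smoothness cut off at a finite order over a fixed set. The derivatives of a function of order
    n+1 have order n, so closure under sums, products and composition is an induction on n; an open
    U lets equalities on U be differentiated. *)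
Fixpoint diff_upto (n : nat) (U : set V) (f : V -> R^o) : Prop :=
  (forall x, U x -> differentiable f x) /\
  if n is n'.+1 then forall v, diff_upto n' U (fun x => 'D_v f x) else True.

Lemma diff_uptoS n U f : diff_upto n.+1 U f -> diff_upto n U f.
Proof.
elim: n f => [|n IH] f /= [df Hf]; split=> //.
by move=> v; apply: IH; exact: Hf.
Qed.

Lemma iterD_rcons vs v f : iterD (rcons vs v) f = iterD vs (fun x => 'D_v f x).
Proof. by rewrite /iterD foldr_rcons. Qed.

(** [iterD] applies the head of the list last, whereas [diff_upto] peels off the derivative taken
    first; hence the induction from the end of the list. *)
Lemma diff_uptoP U f : (forall n, diff_upto n U f) <->
  (forall vs y, U y -> differentiable (iterD vs f) y).
Proof.
split=> [H vs|H n].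
  have {H} := H (size vs); elim/last_ind: vs f => [|vs v IH] f.
    by move=> [].
  rewrite size_rcons iterD_rcons => -[_ H]; exact: IH (H v).
elim: n f H => [|n IH] f H; split=> //; try by move=> x; apply: (H [::]).
by move=> v; apply: IH => vs y; rewrite -iterD_rcons; apply: H.
Qed.

Lemma smooth_nearP f x : smooth_near f x <->
  exists2 U, open_nbhs x U & forall n, diff_upto n U f.
Proof.
split=> [|[U [oU Ux] H]].
  rewrite /smooth_near -nbhs_nearE nbhsE => -[U oU H].
  by exists U => //; apply/diff_uptoP => vs y Uy; exact: H.
rewrite /smooth_near -nbhs_nearE nbhsE; exists U => // y Uy vs.
by move/diff_uptoP: H; apply.
Qed.

Lemma diff_upto_sub n U W f : W `<=` U -> diff_upto n U f -> diff_upto n W f.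
Proof.
move=> WU; elim: n f => [|n IH] f /= [df H]; split=> //; try by move=> x /WU
  /df.
by move=> v; exact: IH.
Qed.

Lemma diff_upto_eq n U f g : open U -> (forall x, U x -> f x = g x) ->
  diff_upto n U f -> diff_upto n U g.
Proof.
move=> oU; elim: n f g => [|n IH] f g fg /= [df H].
  split=> // x Ux; apply: near_eq_differentiable (df x Ux).
  by apply: filterS (open_nbhs_nbhs (conj oU Ux)) => y; exact: fg.
split=> [x Ux|v].
  apply: near_eq_differentiable (df x Ux).
  by apply: filterS (open_nbhs_nbhs (conj oU Ux)) => y; exact: fg.
apply: IH (H v) => x Ux; apply: near_eq_derive.
by apply: filterS (open_nbhs_nbhs (conj oU Ux)) => y; exact: fg.
Qed.

Lemma diff_upto_cst n U (c : R) : diff_upto n U (fun=> c).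
Proof.
elim: n c => [|n IH] c; split=> //; try by move=> x _; exact:
  differentiable_cst.
move=> v; have -> : (fun x => 'D_v (fun=> c : R^o) x) = (fun=> 0 : R^o).
  by apply/funext => x; exact: derive_cst.
exact: IH.
Qed.

Lemma diff_uptoD n U f g : open U -> diff_upto n U f -> diff_upto n U g ->
  diff_upto n U (fun x => f x + g x).
Proof.
move=> oU; elim: n f g => [|n IH] f g [df Hf] [dg Hg].
  by split=> // x Ux; apply: differentiableD; auto.
split=> [x Ux|v]; first by apply: differentiableD; auto.
apply: diff_upto_eq (IH _ _ (Hf v) (Hg v)) => // x Ux /=.
by rewrite deriveD //; apply: diff_derivable; auto.
Qed.

(** By the Leibniz rule the derivative is a sum of products of functions of order n, the
    undifferentiated factors being lowered by one order. *)
Lemma diff_uptoM n U f g : open U -> diff_upto n U f -> diff_upto n U g ->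
  diff_upto n U (fun x => f x * g x).
Proof.
move=> oU; elim: n f g => [|n IH] f g Hf Hg.
  by split=> // x Ux; apply: (@differentiableM R V f g);
     [case: Hf|case: Hg]; auto.
split=> [x Ux|v].
  by apply: (@differentiableM R V f g); [case: Hf|case: Hg]; auto.
have H : diff_upto n U (fun x => f x * 'D_v g x + g x * 'D_v f x).
  apply: diff_uptoD => //; apply: IH; try exact: diff_uptoS.
    by case: Hg => _; exact.
  by case: Hf => _; exact.
apply: diff_upto_eq H => // x Ux /=.
by rewrite (@deriveM R V f g) //; apply: diff_derivable; [case: Hf|case: Hg];
  auto.
Qed.

Lemma diff_upto_sum n U m (f : 'I_m -> V -> R^o) : open U ->
  (forall i, diff_upto n U (f i)) -> diff_upto n U (fun x => \sum_i f i x).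
Proof.
move=> oU H; have -> : (fun x => \sum_i f i x) = \sum_i f i.
  by apply/funext => x; rewrite fct_sumE.
elim/big_ind : _ => //; first exact: diff_upto_cst.
by move=> ? ? *; exact: diff_uptoD.
Qed.

Lemma differentiable_mx (h : V -> V) x :
  (forall i, differentiable (fun y => h y i 0 : R^o) x) -> differentiable h x.
Proof.
move=> H.
have -> : h = \sum_i (fun y => (h y i 0 : R) *: delta_mx i (0 : 'I_1)).
  apply/funext => y; rewrite fct_sumE {1}[h y]matrix_sum_delta.
  by apply: eq_bigr => i _; rewrite big_ord1.
apply: differentiable_sum => i.
exact: (@differentiableZl R V V (fun y => h y i 0 : R)).
Qed.

Lemma derive_addZ f x (u v : V) (t : R) : differentiable f x ->
  'D_(u + t *: v) f x - 'D_u f x = t * 'D_v f x.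
Proof. by move=> df; rewrite !deriveE // linearD addrAC subrr add0r linearZ.
  Qed.

Lemma derive_sum_coord f x v : differentiable f x ->
  'D_v f x = \sum_i v i 0 * 'D_(delta_mx i 0) f x.
Proof.
move=> df; rewrite deriveE // {1}[v]matrix_sum_delta linear_sum.
by apply: eq_bigr => i _; rewrite big_ord1 linearZ /= deriveE.
Qed.

Lemma derive_col (h : V -> V) x v : differentiable h x ->
  forall i, ('D_v h x) i 0 = 'D_v (fun y => h y i 0 : R^o) x.
Proof.
by move=> dh i; rewrite derive_mx ?mxE //; exact: diff_derivable.
Qed.

Lemma derive_comp_sum (h : V -> V) f x v :
  differentiable h x -> differentiable f (h x) ->
  'D_v (fun y => f (h y)) x =
  \sum_i 'D_v (fun y => h y i 0 : R^o) x * 'D_(delta_mx i 0) f (h x).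
Proof.
move=> dh df; rewrite (derive_comp v dh df) derive_sum_coord //.
by apply: eq_bigr => i _; rewrite derive_col.
Qed.

(** The chain rule writes a derivative of f o h as a sum of D h_i times (D_i f) o h. The induction
    hypothesis applies to the partial derivatives of f with the same inner map h. *)
Lemma diff_upto_comp n U W f (h : V -> V) : open U ->
  (forall x, U x -> W (h x)) ->
  (forall i, diff_upto n U (fun x => h x i 0)) -> diff_upto n W f ->
  diff_upto n U (fun x => f (h x)).
Proof.
move=> oU UW; elim: n f => [|n IH] f Hh Hf.
  split=> // x Ux; apply: (@differentiable_comp R V V R^o h f).
    by apply: differentiable_mx => i; case: (Hh i) => dh _; exact: dh.
  by case: Hf => df _; apply: df; exact: UW.
have dh x : U x -> differentiable h x.
  by move=> Ux; apply: differentiable_mx => i; case: (Hh i) => dh _; exact: dh.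
have df x : U x -> differentiable f (h x).
  by move=> /UW Wx; case: Hf => + _; apply.
split=> [x Ux|v].
  by apply: (@differentiable_comp R V V R^o h f); [exact: dh|exact: df].
have H : diff_upto n U (fun x => \sum_i 'D_v (fun y => h y i 0 : R^o) x
    * 'D_(delta_mx i 0) f (h x)).
  apply: diff_upto_sum => // i; apply: diff_uptoM => //.
    by case: (Hh i) => _; exact.
  apply: (IH (fun x => 'D_(delta_mx i 0) f x)).
    by move=> j; exact: diff_uptoS.
  by case: Hf => _; exact.
by apply: diff_upto_eq H => // x Ux /=; rewrite derive_comp_sum //; auto.
Qed.

Lemma smooth_near_eq f g x : (\near x, f x = g x) ->
  smooth_near f x -> smooth_near g x.
Proof.
move=> fg /smooth_nearP[U oU HU]; apply/smooth_nearP.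
have := fg; rewrite -nbhs_nearE nbhsE => -[W oW HW].
exists (U `&` W); first exact: open_nbhsI.
move=> n; apply: (@diff_upto_eq _ _ f).
- by case: (open_nbhsI oU oW).
- by move=> y [_ /HW].
- by apply: diff_upto_sub (HU n) => y [].
Qed.

Lemma smooth_near_op (op : R -> R -> R) x :
  (forall n U f g, open U -> diff_upto n U f -> diff_upto n U g ->
     diff_upto n U (fun y => op (f y) (g y))) ->
  forall f g, smooth_near f x -> smooth_near g x ->
    smooth_near (fun y => op (f y) (g y)) x.
Proof.
move=> H f g /smooth_nearP[U oU HU] /smooth_nearP[W oW HW]; apply/smooth_nearP.
have oUW := open_nbhsI oU oW; exists (U `&` W) => // n.
by apply: H; [case: oUW|apply: diff_upto_sub (HU n) => y []|
  apply: diff_upto_sub (HW n) => y []].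
Qed.

Lemma smooth_nearD f g x : smooth_near f x -> smooth_near g x ->
  smooth_near (fun y => f y + g y) x.
Proof. by apply: smooth_near_op => n U f' g'; exact: diff_uptoD. Qed.

Lemma smooth_nearM f g x : smooth_near f x -> smooth_near g x ->
  smooth_near (fun y => f y * g y) x.
Proof. by apply: smooth_near_op => n U f' g'; exact: diff_uptoM. Qed.

Lemma smooth_near_cst (c : R) x : smooth_near (fun=> c) x.
Proof.
apply/smooth_nearP; exists setT; first by split=> //; exact: openT.
by move=> n; exact: diff_upto_cst.
Qed.

Lemma smooth_near_comp f (h : V -> V) x : 
  (forall i, smooth_near (fun y => h y i 0) x) -> smooth_near f (h x) ->
  smooth_near (fun y => f (h y)) x.
Proof.
move=> hh /smooth_nearP[W [oW Wx] HW].
have /choice[U HU] : forall i, exists U, open_nbhs x U /\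
    forall n, diff_upto n U (fun y => h y i 0).
  by move=> i; have /smooth_nearP[U] := hh i; exists U.
have dh : differentiable h x.
  apply: differentiable_mx => i; have [[_ Ux] /(_ 0%N) []] := HU i.
  by move=> H _; exact: H.
have hW : nbhs x (h @^-1` W).
  by apply: (differentiable_continuous dh); apply: open_nbhs_nbhs.
have HI : \forall y \near x, forall i, U i y.
  apply: (@filter_forall V 'I_7 U _ (nbhs_filter x)) => i.
  by have [oUi _] := HU i; exact: open_nbhs_nbhs.
have [B oB HB] := @nbhs_open V x _ (filterI hW HI).
apply/smooth_nearP; exists B => // n; have [oB' Bx] := oB; apply:
  (@diff_upto_comp n B W) (HW n) => //.
  by move=> y /HB [].
by move=> i; apply: diff_upto_sub ((HU i).2 n) => y /HB [_]; apply.
Qed.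

Lemma smooth_near_diff f x : smooth_near f x -> differentiable f x.
Proof. by move=> /nbhs_singleton/(_ [::]). Qed.

Lemma smooth_near_derive f x v : smooth_near f x ->
  smooth_near (fun y => 'D_v f y) x.
Proof.
move=> /smooth_nearP[U oU HU]; apply/smooth_nearP; exists U => // n.
by case: (HU n.+1) => _; exact.
Qed.

Lemma smooth_near_near f x : smooth_near f x -> \near x, smooth_near f x.
Proof. by rewrite /smooth_near => /nbhs_interior. Qed.

(** * Symmetry of second derivatives *)

Lemma is_derive_line f (u w : V) (s : R) : differentiable f (s *: u + w) ->
  is_derive s (1 : R) (fun r : R => f (r *: u + w)) ('D_u f (s *: u + w)).
Proof.
move=> df.
have dl : is_diff s (fun r : R => r *: u + w) (fun r : R => r *: u).
  have -> : (fun r : R => r *: u + w) = (fun r : R => r *: u) + cst w by [].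
  (* Inserting the constant 0 exhibits the claimed differential as that of the linear part plus the
     differential 0 of the constant w. *)
  have -> : (fun r : R => r *: u) = (fun r : R => r *: u) + cst 0.
    by apply/funext => r; rewrite fctE /= addr0.
  have H : (fun r : R => r *: u) = *:%R ^~ u by [].
  by rewrite -[X in is_diff _ X]addrA add0r; exact: is_diffD.
have dc : differentiable (fun r : R => f (r *: u + w)) s.
  by apply: (@differentiable_comp R _ V R^o (fun r : R => r *: u + w) f).
apply: DeriveDef; first exact: diff_derivable.
rewrite !deriveE //.
rewrite (@diff_comp R _ V R^o (fun r : R => r *: u + w) f) //=.
by rewrite (diff_val (f := fun r : R => r *: u + w)) scale1r.
Qed.

(** The mean value theorem along u reduces the second difference to t times D_u f at c u + t v + x
    minus D_u f at c u + x, with c between 0 and t. Expanding D_u f to first order at x, the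
    contributions of c u cancel and t D_v D_u f remains. Differentiability of D_u f at the single
    point x is enough for this. *)
Lemma second_difference f (x u v : V) :
  (\near x, differentiable f x) ->
  differentiable (fun y => 'D_u f y) x ->
  forall e, 0 < e -> \forall t \near (0 : R)^'+,
    `|f (x + t *: u + t *: v) - f (x + t *: u) - f (x + t *: v) + f x
      - t ^+ 2 * 'D_v (fun y => 'D_u f y) x| <= e * t ^+ 2.
Proof.
move=> df dG e e0.
(* N bounds the two displacements: |c u| + |c u + t v| is at most t (2 |u| + |v|) for c in [0, t].
   The summand 1 makes N positive, so that e / N is a legitimate tolerance. *)
pose G : V -> R^o := fun y => 'D_u f y; set N := 2 * `|u| + `|v| + 1.
have N0 : 0 < N by rewrite /N; have := normr_ge0 u; have := normr_ge0 v; lra.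
have [_ /eqaddoP/(_ (e / N) (divr_gt0 e0 N0)) HG] := (diff_locallyP _ _).1 dG.
have df0 : \forall h \near (0 : V), differentiable f (h + x).
  by have := df; rewrite (near_shift 0 x) subr0.
have [r /= r0 Hr] := (@nbhs_ballP _ _ _ _).1 (filterI HG df0).
have {}Hr (h : V) : `|h| < r ->
    `|G (h + x) - G x - 'D_h G x| <= e / N * `|h| /\ differentiable f (h + x).
  move=> hr; have [|H1 H2] := Hr h; first by rewrite -ball_normE /= sub0r
    normrN.
  split=> //; move: H1; rewrite !fctE /= -(deriveE h dG).
  by rewrite opprD addrA.
near=> t.
have t0 : 0 < t by near: t; exact: nbhs_right_gt.
have tr : t * N < r.
  by rewrite -ltr_pdivlMr //; near: t; apply: nbhs_right_lt; apply: divr_gt0.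
have Hc c : 0 <= c <= t -> `|c *: u| < r /\ `|c *: u + t *: v| < r /\
     `|c *: u| + `|c *: u + t *: v| <= t * N.
  move=> /andP[c0 ct].
  have A : `|c *: u| <= t * `|u|.
    by rewrite normrZ ger0_norm // ler_wpM2r.
  have B : `|c *: u + t *: v| <= t * `|u| + t * `|v|.
    apply: le_trans (ler_normD _ _) _; apply: lerD => //.
    by rewrite normrZ gtr0_norm.
  have tu : 0 <= t * `|u| by rewrite mulr_ge0 // ltW.
  have tv : 0 <= t * `|v| by rewrite mulr_ge0 // ltW.
  have E : t * N = 2 * (t * `|u|) + t * `|v| + t by rewrite /N; ring.
  by split; [|split]; lra.
pose phi s := f (s *: u + (t *: v + x)) - f (s *: u + x).
have dphi s : 0 <= s <= t -> is_derive s (1 : R) (phi : R -> R^o)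
   (G (s *: u + (t *: v + x)) - G (s *: u + x)).
  move=> Hs; have [h1 [h2 _]] := Hc s Hs.
  apply: is_deriveB; apply: is_derive_line; first by rewrite addrA; case: (Hr _
    h2).
  by case: (Hr _ h1).
have [c /[!in_itv]/= /andP[c0 ct] HE] : exists2 c, c \in `]0, t[ & phi t - phi 0
  =
   (G (c *: u + (t *: v + x)) - G (c *: u + x)) * (t - 0).
  apply: (@MVT R (phi : R -> R^o) (fun s => G (s *: u + (t *: v + x)) - G (s *:
    u + x))) => //.
    move=> s; rewrite in_itv /= => /andP[s0 st]; apply: dphi.
    by rewrite !ltW.
  apply: derivable_within_continuous => s; rewrite in_itv /= => Hs.
  by have [] := dphi s Hs.
have Hc' : 0 <= c <= t by rewrite !ltW.
have [h1 [h2 h3]] := Hc c Hc'.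
have [A1 _] := Hr _ h1; have [A2 _] := Hr _ h2.
have E1 : f (x + t *: u + t *: v) - f (x + t *: u) - f (x + t *: v) + f x
    = phi t - phi 0.
  rewrite /phi !scale0r !add0r addrA.
  have -> : x + t *: u + t *: v = t *: u + t *: v + x by rewrite -addrA addrC.
  by rewrite [x + t *: u]addrC [x + t *: v]addrC; ring.
have E2 : 'D_(c *: u + t *: v) G x - 'D_(c *: u) G x = t * 'D_v G x.
  exact: derive_addZ.
have E3 : f (x + t *: u + t *: v) - f (x + t *: u) - f (x + t *: v) + f x
   - t ^+ 2 * 'D_v G x =
   t * ((G (c *: u + t *: v + x) - G x - 'D_(c *: u + t *: v) G x) -
        (G (c *: u + x) - G x - 'D_(c *: u) G x)).
  rewrite E1 HE subr0 addrA expr2 -mulrA -E2.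
  move: ('D_(_) G x) ('D_(_) G x) (G _) (G _) (G _) => d1 d2 g1 g2 g3.
  by ring.
rewrite E3 normrM gtr0_norm // expr2 mulrA [e * t]mulrC -mulrA ler_pM2l //.
apply: le_trans (ler_normB _ _) _; apply: le_trans (lerD A2 A1) _.
rewrite -mulrDr -mulrA ler_pM2l // addrC.
by rewrite mulrC ler_pdivrMr.
Unshelve. all: by end_near. Qed.

(** The second difference is symmetric in u and v. Each mixed derivative, multiplied by t^2,
    approximates it up to (e / 2) t^2, so the two differ by at most e. *)
Lemma derive_swap f (x u v : V) : smooth_near f x ->
  'D_u (fun y => 'D_v f y) x = 'D_v (fun y => 'D_u f y) x.
Proof.
move=> sf.
have df : \near x, differentiable f x.
  by apply: filterS (smooth_near_near sf) => y /smooth_near_diff.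
have dG w : differentiable (fun y => 'D_w f y) x.
  exact/smooth_near_diff/smooth_near_derive.
apply/eqP; rewrite -subr_eq0 -normr_eq0; apply/eqP/le_anti.
rewrite normr_ge0 andbT; apply/ler_addgt0Pl => e e0; rewrite addr0.
have e2 : 0 < e / 2 by rewrite divr_gt0.
have F1 := second_difference v df (dG u) e2.
have F2 := second_difference u df (dG v) e2.
near (0 : R)^'+ => t.
have t0 : 0 < t by near: t; exact: nbhs_right_gt.
have := near F1 t; have := near F2 t.
move=> /(_ _)/wrap[]//; set a := 'D_u _ x => H2; move=> /(_ _)/wrap[]//; set b
  := 'D_v _ x => H1.
have t2 : 0 < t ^+ 2 by rewrite exprn_gt0.
rewrite -(ler_pM2r t2) -{1}(gtr0_norm t2) -normrM.
have -> : (a - b) * t ^+ 2 = (f (x + t *: u + t *: v) - f (x + t *: u) - f (x +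
  t *: v) + f x - t ^+ 2 * b) - (f (x + t *: v + t *: u) - f (x + t *: v) - f (x
  + t *: u) + f x - t ^+ 2 * a).
  by rewrite [x + t *: v + t *: u]addrAC; ring.
apply: le_trans (ler_normB _ _) _.
by apply: le_trans (lerD H1 H2) _; rewrite -mulrDl -splitr.
Unshelve. all: by end_near. Qed.

End Calculus.

(** * Smooth functions, fields and connections on the manifold *)

Section Manifold.
Variables (R : realType) (M : topologicalType) (A : manifold7 R M).
Local Notation V := 'cV[R]_7.
Implicit Types (p q r : M) (f h : M -> R) (u v w : V).

Lemma nbhs_param p q (P : set M) : dom A p q -> nbhs q P ->
  \forall x \near chart A p q, P (param A p x).
Proof.
move=> pq qP; apply: (param_continuous (m := A) pq).
by rewrite (chartK (m := A) pq).
Qed.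

Lemma nbhs_dom p q : dom A p q -> nbhs q (dom A p).
Proof. by move=> pq; apply: open_nbhs_nbhs; split=> //; exact: dom_open. Qed.

Lemma near_paramK p q : dom A p q ->
  \forall x \near chart A p q, chart A p (param A p x) = x.
Proof.
move=> pq; have : nbhs (chart A p q) (chart A p @` dom A p).
  by apply: open_nbhs_nbhs; split; [exact: chart_open|exists q].
by apply: filterS => x [r pr <-]; rewrite chartK.
Qed.

Lemma smooth_fun_eq f h p : (\forall q \near p, f q = h q) ->
  smooth_fun A f p -> smooth_fun A h p.
Proof.
by move=> fh; apply: smooth_near_eq; apply: nbhs_param fh; exact: dom_self.
Qed.

Lemma dfun_eq f h p u : (\forall q \near p, f q = h q) ->
  dfun A f p u = dfun A h p u.
Proof.
by move=> fh; apply: near_eq_derive; apply: nbhs_param fh; exact: dom_self.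
Qed.

Lemma smooth_fun_cst (c : R) p : smooth_fun A (fun=> c) p.
Proof. exact: smooth_near_cst. Qed.

Lemma smooth_funD f h p : smooth_fun A f p -> smooth_fun A h p ->
  smooth_fun A (fun q => f q + h q) p.
Proof. exact: smooth_nearD. Qed.

Lemma smooth_funM f h p : smooth_fun A f p -> smooth_fun A h p ->
  smooth_fun A (fun q => f q * h q) p.
Proof. exact: smooth_nearM. Qed.

Lemma smooth_fun_sum (I : finType) (f : I -> M -> R) p :
  (forall i, smooth_fun A (f i) p) -> smooth_fun A (fun q => \sum_i f i q) p.
Proof.
move=> H; have -> : (fun q => \sum_i f i q) = \sum_i f i.
  by apply/funext => q; rewrite fct_sumE.
by elim/big_ind : _ => // *; [exact: smooth_fun_cst|exact: smooth_funD].
Qed.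

Lemma dfunD f h p u : smooth_fun A f p -> smooth_fun A h p ->
  dfun A (fun q => f q + h q) p u = dfun A f p u + dfun A h p u.
Proof.
move=> sf sh; rewrite /dfun.
by apply: deriveD; apply: diff_derivable; exact: smooth_near_diff.
Qed.

Lemma dfunM f h p u : smooth_fun A f p -> smooth_fun A h p ->
  dfun A (fun q => f q * h q) p u = f p * dfun A h p u + h p * dfun A f p u.
Proof.
move=> sf sh; rewrite /dfun.
rewrite (@deriveM R V (fun x => f (param A p x)) (fun x => h (param A p x))).
- by rewrite /= chartK //; exact: dom_self.
- by apply: diff_derivable; exact: smooth_near_diff.
- by apply: diff_derivable; exact: smooth_near_diff.
Qed.

Lemma dfun_cst (c : R) p u : dfun A (fun=> c) p u = 0.
Proof. exact: derive_cst. Qed.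

Lemma dfunZ (c : R) f p u : smooth_fun A f p ->
  dfun A (fun q => c * f q) p u = c * dfun A f p u.
Proof.
move=> sf; rewrite dfunM //; last exact: smooth_fun_cst.
by rewrite dfun_cst mulr0 addr0.
Qed.

Lemma dfun_sum (I : finType) (f : I -> M -> R) p u :
  (forall i, smooth_fun A (f i) p) ->
  dfun A (fun q => \sum_i f i q) p u = \sum_i dfun A (f i) p u.
Proof.
move=> H; have -> : (fun q => \sum_i f i q) = \sum_i f i.
  by apply/funext => q; rewrite fct_sumE.
(* Smoothness of the partial sums is carried along, as additivity of the derivative requires it. *)
pose K (h : M -> R) t := smooth_fun A h p /\ dfun A h p u = t.
suff [] : K (\sum_i f i) (\sum_i dfun A (f i) p u) by [].
elim/big_ind2 : _ => [|s1 t1 s2 t2 [? <-] [? <-]|i _]; split=> //.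
- exact: smooth_fun_cst.
- exact: dfun_cst.
- exact: smooth_funD.
- exact: dfunD.
Qed.

Section Sections.
Variables (m : nat) (coord : M -> M -> 'M[R]_m).
Implicit Types s t : M -> 'cV[R]_m.

Lemma smooth_section_eq s t p : (\forall q \near p, s q = t q) ->
  smooth_section A coord s p -> smooth_section A coord t p.
Proof.
by move=> st ss a; apply: smooth_fun_eq (ss a); apply: filterS st => q ->.
Qed.

Lemma smooth_sectionD s t p : smooth_section A coord s p ->
  smooth_section A coord t p -> smooth_section A coord (fun q => s q + t q) p.
Proof.
move=> ss st a; under [X in smooth_fun _ X]funext do rewrite mulmxDr mxE.
exact: smooth_funD.
Qed.

Lemma smooth_sectionZ f s p : smooth_fun A f p -> smooth_section A coord s p ->
  smooth_section A coord (fun q => f q *: s q) p.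
Proof.
move=> ss st a; under [X in smooth_fun _ X]funext do rewrite -scalemxAr mxE.
exact: smooth_funM.
Qed.

Lemma smooth_section0 p : smooth_section A coord (fun=> 0) p.
Proof.
move=> a; under [X in smooth_fun _ X]funext do rewrite mulmx0 mxE.
exact: smooth_fun_cst.
Qed.

Lemma smooth_section_sum (I : finType) (s : I -> M -> 'cV[R]_m) p :
  (forall i, smooth_section A coord (s i) p) ->
  smooth_section A coord (fun q => \sum_i s i q) p.
Proof.
move=> H; have -> : (fun q => \sum_i s i q) = \sum_i s i.
  by apply/funext => q; rewrite fct_sumE.
by elim/big_ind : _ => // *; [exact: smooth_section0|exact: smooth_sectionD].
Qed.

Variable nabla : (M -> 'cV[R]_m) -> M -> V -> 'cV[R]_m.
Hypothesis cn : connection A coord nabla.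

Lemma nabla0 p u : nabla (fun=> 0) p u = 0.
Proof.
have s0 := smooth_section0 p.
have := nablaD cn u s0 s0; under [X in nabla X]funext do rewrite addr0.
by move/eqP; rewrite -subr_eq0 opprD addNKr oppr_eq0 => /eqP.
Qed.

Lemma smooth_fun_indic p (U : set M) : nbhs p U -> smooth_fun A \1_U p.
Proof.
move=> pU; apply: smooth_fun_eq (smooth_fun_cst 1 p).
by apply: filterS pU => q Uq; rewrite indicE mem_set.
Qed.

Lemma dfun_indic p (U : set M) u : nbhs p U -> dfun A \1_U p u = 0.
Proof.
move=> pU; rewrite -(dfun_cst 1 p u); apply: dfun_eq.
by apply: filterS pU => q Uq; rewrite indicE mem_set.
Qed.

(* Multiplying by the indicator function of a neighbourhood of p, which is
   smooth at p, takes the place of a cut-off function. *)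
Lemma nabla_eq s t p u : (\forall q \near p, s q = t q) ->
  smooth_section A coord s p -> nabla s p u = nabla t p u.
Proof.
move=> st ss; pose U := [set q | s q = t q].
have pU : nbhs p U by [].
have ts : smooth_section A coord t p := smooth_section_eq st ss.
have loc s' : smooth_section A coord s' p ->
    nabla (fun q => \1_U q *: s' q) p u = nabla s' p u.
  move=> ss'; rewrite (nabla_leibniz cn) //; last exact: smooth_fun_indic.
  rewrite dfun_indic // scale0r add0r indicE mem_set ?scale1r //.
  exact: nbhs_singleton pU.
rewrite -loc // -[RHS]loc //; congr (nabla _ p u); apply/funext => q.
by rewrite indicE; case: (boolP (q \in U)) => [/set_mem -> //|_]; rewrite
  !scale0r.
Qed.

Lemma nabla_sum (I : finType) (s : I -> M -> 'cV[R]_m) p u :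
  (forall i, smooth_section A coord (s i) p) ->
  nabla (fun q => \sum_i s i q) p u = \sum_i nabla (s i) p u.
Proof.
move=> H; have -> : (fun q => \sum_i s i q) = \sum_i s i.
  by apply/funext => q; rewrite fct_sumE.
pose K (s : M -> 'cV[R]_m) (t : 'cV[R]_m) := smooth_section A coord s p /\ nabla
  s p u = t.
suff [] : K (\sum_i s i) (\sum_i nabla (s i) p u) by [].
elim/big_ind2 : _ => [|s1 t1 s2 t2 [? <-] [? <-]|i _]; split=> //.
- exact: smooth_section0.
- exact: nabla0.
- exact: smooth_sectionD.
- exact: (nablaD cn).
Qed.

End Sections.

(** * Coordinate fields and d o d = 0 *)

Definition trans p q (x : V) : V := chart A q (param A p x).

(* The coordinate field u of the chart at p; its value at q is expressed, as
   always, in the chart at q. *)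
Definition chart_field p u : M -> V :=
  fun q => 'D_u (trans p q) (chart A p q).

Lemma trans_chart p q r : dom A p r -> trans p q (chart A p r) = chart A q r.
Proof. by move=> pr; rewrite /trans chartK. Qed.

Lemma trans_smooth p q r i : dom A p r -> dom A q r ->
  smooth_near (fun x => trans p q x i 0) (chart A p r).
Proof. by move=> pr qr; exact: transition_smooth. Qed.

Lemma trans_diff p q r : dom A p r -> dom A q r ->
  differentiable (trans p q) (chart A p r).
Proof.
move=> pr qr; apply: differentiable_mx => i.
by apply: smooth_near_diff; exact: trans_smooth.
Qed.

Lemma param_trans p q r : dom A p r -> dom A q r ->
  \forall x \near chart A p r, param A q (trans p q x) = param A p x.
Proof.
move=> pr qr; apply: filterS (nbhs_param pr (nbhs_dom qr)) => x H.
by rewrite /trans chartK.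
Qed.

Lemma tcoordE p q u : dom A p q -> 
  tcoord A p q *m u = 'D_u (trans q p) (chart A q q).
Proof.
move=> pq; have dt := trans_diff (dom_self A q) pq.
apply/colP => i; rewrite derive_col // mxE.
rewrite derive_sum_coord; last first.
  by apply: smooth_near_diff; apply: trans_smooth => //; exact: dom_self.
by apply: eq_bigr => j _; rewrite mxE mulrC.
Qed.

(** By the chain rule for the transition map, the coordinate field acts at every q of the chart
    domain as the constant vector u read in the chart at p. Brackets and exterior derivatives near p
    thus become ordinary partial derivatives in one chart. *)
Lemma dfun_chart_field f p q u : dom A p q -> smooth_fun A f q ->
  dfun A f q (chart_field p u q) =
  'D_u (fun x => f (param A p x) : R^o) (chart A p q).
Proof.
move=> pq sf; have qq := dom_self A q.
rewrite -(@near_eq_derive _ _ _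
  (fun x => f (param A q (trans p q x)) : R^o)); last first.
  by apply: filterS (param_trans pq qq) => x ->.
rewrite (@derive_comp _ V V R^o (trans p q) (fun x => f (param A q x))).
- by rewrite trans_chart.
- exact: trans_diff.
- by rewrite trans_chart //; exact: smooth_near_diff.
Qed.

Lemma smooth_fun_chart f p q : dom A p q -> smooth_fun A f q ->
  smooth_near (fun x => f (param A p x)) (chart A p q).
Proof.
move=> pq sf; have qq := dom_self A q.
apply: (@smooth_near_eq _ (fun x => f (param A q (trans p q x)))).
  by apply: filterS (param_trans pq qq) => x ->.
apply: (@smooth_near_comp R (fun x => f (param A q x)) (trans p q)).
  by move=> i; exact: trans_smooth.
by rewrite trans_chart.
Qed.

Lemma smooth_fun_from_chart (F : V -> R) p q : dom A p q ->
  smooth_near F (chart A p q) -> smooth_fun A (fun r => F (chart A p r)) q.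
Proof.
move=> pq sF; have qq := dom_self A q.
apply: (@smooth_near_comp R F (trans q p)).
  by move=> i; exact: trans_smooth.
by rewrite trans_chart.
Qed.

(** The cocycle rule for Jacobians: the transition from p to q factors near r through the preferred
    chart at r, in which the field is expressed. *)
Lemma tcoord_chart_field p q r u : dom A p r -> dom A q r ->
  tcoord A q r *m chart_field p u r = 'D_u (trans p q) (chart A p r).
Proof.
move=> pr qr; have rr := dom_self A r.
have dh := trans_diff pr rr.
have df : differentiable (trans r q) (trans p r (chart A p r)).
  by rewrite (trans_chart r pr); exact: trans_diff.
have := derive_comp u dh df; rewrite (trans_chart r pr) => E.
apply: etrans (tcoordE _ qr) _; apply: etrans (esym E) _.
apply: near_eq_derive; apply: filterS (param_trans pr rr) => x.
by rewrite /trans => ->.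
Qed.

Lemma tcoord_chart_fieldE p q u i : dom A p q ->
  \forall r \near q, (tcoord A q r *m chart_field p u r) i 0 =
    'D_u (fun x => trans p q x i 0 : R^o) (chart A p r).
Proof.
move=> pq; have qq := dom_self A q.
apply: filterS2 (nbhs_dom pq) (nbhs_dom qq) => r pr qr.
by rewrite tcoord_chart_field // derive_col //; exact: trans_diff.
Qed.

Lemma smooth_chart_field p q u : dom A p q -> smooth_vf A (chart_field p u) q.
Proof.
move=> pq i; have qq := dom_self A q.
apply: (@smooth_fun_eq
  (fun r => 'D_u (fun x => trans p q x i 0 : R^o) (chart A p r))).
  by apply: filterS (tcoord_chart_fieldE u i pq) => r ->.
apply: (@smooth_fun_from_chart
  (fun y => 'D_u (fun x => trans p q x i 0 : R^o) y) p q pq).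
by apply: smooth_near_derive; exact: trans_smooth.
Qed.

Lemma chart_field_id p u : chart_field p u p = u.
Proof.
have pp := dom_self A p; rewrite /chart_field.
rewrite (near_eq_derive (g := id)) ?derive_id //.
exact: near_paramK.
Qed.

(** Both terms of the bracket are mixed second derivatives of a component of the transition map from
    p to q. *)
Lemma lie_chart_field p q u v : dom A p q ->
  lie A (chart_field p u) (chart_field p v) q = 0.
Proof.
move=> pq; have qq := dom_self A q; apply/colP => i; rewrite mxE [RHS]mxE.
have H w w' : dfun A (fun r => (tcoord A q r *m chart_field p w r) i 0) q
      (chart_field p w' q) =
    'D_w' (fun y => 'D_w (fun x => trans p q x i 0 : R^o) y) (chart A p q).
  rewrite dfun_chart_field //; last exact: smooth_chart_field.
  apply: near_eq_derive.
  have := nbhs_param pq (tcoord_chart_fieldE w i pq).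
  by apply: filterS2 (near_paramK pq) => x Ex ->; rewrite Ex.
have E (a b c d : R) : a = c -> b = d -> c = d -> a - b = 0.
  by move=> -> -> ->; rewrite subrr.
exact: (E _ _ _ _ (H v u) (H u v) (derive_swap u v (trans_smooth i pq qq))).
Qed.

(** B is the pointwise form of d a. Coordinate fields commute, so B(c x, c y) is D_x of a(c y) minus
    D_y of a(c x) in the chart at p; in the cyclic sum the second derivatives cancel in pairs. *)
Lemma dd_chart_field (a : M -> 'rV[R]_7) (B : M -> V -> V -> R) p u v w :
  smooth_form1 A a ->
  (forall q X Y, smooth_vf A X q -> smooth_vf A Y q ->
     d1 A a X Y q = B q (X q) (Y q)) ->
  let c := chart_field p in
  dfun A (fun q => B q (c v q) (c w q)) p u
  + dfun A (fun q => B q (c w q) (c u q)) p v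
  + dfun A (fun q => B q (c u q) (c v q)) p w = 0.
Proof.
move=> sa HB c; have pp := dom_self A p.
pose h x y := ev (a (param A p y)) (c x (param A p y)) : R^o.
have sh x : smooth_near (h x) (chart A p p).
  apply: (@smooth_fun_chart (fun q => ev (a q) (c x q))) => //.
  by apply: sa; exact: smooth_chart_field.
have H x y z : dfun A (fun q => B q (c x q) (c y q)) p z =
   'D_z (fun t => 'D_x (h y) t) (chart A p p) - 'D_z (fun t => 'D_y (h x) t)
     (chart A p p).
  rewrite -deriveB; try by apply: diff_derivable; apply: smooth_near_diff;
    apply: smooth_near_derive.
  apply: near_eq_derive.
  apply: filterS2 (near_paramK pp) (nbhs_param pp (nbhs_dom pp)) => t Et pt.
  have sx := smooth_chart_field x pt; have sy := smooth_chart_field y pt.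
  have E (b k e b' k' : R) : b = b' -> k = k' -> e = 0 -> b - k - e = b' - k'.
    by move=> -> -> ->; rewrite subr0.
  apply: etrans (esym (HB _ _ _ sx sy)) _.
  have E1 := dfun_chart_field x pt (sa _ _ sy); rewrite Et in E1.
  have E2 := dfun_chart_field y pt (sa _ _ sx); rewrite Et in E2.
  apply: (E _ _ _ _ _ E1 E2).
  apply: etrans (congr1 (ev (a (param A p t))) (lie_chart_field x y pt)) _.
  by rewrite /ev mulmx0 mxE.
have E (k b e k1 k2 b1 b2 e1 e2 : R) : k = k1 - k2 -> b = b1 - b2 ->
    e = e1 - e2 -> k1 = b2 -> k2 = e1 -> b1 = e2 -> k + b + e = 0.
  by move=> -> -> -> -> -> ->; ring.
exact: (E _ _ _ _ _ _ _ _ _ (H v w u) (H w u v) (H u v w)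
  (derive_swap u v (sh w)) (derive_swap u w (sh v)) (derive_swap v w (sh u))).
Qed.

End Manifold.

(** * Pointwise algebra of a 3-contact structure *)

Section ContactAlgebra.
Variables (R : realType) (M : topologicalType) (A : manifold7 R M).
Local Notation V := 'cV[R]_7.
Variables (phi : 'I_3 -> M -> 'M[R]_7) (xi : 'I_3 -> M -> V).
Variables (eta : 'I_3 -> M -> 'rV[R]_7) (g : M -> 'M[R]_7).
Hypothesis rg : riemannian A g.
Hypothesis a3 : almost_3contact_metric A phi xi eta g.
Variable p : M.
Implicit Types (u v w x : V) (i : 'I_3).
Local Notation ip := (inner g p).
Local Notation et i := (ev (eta i p)).

Lemma evD (a : 'rV[R]_7) u v : ev a (u + v) = ev a u + ev a v.
Proof. by rewrite /ev mulmxDr mxE. Qed.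

Lemma evZ (a : 'rV[R]_7) c u : ev a (c *: u) = c * ev a u.
Proof. by rewrite /ev -scalemxAr mxE. Qed.

Lemma evN (a : 'rV[R]_7) u : ev a (- u) = - ev a u.
Proof. by rewrite -scaleN1r evZ mulN1r. Qed.

Lemma ev_mul (a : 'rV[R]_7) u v : v *m a *m u = ev a u *: v.
Proof.
by apply/colP => k; rewrite -mulmxA mxE big_ord1 [RHS]mxE mulrC.
Qed.

Lemma innerC u v : ip u v = ip v u.
Proof. exact: (Defs.metric_sym rg p). Qed.

Lemma innerDr u v w : ip u (v + w) = ip u v + ip u w.
Proof. by rewrite /inner mulmxDr mxE. Qed.

Lemma innerZr u c v : ip u (c *: v) = c * ip u v.
Proof. by rewrite /inner -scalemxAr mxE. Qed.

Lemma innerNr u v : ip u (- v) = - ip u v.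
Proof. by rewrite -scaleN1r innerZr mulN1r. Qed.

Lemma inner0r u : ip u 0 = 0.
Proof. by rewrite /inner mulmx0 mxE. Qed.

Lemma innerBr u v w : ip u (v - w) = ip u v - ip u w.
Proof. by rewrite innerDr innerNr. Qed.

Lemma inner_sumr (I : finType) u (F : I -> V) :
  ip u (\sum_a F a) = \sum_a ip u (F a).
Proof. by elim/big_rec2 : _ => [|a c d _ <-]; rewrite ?inner0r ?innerDr. Qed.

Lemma innerDl u v w : ip (u + v) w = ip u w + ip v w.
Proof. by rewrite innerC innerDr 2!(innerC w). Qed.

Lemma innerZl u c v : ip (c *: u) v = c * ip u v.
Proof. by rewrite innerC innerZr innerC. Qed.

Lemma innerNl u v : ip (- u) v = - ip u v.
Proof. by rewrite innerC innerNr innerC. Qed.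

Lemma innerBl u v w : ip (u - v) w = ip u w - ip v w.
Proof. by rewrite innerDl innerNl. Qed.

Lemma inner0l u : ip 0 u = 0.
Proof. by rewrite innerC inner0r. Qed.

Lemma inner_suml (I : finType) u (F : I -> V) :
  ip (\sum_a F a) u = \sum_a ip (F a) u.
Proof. by rewrite innerC inner_sumr; apply: eq_bigr => a _; exact: innerC. Qed.

Lemma inner_inj u v : (forall w, ip u w = ip v w) -> u = v.
Proof.
move=> H; apply/eqP; rewrite -subr_eq0; apply/negPn/negP => /(Defs.metric_pos rg
  p).
by rewrite [X in 0 < X](_ : _ = 0) ?ltxx // innerBl H subrr.
Qed.

Lemma phi2E i u : phi i p *m (phi i p *m u) = - u + et i u *: xi i p.
Proof.
have [_ _ _ H _ _] := acm_each a3 i.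
by rewrite mulmxA H mulmxDl mulNmx mul1mx ev_mul.
Qed.

Lemma eta_xi_self i : et i (xi i p) = 1.
Proof. by have [_ _ _ _ H _] := acm_each a3 i. Qed.

(** For f = phi xi the formula for phi^2 gives phi f = 0, then f = eta(f) xi, and applying phi once
    more eta(f) f = 0. Either factor being zero forces f = 0. *)
Lemma phi_xi_self i : phi i p *m xi i p = 0.
Proof.
set f := phi i p *m xi i p.
have ff : phi i p *m f = 0 by rewrite phi2E eta_xi_self scale1r addNr.
have fE : f = et i f *: xi i p.
  by apply/eqP; rewrite eq_sym -subr_eq0 addrC -phi2E ff mulmx0.
have : et i f *: f = 0 by rewrite {2}/f scalemxAr -fE ff.
move/eqP; rewrite scaler_eq0 => /orP[/eqP e0|/eqP //].
by rewrite fE e0 scale0r.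
Qed.

(** Computing phi^3 u as phi^2 (phi u) and as phi (phi^2 u) leaves eta(phi u) xi = 0. *)
Lemma eta_phi_self i u : et i (phi i p *m u) = 0.
Proof.
have := phi2E i (phi i p *m u); rewrite (phi2E i u) mulmxDr mulmxN.
rewrite -scalemxAr phi_xi_self scaler0 addr0.
move/eqP; rewrite addrC -subr_eq subrr eq_sym => /eqP E.
by have := congr1 (ev (eta i p)) E; rewrite evZ eta_xi_self mulr1 => ->; rewrite
  /ev mulmx0 mxE.
Qed.

Lemma inner_xi i u : ip (xi i p) u = et i u.
Proof.
have [_ _ _ _ _ H] := acm_each a3 i.
have := H p (xi i p) u; rewrite phi_xi_self inner0l eta_xi_self mul1r.
by move/eqP; rewrite eq_sym subr_eq0 => /eqP.
Qed.

Lemma phi_skew i u v : ip (phi i p *m u) v = - ip u (phi i p *m v).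
Proof.
have [_ _ _ _ _ H] := acm_each a3 i.
have := H p u (phi i p *m v); rewrite phi2E eta_phi_self mulr0 subr0.
rewrite innerDr innerNr innerZr (innerC _ (xi i p)) inner_xi eta_phi_self.
by rewrite mulr0 addr0 => <-; rewrite opprK.
Qed.

Lemma phi_phi i u : let j := ordS i in let k := ordS j in
  phi i p *m (phi j p *m u) = phi k p *m u + et j u *: xi i p.
Proof.
move=> j k; have [-> _] := acm_phi a3 i p.
by rewrite mulmxBl mulmxA ev_mul subrK.
Qed.

Lemma phi_phiC i u : let j := ordS i in let k := ordS j in
  phi j p *m (phi i p *m u) = - (phi k p *m u) + et i u *: xi j p.
Proof.
move=> j k; have [_ ->] := acm_phi a3 i p.
by rewrite mulmxDl mulNmx mulmxA ev_mul opprD opprK subrK.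
Qed.

Lemma phi_xi i : let j := ordS i in let k := ordS j in
  phi i p *m xi j p = xi k p /\ phi j p *m xi i p = - xi k p.
Proof.
by move=> j k; have [H1 H2] := acm_xi a3 i p; split=> //; rewrite {}H2 opprK.
Qed.

Lemma ordS3 i : ordS (ordS (ordS i)) = i.
Proof. by case: i => [[|[|[|i]]]] Hi //; apply: val_inj. Qed.

Lemma ordS_3 : (ordS (0 : 'I_3) = 1) * (ordS (1 : 'I_3) = 2) * (ordS (2 : 'I_3)
  = 0).
Proof. by split; [split|]; apply: val_inj. Qed.

(** The vector xi_{i+1} lies in the image of phi_i, which is skew and kills xi_i. *)
Lemma eta_xi_next i : et i (xi (ordS i) p) = 0 /\ et (ordS i) (xi i p) = 0.
Proof.
have H : et i (xi (ordS i) p) = 0.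
  have := phi_xi (ordS (ordS i)); rewrite !ordS3 => -[_ /esym/eqP].
  rewrite eqr_oppLR => /eqP ->.
  by rewrite evN -inner_xi innerC phi_skew phi_xi_self inner0r !oppr0.
by split=> //; rewrite -inner_xi innerC inner_xi.
Qed.

(** Counting from an arbitrary i keeps the three cases in the cyclic form i, [ordS i],
    [ordS (ordS i)] in which the axioms are stated. *)
Lemma I3_case (P : 'I_3 -> Prop) i :
  P i -> P (ordS i) -> P (ordS (ordS i)) -> forall j, P j.
Proof.
move=> H0 H1 H2 j.
suff : j \in [:: i; ordS i; ordS (ordS i)].
  by rewrite !inE => /or3P[] /eqP ->.
by case: i {H0 H1 H2} => [[|[|[|i]]] Hi]; case: j => [[|[|[|j]]] Hj]; rewrite
  //= !inE.
Qed.

Lemma eta_xi_delta i j : et i (xi j p) = (i == j)%:R.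
Proof.
move: j; apply: (@I3_case _ i).
- by rewrite eta_xi_self eqxx.
- rewrite (eta_xi_next i).1; case: eqP => // E; exfalso.
  by move: E; case: i => [[|[|[|i]]] Hi] // /(congr1 val).
- have := (eta_xi_next (ordS (ordS i))).2; rewrite ordS3 => ->.
  by case: eqP => // E; exfalso; move: E; case: i => [[|[|[|i]]] Hi] // /(congr1
    val).
Qed.

Lemma sum7 (U : nmodType) (F : 'I_7 -> U) : \sum_a F a = F (inord 0) + F (inord
  1) +
  F (inord 2) + F (inord 3) + F (inord 4) + F (inord 5) + F (inord 6).
Proof.
rewrite !big_ord_recl big_ord0 addr0 !addrA.
by do !congr (_ + _); congr F; apply: val_inj; rewrite /= inordK.
Qed.

Lemma I7_case (P : 'I_7 -> Prop) : P (inord 0) -> P (inord 1) -> P (inord 2) ->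
  P (inord 3) -> P (inord 4) -> P (inord 5) -> P (inord 6) -> forall a, P a.
Proof.
move=> ? ? ? ? ? ? ? a; rewrite -(inord_val a).
by case: a => [[|[|[|[|[|[|[|a]]]]]]] Ha].
Qed.

(** P has the frame as its columns. Orthonormality says P^T g is a left inverse of P; for square
    matrices it is also a right inverse, which is the expansion of a vector in the frame. *)
Lemma onb_mx (e : 'I_7 -> V) : onb g p e ->
  let P : 'M[R]_7 := \matrix_(b, a) e a b 0 in P *m (P^T *m g p) = 1%:M.
Proof.
move=> oe P; apply: mulmx1C.
apply/matrixP => a b; rewrite !mxE -oe /inner mxE.
apply: eq_bigr => c _; rewrite !mxE; congr (_ * _).
by apply: eq_bigr => d _; rewrite !mxE.
Qed.

Lemma onb_expand (e : 'I_7 -> V) u : onb g p e -> u = \sum_a ip (e a) u *: e a.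
Proof.
move=> /onb_mx PPG.
rewrite -[LHS]mul1mx -PPG -!mulmxA; apply/colP => b.
rewrite mxE summxE; apply: eq_bigr => a _; rewrite !mxE mulrC; congr (_ * _).
rewrite /inner -mulmxA mxE; apply: eq_bigr => c _; rewrite !mxE //.
Qed.

(** * Frames adapted to the 3-contact structure *)

(** The signs of the last three vectors are chosen so that omega becomes exactly [std_form] of this
    frame ([omega_std]), as [adapted] demands. *)
Record contact_frame (e : 'I_7 -> V) : Prop := ContactFrame {
  cf_onb : onb g p e;
  cf_xi0 : e (inord 0) = xi 0 p;
  cf_xi1 : e (inord 1) = xi 1 p;
  cf_xi2 : e (inord 2) = xi 2 p;
  cf_phi0 : phi 0 p *m e (inord 3) = - e (inord 4);
  cf_phi1 : phi 1 p *m e (inord 3) = - e (inord 5);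
  cf_phi2 : phi 2 p *m e (inord 3) = e (inord 6)
}.

Lemma exists_horizontal : exists2 x, ip x x = 1 & forall i, et i x = 0.
Proof.
pose N : 'M[R]_(7, 3) := \matrix_(a, i) eta i p 0 a.
have rk : kermx N != 0.
  rewrite -mxrank_eq0 mxrank_ker -lt0n subn_gt0.
  by apply: leq_ltn_trans (rank_leq_col N) _.
have [a Ha] : exists a, row a (kermx N) != 0.
  apply/existsP; rewrite -negb_forall; apply: contra rk => /forallP H.
  by apply/eqP/row_matrixP => a; rewrite row0; exact/eqP.
pose y := (row a (kermx N))^T.
have y0 : y != 0 by rewrite -(trmx0 R 1 7) (inj_eq trmx_inj).
have hy i : et i y = 0.
  have : row a (kermx N) *m N = 0 by rewrite -row_mul mulmx_ker row0.
  move=> /matrixP/(_ 0 i); rewrite [RHS]mxE => <-; rewrite /ev !mxE.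
  by apply: eq_bigr => b _; rewrite !mxE mulrC.
have y2 := Defs.metric_pos rg p y0.
exists ((Num.sqrt (ip y y))^-1 *: y) => [|i]; last by rewrite evZ hy mulr0.
rewrite innerZl innerZr mulrA -invfM -expr2 sqr_sqrtr ?ltW // mulVf //.
by rewrite gt_eqF.
Qed.

(** On H the phi_i are skew and satisfy the quaternion relations, so a unit horizontal x and its
    three images are orthonormal. *)
Lemma exists_contact_frame : exists e, contact_frame e.
Proof.
have [x xx hx] := exists_horizontal.
pose s := [:: xi 0 p; xi 1 p; xi 2 p; x; - (phi 0 p *m x); - (phi 1 p *m x);
    phi 2 p *m x].
exists (fun a => nth 0 s a).
have P0 := phi_phi 0 x; have P1 := phi_phi 1 x; have P2 := phi_phi 2 x.
cbv zeta in P0, P1, P2; rewrite !ordS_3 !hx !scale0r !addr0 in P0 P1 P2.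
have Q0 := phi_phiC 0 x; have Q1 := phi_phiC 1 x; have Q2 := phi_phiC 2 x.
cbv zeta in Q0, Q1, Q2; rewrite !ordS_3 !hx !scale0r !addr0 in Q0 Q1 Q2.
have S i : phi i p *m (phi i p *m x) = - x by rewrite phi2E hx scale0r addr0.
have hphi i j : et i (phi j p *m x) = 0.
  rewrite -inner_xi innerC phi_skew.
  move: i; apply: (@I3_case _ j).
  - by rewrite phi_xi_self inner0r oppr0.
  - by rewrite (phi_xi j).1 innerC inner_xi hx oppr0.
  have := (phi_xi (ordS (ordS j))).2; rewrite ordS3 => ->.
  by rewrite innerNr innerC inner_xi hx !oppr0.
have xphi i : ip x (phi i p *m x) = 0.
  have := phi_skew i x x; rewrite innerC => /eqP.
  by rewrite -addr_eq0 -mulr2n mulrn_eq0 /= => /eqP.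
have phixx i : ip (phi i p *m x) (phi i p *m x) = 1.
  by rewrite phi_skew S innerNr opprK.
have phiphi i j : i != j -> ip (phi i p *m x) (phi j p *m x) = 0.
  rewrite phi_skew; move: j; apply: (@I3_case _ i).
  - by rewrite eqxx.
  - by rewrite phi_phi hx scale0r addr0 xphi oppr0.
  move=> _; have := phi_phiC (ordS (ordS i)) x; rewrite !ordS3 => ->.
  by rewrite hx scale0r addr0 innerNr xphi !oppr0.
split.
- have xiE i j : ip (xi i p) (xi j p) = (i == j)%:R.
    by rewrite inner_xi eta_xi_delta.
  have xix i : ip (xi i p) x = 0 by rewrite inner_xi hx.
  have xixr i : ip x (xi i p) = 0 by rewrite innerC.
  have xiphi i j : ip (xi i p) (phi j p *m x) = 0 by rewrite inner_xi hphi.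
  have xiphir i j : ip (phi j p *m x) (xi i p) = 0 by rewrite innerC.
  have xphir i : ip (phi i p *m x) x = 0 by rewrite innerC.
  by apply: I7_case; apply: I7_case; rewrite !inordK //= ?innerNl ?innerNr
    ?xiE ?xix ?xixr ?xiphi ?xiphir ?xphi ?xphir ?xx ?phixx ?phiphi ?oppr0 ?opprK
    // -?val_eqE /= ?inordK.
- by rewrite inordK.
- by rewrite inordK.
- by rewrite inordK.
- by rewrite !inordK //= opprK.
- by rewrite !inordK //= opprK.
- by rewrite !inordK.
Qed.

(** * The structure tensors in a contact frame *)

Section Frame.
Variable e : 'I_7 -> V.
Hypothesis fe : contact_frame e.
Local Notation t k u := (ip (e (inord k)) u).

Lemma frame_expand u : u = \sum_a ip (e a) u *: e a.
Proof. exact: onb_expand (cf_onb fe). Qed.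

Lemma inner_frame u v : ip u v = t 0 u * t 0 v + t 1 u * t 1 v + t 2 u * t 2 v
  + t 3 u * t 3 v + t 4 u * t 4 v + t 5 u * t 5 v + t 6 u * t 6 v.
Proof.
rewrite {1}[u]frame_expand inner_suml sum7.
by rewrite !innerZl.
Qed.

Lemma eta_frame u : (et 0 u = t 0 u) * (et 1 u = t 1 u) * (et 2 u = t 2 u).
Proof. by rewrite (cf_xi0 fe) (cf_xi1 fe) (cf_xi2 fe) !inner_xi. Qed.

Lemma frame_onb (k l : nat) : (k < 7)%N -> (l < 7)%N ->
  t k (e (inord l)) = (k == l)%:R.
Proof. by move=> k7 l7; rewrite (cf_onb fe) -val_eqE /= !inordK. Qed.

Lemma eta_frame3 i : et i (e (inord 3)) = 0.
Proof.
by move: i; apply: (@I3_case _ 0); rewrite ?ordS_3 eta_frame frame_onb.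
Qed.

Lemma phi_frame0 : [/\ phi 0 p *m e (inord 0) = 0,
  phi 0 p *m e (inord 1) = e (inord 2), phi 0 p *m e (inord 2) = - e (inord 1) &
  [/\ phi 0 p *m e (inord 3) = - e (inord 4),
  phi 0 p *m e (inord 4) = e (inord 3), phi 0 p *m e (inord 5) = - e (inord 6) &
  phi 0 p *m e (inord 6) = e (inord 5)]].
Proof.
have [A0 A1] := phi_xi 0; have [_ A2] := phi_xi 2; rewrite !ordS_3 in A0 A1 A2.
have B0 := phi2E 0 (e (inord 3)); have B1 := phi_phi 0 (e (inord 3)).
have B2 := phi_phiC 2 (e (inord 3)).
cbv zeta in B1, B2; rewrite !ordS_3 !eta_frame3 !scale0r !addr0 in B0 B1 B2.
have C0 := cf_phi0 fe; have C1 := cf_phi1 fe; have C2 := cf_phi2 fe.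
have D4 : e (inord 4) = - (phi 0 p *m e (inord 3)) by rewrite C0 opprK.
have D5 : e (inord 5) = - (phi 1 p *m e (inord 3)) by rewrite C1 opprK.
rewrite (cf_xi0 fe) (cf_xi1 fe) (cf_xi2 fe) phi_xi_self; split=> //; split=> //.
- by rewrite D4 mulmxN B0 opprK.
- by rewrite D5 mulmxN B1 C2.
- by rewrite -C2 B2 D5.
Qed.

Lemma phi_frame1 : [/\ phi 1 p *m e (inord 0) = - e (inord 2),
  phi 1 p *m e (inord 1) = 0, phi 1 p *m e (inord 2) = e (inord 0) &
  [/\ phi 1 p *m e (inord 3) = - e (inord 5),
  phi 1 p *m e (inord 4) = e (inord 6), phi 1 p *m e (inord 5) = e (inord 3) &
  phi 1 p *m e (inord 6) = - e (inord 4)]].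
Proof.
have [A0 A1] := phi_xi 1; have [_ A2] := phi_xi 0; rewrite !ordS_3 in A0 A1 A2.
have B0 := phi2E 1 (e (inord 3)); have B1 := phi_phi 1 (e (inord 3)).
have B2 := phi_phiC 0 (e (inord 3)).
cbv zeta in B1, B2; rewrite !ordS_3 !eta_frame3 !scale0r !addr0 in B0 B1 B2.
have C0 := cf_phi0 fe; have C1 := cf_phi1 fe; have C2 := cf_phi2 fe.
have D4 : e (inord 4) = - (phi 0 p *m e (inord 3)) by rewrite C0 opprK.
have D5 : e (inord 5) = - (phi 1 p *m e (inord 3)) by rewrite C1 opprK.
rewrite (cf_xi0 fe) (cf_xi1 fe) (cf_xi2 fe) phi_xi_self; split=> //; split=> //.
- by rewrite D4 mulmxN B2 opprK C2.
- by rewrite D5 mulmxN B0 opprK.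
- by rewrite -C2 B1 C0.
Qed.

Lemma phi_frame2 : [/\ phi 2 p *m e (inord 0) = e (inord 1),
  phi 2 p *m e (inord 1) = - e (inord 0), phi 2 p *m e (inord 2) = 0 &
  [/\ phi 2 p *m e (inord 3) = e (inord 6),
  phi 2 p *m e (inord 4) = e (inord 5), phi 2 p *m e (inord 5) = - e (inord 4) &
  phi 2 p *m e (inord 6) = - e (inord 3)]].
Proof.
have [A0 A1] := phi_xi 2; have [_ A2] := phi_xi 1; rewrite !ordS_3 in A0 A1 A2.
have B0 := phi2E 2 (e (inord 3)); have B1 := phi_phi 2 (e (inord 3)).
have B2 := phi_phiC 1 (e (inord 3)).
cbv zeta in B1, B2; rewrite !ordS_3 !eta_frame3 !scale0r !addr0 in B0 B1 B2.
have C0 := cf_phi0 fe; have C1 := cf_phi1 fe; have C2 := cf_phi2 fe.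
have D4 : e (inord 4) = - (phi 0 p *m e (inord 3)) by rewrite C0 opprK.
have D5 : e (inord 5) = - (phi 1 p *m e (inord 3)) by rewrite C1 opprK.
rewrite (cf_xi0 fe) (cf_xi1 fe) (cf_xi2 fe) phi_xi_self; split=> //; split=> //.
- by rewrite D4 mulmxN B1 D5.
- by rewrite D5 mulmxN B2 opprK C0.
- by rewrite -C2 B0.
Qed.

Lemma t_phi i k u : t k (phi i p *m u) = - ip (phi i p *m e (inord k)) u.
Proof. by rewrite phi_skew opprK. Qed.

Lemma coord_phi0 u : (t 0 (phi 0 p *m u) = 0) * (t 1 (phi 0 p *m u) = - t 2 u) *
  (t 2 (phi 0 p *m u) = t 1 u) * (t 3 (phi 0 p *m u) = t 4 u) *
  (t 4 (phi 0 p *m u) = - t 3 u) * (t 5 (phi 0 p *m u) = t 6 u) *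
  (t 6 (phi 0 p *m u) = - t 5 u).
Proof.
have [H0 H1 H2 [H3 H4 H5 H6]] := phi_frame0.
by rewrite !t_phi H0 H1 H2 H3 H4 H5 H6 !innerNl inner0l !opprK oppr0.
Qed.

Lemma coord_phi1 u : (t 0 (phi 1 p *m u) = t 2 u) * (t 1 (phi 1 p *m u) = 0) *
  (t 2 (phi 1 p *m u) = - t 0 u) * (t 3 (phi 1 p *m u) = t 5 u) *
  (t 4 (phi 1 p *m u) = - t 6 u) * (t 5 (phi 1 p *m u) = - t 3 u) *
  (t 6 (phi 1 p *m u) = t 4 u).
Proof.
have [H0 H1 H2 [H3 H4 H5 H6]] := phi_frame1.
by rewrite !t_phi H0 H1 H2 H3 H4 H5 H6 !innerNl inner0l !opprK oppr0.
Qed.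

Lemma coord_phi2 u : (t 0 (phi 2 p *m u) = - t 1 u) * (t 1 (phi 2 p *m u) = t 0
  u) *
  (t 2 (phi 2 p *m u) = 0) * (t 3 (phi 2 p *m u) = - t 6 u) *
  (t 4 (phi 2 p *m u) = - t 5 u) * (t 5 (phi 2 p *m u) = t 4 u) *
  (t 6 (phi 2 p *m u) = t 3 u).
Proof.
have [H0 H1 H2 [H3 H4 H5 H6]] := phi_frame2.
by rewrite !t_phi H0 H1 H2 H3 H4 H5 H6 !innerNl inner0l !opprK oppr0.
Qed.

(** Each correction eta_j /\ eta_k in [PhiH] contributes one more copy of eta_1 /\ eta_2 /\ eta_3;
    with the copy already in omega this makes four. *)
Lemma omegaE u v w : omega phi eta g p u v w =
  wedge12 (ev (eta 0 p)) (Phi phi g 0 p) u v w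
  + wedge12 (ev (eta 1 p)) (Phi phi g 1 p) u v w
  + wedge12 (ev (eta 2 p)) (Phi phi g 2 p) u v w
  + 4 * wedge111 (ev (eta 0 p)) (ev (eta 1 p)) (ev (eta 2 p)) u v w.
Proof.
rewrite /omega !big_ord_recl big_ord0 addr0.
have -> : lift ord0 (ord0 : 'I_2) = 1 :> 'I_3 by apply: val_inj.
have -> : lift ord0 (lift ord0 (ord0 : 'I_1)) = 2 :> 'I_3 by apply: val_inj.
have -> : ord0 = 0 :> 'I_3 by apply: val_inj.
rewrite /wedge12 /PhiH !ordS_3 /wedge111 /wedge12 /wedge11; ring.
Qed.

Lemma Phi_frame u v :
  (Phi phi g 0 p u v = t 2 u * t 1 v - t 1 u * t 2 v + t 3 u * t 4 v
     - t 4 u * t 3 v + t 5 u * t 6 v - t 6 u * t 5 v) *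
  (Phi phi g 1 p u v = t 0 u * t 2 v - t 2 u * t 0 v + t 3 u * t 5 v
     - t 5 u * t 3 v + t 6 u * t 4 v - t 4 u * t 6 v) *
  (Phi phi g 2 p u v = t 1 u * t 0 v - t 0 u * t 1 v - t 3 u * t 6 v
     + t 6 u * t 3 v + t 5 u * t 4 v - t 4 u * t 5 v).
Proof.
split; [split|]; rewrite /Phi inner_frame.
- by rewrite !coord_phi0; ring.
- by rewrite !coord_phi1; ring.
- by rewrite !coord_phi2; ring.
Qed.

Lemma std_formE u v w : std_form g p e u v w =
  let W (a b c : nat) := wedge111 (ip (e (inord a))) (ip (e (inord b)))
    (ip (e (inord c))) u v w in
  W 0%N 1%N 2%N + W 0%N 3%N 4%N + W 0%N 5%N 6%N + W 1%N 3%N 5%N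
  - W 1%N 4%N 6%N - W 2%N 3%N 6%N - W 2%N 4%N 5%N.
Proof. by []. Qed.

Lemma omega_std u v w : omega phi eta g p u v w = std_form g p e u v w.
Proof.
rewrite omegaE std_formE /wedge111 /wedge12 /wedge11 !Phi_frame !eta_frame.
ring.
Qed.

(** With the sign s as a parameter, the seven summands of omega have one shape and a single lemma
    per operation (Clifford action, contraction, Hodge dual) serves them all. *)
Definition frame_wedge (s : R) (i j k : nat) (u v w : V) :=
  s * wedge111 (ip (e (inord i))) (ip (e (inord j))) (ip (e (inord k))) u v w.

Lemma omega_frame u v w : omega phi eta g p u v w =
  frame_wedge 1 0 1 2 u v w + frame_wedge 1 0 3 4 u v w
  + frame_wedge 1 0 5 6 u v w + frame_wedge 1 1 3 5 u v w
  + frame_wedge (-1) 1 4 6 u v w + frame_wedge (-1) 2 3 6 u v w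
  + frame_wedge (-1) 2 4 5 u v w.
Proof. by rewrite omega_std std_formE /frame_wedge !mul1r !mulN1r. Qed.

(** * Determination of the torsion *)

(** Alternation moves every slot to the last, so linearity there suffices. A 3-form annihilated by V
    lives on the 4-dimensional H and has only four coefficients. *)
Lemma alt3_frame_eq0 (K : V -> V -> V -> R) :
  (forall u v w1 w2, K u v (w1 + w2) = K u v w1 + K u v w2) ->
  (forall u v c w, K u v (c *: w) = c * K u v w) ->
  (forall u v w, K u v w = - K v u w) ->
  (forall u v w, K u v w = - K u w v) ->
  (forall i u v, K u v (xi i p) = 0) ->
  K (e (inord 3)) (e (inord 4)) (e (inord 5)) = 0 ->
  K (e (inord 3)) (e (inord 4)) (e (inord 6)) = 0 ->
  K (e (inord 3)) (e (inord 5)) (e (inord 6)) = 0 ->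
  K (e (inord 4)) (e (inord 5)) (e (inord 6)) = 0 ->
  forall u v w, K u v w = 0.
Proof.
move=> KD KZ s1 s2 Kxi b1 b2 b3 b4.
have K0 u v : K u v 0 = 0 by have := KZ u v 0 0; rewrite scale0r mul0r.
have rdc u v : (forall c, K u v (e c) = 0) -> forall w, K u v w = 0.
  move=> H w; rewrite [w]frame_expand.
  elim/big_rec : _ => [|c w' _ E]; first exact: K0.
  by rewrite KD E KZ H mulr0 addr0.
have d12 u v : K u u v = 0.
  by apply/eqP; have /eqP := s1 u u v; rewrite -addr_eq0 -mulr2n mulrn_eq0.
have d23 u v : K v u u = 0.
  by apply/eqP; have /eqP := s2 v u u; rewrite -addr_eq0 -mulr2n mulrn_eq0.
have d13 u v : K u v u = 0 by rewrite s1 d23 oppr0.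
have prm u v w : K u v w = 0 -> (K u w v = 0) * (K v u w = 0) * (K v w u = 0)
    * (K w u v = 0) * (K w v u = 0).
  move=> E; have E1 : K u w v = 0 by rewrite s2 E oppr0.
  have E2 : K v u w = 0 by rewrite s1 E oppr0.
  have E3 : K v w u = 0 by rewrite s2 E2 oppr0.
  have E4 : K w u v = 0 by rewrite s1 E1 oppr0.
  by rewrite E1 E2 E3 E4; split=> //; rewrite s2 E4 oppr0.
have x0 u v : K u v (e (inord 0)) = 0 by rewrite (cf_xi0 fe).
have x1 u v : K u v (e (inord 1)) = 0 by rewrite (cf_xi1 fe).
have x2 u v : K u v (e (inord 2)) = 0 by rewrite (cf_xi2 fe).
have y0 u v := (prm _ _ _ (x0 u v)); have y1 u v := (prm _ _ _ (x1 u v)).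
have y2 u v := (prm _ _ _ (x2 u v)).
have c1 := prm _ _ _ b1; have c2 := prm _ _ _ b2.
have c3 := prm _ _ _ b3; have c4 := prm _ _ _ b4.
move=> u v; apply: (rdc _ _) => c; rewrite s2 s1 opprK; move: v; apply: (rdc _
  _) => b.
rewrite s2 s1 opprK; move: u; apply: (rdc _ _); move: b c.
by apply: I7_case; apply: I7_case; apply: I7_case; rewrite ?d12 ?d13 ?d23
  ?x0 ?x1 ?x2 ?y0 ?y1 ?y2 ?b1 ?b2 ?b3 ?b4 ?c1 ?c2 ?c3 ?c4.
Qed.

(** The difference of the two sides is an alternating form. The second hypothesis makes it vanish on
    vertical vectors: contracting omega with xi_i gives Phi_i + 2 eta_j /\ eta_k, and 4 al + 2 (de -
    5 al) = 2 de - 6 al. On H the right-hand side is zero, so only T remains. *)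
Lemma torsion_formula (al de : R) (T : V -> V -> V) :
  (forall u v w, ip (T u v) w = - ip (T v u) w /\
                 ip (T u v) w = - ip (T u w) v) ->
  (forall i u v, let j := ordS i in let k := ordS j in
     ip (T u v) (xi i p) =
     2 * al * Phi phi g i p u v
     + (2 * de - 6 * al) * wedge11 (et j) (et k) u v) ->
  (forall u v w, horizontal eta p u -> horizontal eta p v ->
     horizontal eta p w ->
     ip (T u v) (phi 0 p *m w) + ip (T v w) (phi 0 p *m u)
     + ip (T w u) (phi 0 p *m v) = 0) ->
  forall u v w, ip (T u v) w = 2 * al * omega phi eta g p u v w
    + 2 * (de - 5 * al) * wedge111 (et 0) (et 1) (et 2) u v w.
Proof.
move=> Ts Tx Th u v w; apply/eqP; rewrite -subr_eq0; apply/eqP.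
pose Q u v w := 2 * al * omega phi eta g p u v w
    + 2 * (de - 5 * al) * wedge111 (et 0) (et 1) (et 2) u v w.
have QE : Q = fun u v w => 2 * al * (
  wedge12 (ev (eta 0 p)) (Phi phi g 0 p) u v w
  + wedge12 (ev (eta 1 p)) (Phi phi g 1 p) u v w
  + wedge12 (ev (eta 2 p)) (Phi phi g 2 p) u v w
  + 4 * wedge111 (ev (eta 0 p)) (ev (eta 1 p)) (ev (eta 2 p)) u v w)
    + 2 * (de - 5 * al) * wedge111 (et 0) (et 1) (et 2) u v w.
  by apply/funext => ?; apply/funext => ?; apply/funext => ?; rewrite /Q omegaE.
have PhiC i x y : Phi phi g i p x y = - Phi phi g i p y x.
  by rewrite /Phi -phi_skew innerC.
have PhiD i x y z : Phi phi g i p x (y + z) = Phi phi g i p x y + Phi phi g i p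
  x z.
  by rewrite /Phi mulmxDr innerDr.
have PhiZ i x c y : Phi phi g i p x (c *: y) = c * Phi phi g i p x y.
  by rewrite /Phi -scalemxAr innerZr.
have PhiDl i x y z : Phi phi g i p (y + z) x = Phi phi g i p y x + Phi phi g i p
  z x.
  by rewrite /Phi innerDl.
have PhiZl i x c y : Phi phi g i p (c *: y) x = c * Phi phi g i p y x.
  by rewrite /Phi innerZl.
have Phixi i j x : Phi phi g i p x (xi j p) = - et j (phi i p *m x).
  by rewrite PhiC /Phi inner_xi.
have H3 k : (2 < k < 7)%N -> horizontal eta p (e (inord k)).
  move=> /andP[k2 k7]; apply: (@I3_case _ 0);
  by rewrite ?ordS_3 eta_frame frame_onb //; move: k2; case: k {k7} =>
    [|[|[|k]]].
have Q0 x y z : horizontal eta p x -> horizontal eta p y ->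
    horizontal eta p z -> Q x y z = 0.
  move=> hx hy hz.
  by rewrite QE /wedge111 /wedge12 /wedge11 !hx !hy !hz; ring.
pose K u v w := ip (T u v) w - Q u v w.
have [f0 f1 f2 [f3 f4 f5 f6]] := phi_frame0.
have [h3 h4 h5 h6] : [/\ horizontal eta p (e (inord 3)),
    horizontal eta p (e (inord 4)), horizontal eta p (e (inord 5)) &
    horizontal eta p (e (inord 6))].
  by split; apply: H3.
have s12 x y : ip (T x x) y = 0.
  by apply/eqP; have /eqP := (Ts x x y).1; rewrite -addr_eq0 -mulr2n mulrn_eq0.
have s23 x y : ip (T x y) y = 0.
  by apply/eqP; have /eqP := (Ts x y y).2; rewrite -addr_eq0 -mulr2n mulrn_eq0.
have s13 x y : ip (T x y) x = 0 by rewrite (Ts _ _ _).1 s23 oppr0.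
(* Up to sign [phi 0] exchanges e_3 with e_4 and e_5 with e_6. A triple of these vectors contains
   one such pair, so two of the three cyclic terms repeat a vector and vanish; each instance
   isolates one coefficient of T. *)
have T346 := Th _ _ _ h3 h4 h5; have T345 := Th _ _ _ h3 h4 h6.
have T456 := Th _ _ _ h3 h5 h6; have T356 := Th _ _ _ h4 h5 h6.
rewrite f5 f3 f4 !innerNr s13 s23 !oppr0 !addr0 in T346.
rewrite f6 f3 f4 !innerNr s13 s23 !oppr0 !addr0 in T345.
rewrite f6 f3 f5 !innerNr s13 s23 !oppr0 addr0 add0r in T456.
rewrite f6 f4 f5 !innerNr s13 s23 !oppr0 addr0 add0r in T356.
apply: (@alt3_frame_eq0 K) => {u v w}.
- by move=> u v x y; rewrite /K QE /wedge111 /wedge12 /wedge11 innerDr !evD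
    !PhiD !PhiDl; ring.
- by move=> u v c y; rewrite /K QE /wedge111 /wedge12 /wedge11 innerZr !evZ
    !PhiZ !PhiZl; ring.
- move=> u v w; rewrite /K QE (Ts u v w).1 /wedge111 /wedge12 /wedge11.
  by rewrite !(PhiC _ u w) !(PhiC _ w v) !(PhiC _ v u); ring.
- move=> u v w; rewrite /K QE (Ts u v w).2 /wedge111 /wedge12 /wedge11.
  by rewrite !(PhiC _ u w) !(PhiC _ w v) !(PhiC _ v u); ring.
- move=> i u v; apply/eqP; rewrite subr_eq0 Tx; apply/eqP.
  rewrite QE /wedge111 /wedge12 /wedge11; move: i; apply: (@I3_case _ 0);
  rewrite ?ordS_3.
  + by rewrite -(cf_xi0 fe) !Phi_frame !eta_frame !frame_onb //=; ring.
  + by rewrite -(cf_xi1 fe) !Phi_frame !eta_frame !frame_onb //=; ring.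
  + by rewrite -(cf_xi2 fe) !Phi_frame !eta_frame !frame_onb //=; ring.
- by rewrite /K (Q0 _ _ _ h3 h4 h5) subr0.
- by rewrite /K (Q0 _ _ _ h3 h4 h6) subr0 -[LHS]opprK T346 oppr0.
- by rewrite /K (Q0 _ _ _ h3 h5 h6) subr0 (Ts _ _ _).1 (Ts _ _ _).2 opprK.
- rewrite /K (Q0 _ _ _ h4 h5 h6) subr0 (Ts _ _ _).1 (Ts _ _ _).2 opprK.
  by rewrite -[LHS]opprK T456 oppr0.
Qed.

End Frame.

End ContactAlgebra.

(** * Clifford multiplication *)

Section Clifford.
Variables (R : realType) (M : topologicalType) (A : manifold7 R M).
Local Notation V := 'cV[R]_7.
Variables (g : M -> 'M[R]_7) (Sigma : spin_bundle A g).
Hypothesis rg : riemannian A g.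
Variable p : M.
Implicit Types (u v w x y z : V) (psi : 'cV[R]_8).
Local Notation ip := (inner g p).
Local Notation c := (clif Sigma p).

Lemma clifD u v : c (u + v) = c u + c v.
Proof. by rewrite -[u]scale1r clif_linear !scale1r. Qed.

Lemma clif0 : c 0 = 0.
Proof. by apply/eqP; rewrite -(inj_eq (addrI (c 0))) addr0 -clifD addr0. Qed.

Lemma clifZ (a : R) u : c (a *: u) = a *: c u.
Proof. by rewrite -[a *: u]addr0 clif_linear clif0 addr0. Qed.

Lemma clifN u : c (- u) = - c u.
Proof. by rewrite -scaleN1r clifZ scaleN1r. Qed.

Lemma clif_sum (I : finType) (F : I -> V) : c (\sum_a F a) = \sum_a c (F a).
Proof. by elim/big_rec2 : _ => [|a x y _ <-]; rewrite ?clif0 ?clifD. Qed.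

Local Notation f i := (sframe Sigma p i p).

Lemma sframe_onb_at : onb g p (fun i => f i).
Proof. by have := sframe_onb Sigma p => /nbhs_singleton. Qed.

Lemma scoord_orth_at : (scoord Sigma p p)^T *m scoord Sigma p p = 1%:M.
Proof. by apply: mulmx1C; have := scoord_orth Sigma p => /nbhs_singleton. Qed.

Lemma clif_sframe i :
  c (f i) = (scoord Sigma p p)^T *m gamma Sigma i *m scoord Sigma p p.
Proof.
have /nbhs_singleton/(_ i) H := clif_frame Sigma p.
by rewrite -mulmxA -H mulmxA scoord_orth_at mul1mx.
Qed.

(** Identities linear in a vector need only be checked on the local frame, where Clifford
    multiplication is conjugate to the constant gamma matrices. *)
Lemma clif_ind (P : V -> Prop) : (forall i, P (f i)) ->
  (forall (a : R) u v, P u -> P v -> P (a *: u + v)) -> forall u, P u.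
Proof.
move=> Pf Pl u; rewrite (onb_expand u sframe_onb_at).
have P0 : P 0.
  by have := Pl (-1) (f 0) (f 0) (Pf 0) (Pf 0); rewrite scaleN1r addNr.
by elim/big_rec : _ => // i x _ Px; exact: Pl.
Qed.

Lemma clif_tr u : (c u)^T = - c u.
Proof.
elim/clif_ind : u => [i|a u v Hu Hv].
  by rewrite clif_sframe !trmx_mul trmxK gamma_skew mulNmx mulmxN mulmxA.
by rewrite clif_linear linearD linearZ /= Hu Hv scalerN opprD.
Qed.

Lemma clif_anti u v : c u *m c v + c v *m c u = (- 2 * ip u v)%:M.
Proof.
elim/clif_ind : u => [i|a u w Hu Hw]; last first.
  rewrite !clif_linear mulmxDl mulmxDr -scalemxAl -scalemxAr addrACA -scalerDr.
  rewrite Hu Hw (innerDl rg) (innerZl rg) -scalemx1 -[X in _ + X]scalemx1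
    -[RHS]scalemx1.
  by rewrite scalerA -scalerDl; congr (_ *: _); ring.
elim/clif_ind : v => [j|a u w Hu Hw]; last first.
  rewrite !clif_linear mulmxDl mulmxDr -scalemxAl -scalemxAr addrACA -scalerDr.
  rewrite Hu Hw innerDr innerZr -scalemx1 -[X in _ + X]scalemx1 -[RHS]scalemx1.
  by rewrite scalerA -scalerDl; congr (_ *: _); ring.
rewrite sframe_onb_at !clif_sframe; set C := scoord Sigma p p.
have CC : C *m C^T = 1%:M by apply: mulmx1C; exact: scoord_orth_at.
have E a b : C^T *m gamma Sigma a *m C *m (C^T *m gamma Sigma b *m C) =
    C^T *m (gamma Sigma a *m gamma Sigma b) *m C.
  rewrite !mulmxA; congr (_ *m _ *m _).
  by rewrite -[_ *m C *m C^T]mulmxA CC mulmx1.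
rewrite !E -mulmxDl -mulmxDr gamma_clifford.
by rewrite scalar_mxC mul_scalar_mx -scalemxAl scoord_orth_at scalemx1.
Qed.

Lemma clif_sqr u : c u *m c u = (- ip u u)%:M.
Proof.
have := clif_anti u u; rewrite -mulr2n => H.
have : (2 : R) *: (c u *m c u) = 2 *: (- ip u u)%:M.
  rewrite scaler_nat H -[X in _ = 2 *: X]scalemx1 scalerA scalemx1.
  by congr (_%:M); ring.
by apply: scalerI; rewrite pnatr_eq0.
Qed.

Lemma clif_orth u v : ip u v = 0 -> c u *m c v = - (c v *m c u).
Proof.
move=> H; have := clif_anti u v; rewrite H mulr0 raddf0 => /eqP.
by rewrite addr_eq0 => /eqP.
Qed.

(** Multiplying once more by u gives -|u|^2 psi. This makes the endomorphism of a nowhere vanishing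
    generalized Killing spinor unique. *)
Lemma clif_inj psi u : psi != 0 -> c u *m psi = 0 -> u = 0.
Proof.
move=> psi0 H; apply/eqP/negPn/negP => /(Defs.metric_pos rg p) u0.
have : c u *m (c u *m psi) = 0 by rewrite H mulmx0.
rewrite mulmxA clif_sqr mul_scalar_mx.
by move/eqP; rewrite scaler_eq0 oppr_eq0 gt_eqF //= (negPf psi0).
Qed.

Lemma metric_unit : g p \in unitmx.
Proof.
have H := onb_mx sframe_onb_at; cbv zeta in H.
by move: H; rewrite mulmxA => /mulmx1_unit[].
Qed.

Lemma inner_dual u a : ip u (dual_basis g p a) = u a 0.
Proof.
rewrite /inner /dual_basis colE mulmxA -[_ *m g p *m invmx _]mulmxA.
by rewrite mulmxV ?metric_unit // mulmx1 -colE !mxE.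
Qed.

(** The basis and its g-dual cancel; this converts the sums defining [clif2] and [clif3] into
    Clifford products of vectors. *)
Lemma clif_dual u : \sum_a ip u (dual_basis g p a) *: clif_basis Sigma p a = c
  u.
Proof.
rewrite {2}[u]matrix_sum_delta clif_sum; apply: eq_bigr => a _.
by rewrite big_ord1 clifZ inner_dual.
Qed.

Local Notation E := (dual_basis g p).
Local Notation b := (clif_basis Sigma p).

Lemma clif_dual2 x y :
  \sum_a1 \sum_a2 (ip x (E a1) * ip y (E a2)) *: (b a1 *m b a2) = c x *m c y.
Proof.
rewrite -(clif_dual x) mulmx_suml; apply: eq_bigr => a1 _.
rewrite -(clif_dual y) mulmx_sumr; apply: eq_bigr => a2 _.
by rewrite -scalemxAl -scalemxAr scalerA.
Qed.

Lemma clif_dual3 x y z :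
  \sum_a1 \sum_a2 \sum_a3 (ip x (E a1) * ip y (E a2) * ip z (E a3)) *:
    (b a1 *m b a2 *m b a3) = c x *m c y *m c z.
Proof.
rewrite -(clif_dual2 x y) mulmx_suml; apply: eq_bigr => a1 _.
rewrite mulmx_suml; apply: eq_bigr => a2 _.
rewrite -(clif_dual z) mulmx_sumr; apply: eq_bigr => a3 _.
by rewrite -scalemxAl -scalemxAr scalerA.
Qed.

Lemma clif2_eq s t : (forall u v, s u v = t u v) -> clif2 Sigma p s = clif2
  Sigma p t.
Proof. by move=> H; congr (_ *: _); do 2!apply: eq_bigr => ? _; rewrite H. Qed.

Lemma clif2D s t : clif2 Sigma p (fun u v => s u v + t u v) =
  clif2 Sigma p s + clif2 Sigma p t.
Proof.
rewrite /clif2 -scalerDr -big_split; congr (_ *: _); apply: eq_bigr => a1 _ /=.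
by rewrite -big_split; apply: eq_bigr => a2 _ /=; rewrite scalerDl.
Qed.

Lemma clif2Z (k : R) s : clif2 Sigma p (fun u v => k * s u v) =
  k *: clif2 Sigma p s.
Proof.
rewrite /clif2 scalerA mulrC -scalerA; congr (_ *: _); rewrite scaler_sumr.
apply: eq_bigr => a1 _; rewrite scaler_sumr; apply: eq_bigr => a2 _.
by rewrite scalerA.
Qed.

Lemma clif3_eq s t : (forall u v w, s u v w = t u v w) ->
  clif3 Sigma p s = clif3 Sigma p t.
Proof. by move=> H; congr (_ *: _); do 3!apply: eq_bigr => ? _; rewrite H. Qed.

Lemma clif3D s t : clif3 Sigma p (fun u v w => s u v w + t u v w) =
  clif3 Sigma p s + clif3 Sigma p t.
Proof.
rewrite /clif3 -scalerDr -big_split; congr (_ *: _); apply: eq_bigr => a1 _ /=.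
rewrite -big_split; apply: eq_bigr => a2 _ /=.
by rewrite -big_split; apply: eq_bigr => a3 _ /=; rewrite scalerDl.
Qed.

Lemma clif3Z (k : R) s : clif3 Sigma p (fun u v w => k * s u v w) =
  k *: clif3 Sigma p s.
Proof.
rewrite /clif3 scalerA mulrC -scalerA; congr (_ *: _); rewrite scaler_sumr.
apply: eq_bigr => a1 _; rewrite scaler_sumr; apply: eq_bigr => a2 _.
by rewrite scaler_sumr; apply: eq_bigr => a3 _; rewrite scalerA.
Qed.

(** Orthogonal vectors anticommute, so c x c y equals half of its antisymmetrization, the factor
    appearing in [clif2]. *)
Lemma clif2_wedge x y : ip x y = 0 ->
  clif2 Sigma p (wedge11 (ip x) (ip y)) = c x *m c y.
Proof.
move=> xy; have -> : c x *m c y = 2^-1 *: (c x *m c y - c y *m c x).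
  rewrite (clif_orth (u := y)) ?opprK; last by rewrite (innerC rg).
  by rewrite -mulr2n -[X in _ *: X]scaler_nat scalerA mulVf ?scale1r ?pnatr_eq0.
congr (_ *: _); rewrite -!clif_dual2.
rewrite -sumrB; apply: eq_bigr => a1 _; rewrite -sumrB; apply: eq_bigr => a2 _.
by rewrite -scalerBl; congr (_ *: _); rewrite /wedge11; ring.
Qed.

(** By anticommutation all six signed permutations of the product are equal; their average matches
    the factor 1/6 in [clif3]. *)
Lemma clif3_wedge x y z : ip x y = 0 -> ip x z = 0 -> ip y z = 0 ->
  clif3 Sigma p (wedge111 (ip x) (ip y) (ip z)) = c x *m c y *m c z.
Proof.
move=> xy xz yz; pose q := c x *m c y *m c z.
have yx : c y *m c x = - (c x *m c y) by apply: clif_orth; rewrite (innerC rg).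
have zx : c z *m c x = - (c x *m c z) by apply: clif_orth; rewrite (innerC rg).
have zy : c z *m c y = - (c y *m c z) by apply: clif_orth; rewrite (innerC rg).
have q1 : c x *m c z *m c y = - q by rewrite -mulmxA zy mulmxN mulmxA.
have q2 : c z *m c x *m c y = q by rewrite zx mulNmx q1 opprK.
have q3 : c y *m c x *m c z = - q by rewrite yx mulNmx.
have q4 : c y *m c z *m c x = q by rewrite -mulmxA zx mulmxN mulmxA q3 opprK.
have q5 : c z *m c y *m c x = - q by rewrite zy mulNmx q4.
rewrite -/q; have -> : q = 6^-1 *: (q - c x *m c z *m c y + c z *m c x *m c y
    - c y *m c x *m c z + c y *m c z *m c x - c z *m c y *m c x).
  rewrite q1 q2 q3 q4 q5 !opprK -!mulr2n -!mulrSr -[X in _ *: X]scaler_nat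
    scalerA mulVf
    ?scale1r ?pnatr_eq0 //.
congr (_ *: _); rewrite /q -!clif_dual3.
do 3![rewrite -?sumrB -?big_split /= -?sumrB -?big_split /= -?sumrB;
  apply: eq_bigr => ? _].
rewrite -?scalerBl -?scalerDl -?scalerBl -?scalerDl -?scalerBl.
by congr (_ *: _); rewrite /wedge111 /wedge12 /wedge11; ring.
Qed.

End Clifford.

(** * The action of the 3-forms on the canonical spinor *)

Section Eigen.
Variable R : realType.

Lemma col_norm_eq0 n (x : 'cV[R]_n) : ((x^T *m x) 0 0 == 0) = (x == 0).
Proof.
apply/eqP/eqP => [H|->]; last by rewrite mulmx0 mxE.
have {}H : \sum_i x i 0 ^+ 2 == 0.
  by apply/eqP; rewrite -[RHS]H mxE; apply: eq_bigr => i _; rewrite mxE expr2.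
apply/colP => i; rewrite mxE; apply/eqP; rewrite -sqrf_eq0.
by move: H; rewrite psumr_eq0 => [/allP/(_ i (mem_index_enum i))|j _]; rewrite
  ?sqr_ge0.
Qed.

(* |psi + P_a psi|^2 = 2 |psi|^2 + 2 <psi, P_a psi>, and these numbers sum to 0.
  *)
Lemma involutions_eigen n (I : finType) (P : I -> 'M[R]_n) (psi : 'cV[R]_n) :
  (forall a, (P a)^T = P a) -> (forall a, P a *m P a = 1%:M) ->
  \sum_a P a *m psi = - #|I|%:R *: psi -> forall a, P a *m psi = - psi.
Proof.
move=> Pt P2 HS a; pose q (x : 'cV[R]_n) := (x^T *m x) 0 0.
have q_ge0 x : 0 <= q x.
  by rewrite /q mxE sumr_ge0 // => i _; rewrite mxE -expr2 sqr_ge0.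
have qE b : q (psi + P b *m psi) = 2 * q psi + 2 * (psi^T *m (P b *m psi)) 0 0.
  rewrite /q [(psi + _)^T]linearD /= trmx_mul Pt mulmxDl !mulmxDr -!mulmxA.
  by rewrite [P b *m (P b *m _)]mulmxA P2 mul1mx !mxE; ring.
have : \sum_b q (psi + P b *m psi) = 0.
  under eq_bigr do rewrite qE.
  have E : \sum_b (psi^T *m (P b *m psi)) 0 0 = - #|I|%:R * q psi.
    by rewrite -summxE -mulmx_sumr HS -scalemxAr mxE.
  by rewrite big_split /= -!mulr_sumr E sumr_const -mulr_natl; ring.
move/eqP; rewrite psumr_eq0 => [/allP/(_ a (mem_index_enum a))|//].
by rewrite /= col_norm_eq0 addrC addr_eq0 => /eqP.
Qed.

End Eigen.

Section SpinorAlgebra.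
Variables (R : realType) (M : topologicalType) (A : manifold7 R M).
Local Notation V := 'cV[R]_7.
Variables (phi : 'I_3 -> M -> 'M[R]_7) (xi : 'I_3 -> M -> V).
Variables (eta : 'I_3 -> M -> 'rV[R]_7) (g : M -> 'M[R]_7).
Variable Sigma : spin_bundle A g.
Hypothesis rg : riemannian A g.
Hypothesis a3 : almost_3contact_metric A phi xi eta g.
Variable p : M.
Variable psi : 'cV[R]_8.
Implicit Types (u v w x y z : V).
Local Notation ip := (inner g p).
Local Notation c := (clif Sigma p).
Local Notation et i := (ev (eta i p)).

Section Triple.
Variables (x y z : V).
Hypothesis (xx : ip x x = 1) (yy : ip y y = 1) (zz : ip z z = 1).
Hypothesis (xy : ip x y = 0) (xz : ip x z = 0) (yz : ip y z = 0).

Lemma clif_unit u : ip u u = 1 -> c u *m c u = - 1%:M.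
Proof. by move=> H; rewrite (clif_sqr Sigma rg) H raddfN. Qed.

(** A cyclic permutation of three factors is made of two transpositions, whose signs cancel. *)
Lemma triple_cycle : c x *m c y *m c z = c y *m c z *m c x /\
  c x *m c y *m c z = c z *m c x *m c y.
Proof.
have yx := clif_orth Sigma rg xy; have zx := clif_orth Sigma rg xz.
have zy := clif_orth Sigma rg yz.
split; first by rewrite yx mulNmx -[c y *m c x *m c z]mulmxA zx mulmxN mulmxA
  opprK.
by rewrite -[LHS]mulmxA zy mulmxN mulmxA zx mulNmx opprK.
Qed.

(** Transposition gives a sign (-1)^3 from the skew factors, and restoring their order another
    (-1)^3. *)
Lemma triple_tr : (c x *m c y *m c z)^T = c x *m c y *m c z.
Proof.
rewrite !trmx_mul !(clif_tr Sigma) !(mulNmx, mulmxN) !opprK mulmxA.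
have yx := clif_orth Sigma rg xy; have zy := clif_orth Sigma rg yz.
have [E _] := triple_cycle; rewrite E zy mulNmx.
by rewrite ?opprK.
Qed.

Lemma triple_sqr : c x *m c y *m c z *m (c x *m c y *m c z) = 1%:M.
Proof.
have [_ E] := triple_cycle; rewrite {2}E !mulmxA.
rewrite -[_ *m c z *m c z]mulmxA clif_unit // mulmxN mulmx1 !mulNmx.
rewrite (clif_orth Sigma rg xy) !mulNmx opprK -[c y *m c x *m c x]mulmxA.
by rewrite clif_unit // mulmxN mulmx1 mulNmx clif_unit // opprK.
Qed.

Lemma triple_products (s : R) :
  c x *m c y *m c z *m psi = - (s *: psi) ->
  [/\ c y *m c z *m psi = s *: (c x *m psi),
      c z *m c x *m psi = s *: (c y *m psi) &
      c x *m c y *m psi = s *: (c z *m psi)].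
Proof.
move=> H; have [E1 E2] := triple_cycle; split; apply: oppr_inj.
- have := congr1 (fun q => c x *m q) H; rewrite !mulmxA clif_unit //.
  by rewrite !mulNmx mul1mx mulmxN -scalemxAr.
- have := congr1 (fun q => c y *m q) H; rewrite E1 !mulmxA clif_unit //.
  by rewrite !mulNmx mul1mx mulmxN -scalemxAr.
- have := congr1 (fun q => c z *m q) H; rewrite E2 !mulmxA clif_unit //.
  by rewrite !mulNmx mul1mx mulmxN -scalemxAr.
Qed.

(** Contraction with u leaves three bivectors. On psi each product of two vectors of the triple is s
    times the third, and the two factors s cancel. *)
Lemma clif2_triple (s : R) u : s ^+ 2 = 1 ->
  c x *m c y *m c z *m psi = - (s *: psi) ->
  clif2 Sigma p (fun v w => s * wedge111 (ip x) (ip y) (ip z) u v w) *m psi =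
  ip x u *: (c x *m psi) + ip y u *: (c y *m psi) + ip z u *: (c z *m psi).
Proof.
move=> s2 /triple_products[H1 H2 H3].
have zx : ip z x = 0 by rewrite (innerC rg).
rewrite (@clif2_eq _ _ _ _ Sigma p _ (fun v w => s * ip x u * wedge11 (ip y) (ip
  z) v w +
   s * ip y u * wedge11 (ip z) (ip x) v w + s * ip z u * wedge11 (ip x) (ip y) v
     w)).
  rewrite !clif2D !clif2Z !clif2_wedge // !mulmxDl -!scalemxAl H1 H2 H3
    !scalerA.
  have E k : s * k * s = k by rewrite mulrAC -expr2 s2 mul1r.
  by rewrite !E.
by move=> v w; rewrite /wedge111 /wedge12 /wedge11; ring.
Qed.

End Triple.

Variable e : 'I_7 -> V.
Hypothesis fe : contact_frame phi xi g p e.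
Hypothesis psi_om : clif3 Sigma p (omega phi eta g p) *m psi = (- 7) *: psi.
Local Notation ce k := (c (e (inord k))).

Lemma frame_triple (i j k : nat) : (i < j)%N -> (j < k)%N -> (k < 7)%N ->
  [/\ ip (e (inord i)) (e (inord i)) = 1, ip (e (inord j)) (e (inord j)) = 1,
      ip (e (inord k)) (e (inord k)) = 1, ip (e (inord i)) (e (inord j)) = 0 &
      ip (e (inord i)) (e (inord k)) = 0 /\ ip (e (inord j)) (e (inord k)) = 0].
Proof.
move=> ij jk k7; have j7 := ltn_trans jk k7; have i7 := ltn_trans ij j7.
rewrite !(frame_onb fe) // !eqxx ltn_eqF // (ltn_eqF jk).
by rewrite (ltn_eqF (ltn_trans ij jk)).
Qed.

Definition tripleP (s : R) (i j k : nat) := s *: (ce i *m ce j *m ce k).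

Lemma omega_clif : clif3 Sigma p (omega phi eta g p) =
  tripleP 1 0 1 2 + tripleP 1 0 3 4 + tripleP 1 0 5 6 + tripleP 1 1 3 5
  + tripleP (-1) 1 4 6 + tripleP (-1) 2 3 6 + tripleP (-1) 2 4 5.
Proof.
rewrite /tripleP.
have W (i j k : nat) : (i < j)%N -> (j < k)%N -> (k < 7)%N ->
    ce i *m ce j *m ce k = clif3 Sigma p (wedge111 (ip (e (inord i)))
      (ip (e (inord j))) (ip (e (inord k)))).
  by move=> ij jk k7; have [_ _ _ ? [? ?]] := frame_triple ij jk k7;
     rewrite (clif3_wedge Sigma rg).
rewrite !W // -!clif3Z -!clif3D; apply: clif3_eq => u v w.
exact: (omega_frame rg a3 fe).
Qed.

Lemma omega_triples :
  let Q (s : R) i j k := ce i *m ce j *m ce k *m psi = - (s *: psi) in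
  [/\ Q 1 0%N 1%N 2%N, Q 1 0%N 3%N 4%N, Q 1 0%N 5%N 6%N & Q 1 1%N 3%N 5%N] /\
  [/\ Q (-1) 1%N 4%N 6%N, Q (-1) 2%N 3%N 6%N & Q (-1) 2%N 4%N 5%N].
Proof.
pose P : 'I_7 -> 'M[R]_8 := fun a => nth 0 [:: tripleP 1 0 1 2; tripleP 1 0 3 4;
  tripleP 1 0 5 6; tripleP 1 1 3 5; tripleP (-1) 1 4 6; tripleP (-1) 2 3 6;
  tripleP (-1) 2 4 5] a.
have T (s' : R) i' j' k' : (i' < j')%N -> (j' < k')%N -> (k' < 7)%N -> s' ^+ 2 =
  1 ->
    (tripleP s' i' j' k')^T = tripleP s' i' j' k' /\
    tripleP s' i' j' k' *m tripleP s' i' j' k' = 1%:M.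
  move=> ij jk k7 s2; have [? ? ? ? [? ?]] := frame_triple ij jk k7.
  rewrite /tripleP linearZ /= triple_tr // -scalemxAl -scalemxAr scalerA.
  by rewrite triple_sqr // -expr2 s2 scale1r.
have sqN1 : (-1 : R) ^+ 2 = 1 by rewrite sqrrN expr1n.
have PP : forall a, (P a)^T = P a /\ P a *m P a = 1%:M.
  by apply: I7_case; rewrite /P inordK //; apply: T; rewrite ?expr1n.
have HP : forall a, P a *m psi = - psi.
  apply: involutions_eigen => [a|a|]; [exact: (PP a).1|exact: (PP a).2|].
  rewrite card_ord -psi_om omega_clif -mulmx_suml; congr (_ *m _).
  by rewrite !big_ord_recl big_ord0 addr0 /P /= !addrA.
have L a : (a < 7)%N -> nth 0 [:: tripleP 1 0 1 2; tripleP 1 0 3 4;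
  tripleP 1 0 5 6; tripleP 1 1 3 5; tripleP (-1) 1 4 6; tripleP (-1) 2 3 6;
  tripleP (-1) 2 4 5] a *m psi = - psi.
  by move=> a7; have := HP (Ordinal a7).
have fin (s' : R) i' j' k' : s' ^+ 2 = 1 -> tripleP s' i' j' k' *m psi = - psi
  ->
    ce i' *m ce j' *m ce k' *m psi = - (s' *: psi).
  move=> s2 H; have := congr1 ( *:%R s') H.
  by rewrite /tripleP -scalemxAl scalerA -expr2 s2 scale1r scalerN.
split; split; apply: fin; rewrite ?sqN1 ?expr1n //.
- exact: (L 0%N).
- exact: (L 1%N).
- exact: (L 2%N).
- exact: (L 3%N).
- exact: (L 4%N).
- exact: (L 5%N).
- exact: (L 6%N).
Qed.

Lemma clif_frame_sum u : c u *m psi = \sum_a ip (e a) u *: (c (e a) *m psi).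
Proof.
rewrite {1}[u](frame_expand fe) clif_sum mulmx_suml; apply: eq_bigr => a _.
by rewrite clifZ -scalemxAl.
Qed.

(** Each triple containing a frame index contributes that component of u once, and every index lies
    in exactly three of the seven triples. *)
Lemma clif2_omega u :
  clif2 Sigma p (fun v w => omega phi eta g p u v w) *m psi =
  3 *: (c u *m psi).
Proof.
pose m k := ip (e (inord k)) u *: (ce k *m psi).
rewrite (clif2_eq Sigma p (omega_frame rg a3 fe u)).
have H (s : R) i j k : (i < j)%N -> (j < k)%N -> (k < 7)%N -> s ^+ 2 = 1 ->
    ce i *m ce j *m ce k *m psi = - (s *: psi) ->
    clif2 Sigma p (frame_wedge g p e s i j k u) *m psi = m i + m j + m k.
  move=> ij jk k7 s2 Q; have [? ? ? ? [? ?]] := frame_triple ij jk k7.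
  exact: clif2_triple.
have sqN1 : (-1 : R) ^+ 2 = 1 by rewrite sqrrN expr1n.
have [[H1 H2 H3 H4] [H5 H6 H7]] := omega_triples.
rewrite !clif2D !mulmxDl !H ?sqN1 ?expr1n //.
rewrite clif_frame_sum sum7 -/(m 0%N) -/(m 1%N) -/(m 2%N) -/(m 3%N) -/(m 4%N).
rewrite -/(m 5%N) -/(m 6%N).
move: (m 0%N) (m 1%N) (m 2%N) (m 3%N) (m 4%N) (m 5%N) (m 6%N).
by move=> m0 m1 m2 m3 m4 m5 m6; apply/colP => a; rewrite !mxE; ring.
Qed.

Lemma clif2_vertical u :
  clif2 Sigma p (wedge111 (et 0) (et 1) (et 2) u) *m psi =
  \sum_i et i u *: (c (xi i p) *m psi).
Proof.
have [? ? ? ? [? ?]] := @frame_triple 0%N 1%N 2%N isT isT isT.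
have [[H1 _ _ _] _] := omega_triples.
rewrite (@clif2_eq _ _ _ _ Sigma p _ (fun v w => 1 * wedge111 (ip (e (inord 0)))
   (ip (e (inord 1))) (ip (e (inord 2))) u v w)); last first.
  move=> v w; rewrite mul1r /wedge111 /wedge12 /wedge11.
  by rewrite !(eta_frame rg a3 fe).
rewrite clif2_triple ?expr1n // !big_ord_recl big_ord0 addr0 addrA.
have -> : lift ord0 (ord0 : 'I_2) = 1 :> 'I_3 by apply: val_inj.
have -> : lift ord0 (lift ord0 (ord0 : 'I_1)) = 2 :> 'I_3 by apply: val_inj.
have -> : ord0 = 0 :> 'I_3 by apply: val_inj.
by rewrite !(eta_frame rg a3 fe) (cf_xi0 fe) (cf_xi1 fe) (cf_xi2 fe).
Qed.

Local Notation q k := (ce k *m psi).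

Lemma frame_products (s : R) i j k : (i < j)%N -> (j < k)%N -> (k < 7)%N ->
  ce i *m ce j *m ce k *m psi = - (s *: psi) ->
  (ce i *m q j = s *: q k) * (ce j *m q k = s *: q i) *
  (ce k *m q i = s *: q j) * (ce j *m q i = - (s *: q k)) *
  (ce k *m q j = - (s *: q i)) * (ce i *m q k = - (s *: q j)).
Proof.
move=> ij jk k7 Q.
have [ii jj kk oij [oik ojk]] := frame_triple ij jk k7.
have [H1 H2 H3] := triple_products ii jj kk oij oik ojk Q.
rewrite !mulmxA; split; [split; [split; [split; [split|]|]|]|] => //.
- by rewrite (clif_orth Sigma rg (u := e (inord j))) ?mulNmx ?H3 // (innerC rg).
- by rewrite (clif_orth Sigma rg (u := e (inord k))) ?mulNmx ?H1 // (innerC rg).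
- by rewrite (clif_orth Sigma rg) ?mulNmx ?H2 // (innerC rg).
Qed.

(* Clifford multiplication by xi_i on psi is, up to the scalar part, minus
   phi_i on H and phi_i on V. *)
Lemma clif_xi i u : let j := ordS i in let k := ordS j in
  c (xi i p) *m (c u *m psi) = - et i u *: psi - c (phi i p *m u) *m psi
  + (2 * et j u) *: (c (xi k p) *m psi) - (2 * et k u) *: (c (xi j p) *m psi).
Proof.
move=> j k.
pose F v := c (xi i p) *m (c v *m psi).
pose G v := - et i v *: psi - c (phi i p *m v) *m psi
  + (2 * et j v) *: (c (xi k p) *m psi) - (2 * et k v) *: (c (xi j p) *m psi).
rewrite -/(F u) -/(G u).
have FL a x y : F (a *: x + y) = a *: F x + F y.
  by rewrite /F clif_linear mulmxDl mulmxDr -scalemxAl -scalemxAr.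
have GL a x y : G (a *: x + y) = a *: G x + G y.
  rewrite /G mulmxDr -scalemxAr clif_linear mulmxDl -scalemxAl !evD !evZ.
  move: (c (phi i p *m x) *m psi) (c (phi i p *m y) *m psi).
  move: (c (xi k p) *m psi) (c (xi j p) *m psi) => r1 r2 r3 r4.
  by apply/colP => l; rewrite !mxE; ring.
(* Both sides are linear in u, so the seven frame vectors decide. For each i only the three triples
   containing the index of xi_i are used; together they reach all the other frame vectors. *)
suff E a : F (e a) = G (e a).
  rewrite [u](frame_expand fe); apply: (big_rec (fun v => F v = G v)).
    have F0 := FL (-1) 0 0; have G0 := GL (-1) 0 0.
    by move: F0 G0; rewrite !scaleN1r !addNr => -> ->.
  by move=> a v _ H; rewrite FL GL E H.
move: a; have [[H1 H2 H3 H4] [H5 H6 H7]] := omega_triples.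
have P1 := @frame_products 1 0 1 2 isT isT isT H1; have P2 := @frame_products 1
  0 3 4 isT isT isT H2.
have P3 := @frame_products 1 0 5 6 isT isT isT H3; have P4 := @frame_products 1
  1 3 5 isT isT isT H4.
have P5 := @frame_products (-1) 1 4 6 isT isT isT H5; have P6 := @frame_products
  (-1) 2 3 6 isT isT isT H6.
have P7 := @frame_products (-1) 2 4 5 isT isT isT H7.
have sq l : (l < 7)%N -> ce l *m q l = - psi.
  by move=> l7; rewrite mulmxA clif_unit ?mulNmx ?mul1mx // (frame_onb fe)
    ?eqxx.
have [a0 a1 a2 [a3' a4 a5 a6]] := phi_frame0 rg a3 fe.
have [b0 b1 b2 [b3 b4 b5 b6]] := phi_frame1 rg a3 fe.
have [d0 d1 d2 [d3 d4 d5 d6]] := phi_frame2 rg a3 fe.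
have c0 : c 0 = 0 by exact: clif0.
rewrite /F /G /k /j; clear F G FL GL u j k.
move: i; apply: (@I3_case _ 0); rewrite ?ordS_3 -?(cf_xi0 fe) -?(cf_xi1 fe)
  -?(cf_xi2 fe).
- apply: I7_case; rewrite !(eta_frame rg a3 fe) !(frame_onb fe) // ?a0 ?a1 ?a2
  ?a3' ?a4 ?a5 ?a6 ?(clifN Sigma) ?c0 ?mul0mx ?mulNmx ?P1 ?P2 ?P3 ?sq //=;
  apply/colP => l; rewrite !mxE /=; ring.
- apply: I7_case; rewrite !(eta_frame rg a3 fe) !(frame_onb fe) // ?b0 ?b1 ?b2
  ?b3 ?b4 ?b5 ?b6 ?(clifN Sigma) ?c0 ?mul0mx ?mulNmx ?P1 ?P4 ?P5 ?sq //=;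
  apply/colP => l; rewrite !mxE /=; ring.
- apply: I7_case; rewrite !(eta_frame rg a3 fe) !(frame_onb fe) // ?d0 ?d1 ?d2
  ?d3 ?d4 ?d5 ?d6 ?(clifN Sigma) ?c0 ?mul0mx ?mulNmx ?P1 ?P6 ?P7 ?sq //=;
  apply/colP => l; rewrite !mxE /=; ring.
Qed.

End SpinorAlgebra.

(** * Connections *)

Section Connections.
Variables (R : realType) (M : topologicalType) (A : manifold7 R M).
Local Notation V := 'cV[R]_7.
Variables (g : M -> 'M[R]_7) (Sigma : spin_bundle A g).
Hypothesis rg : riemannian A g.
Implicit Types (p : M) (u v w : V) (X Y Z : M -> V).

(** Constant coefficients in the local orthonormal frame around p give a field smooth at p with
    value u there, on which tensorial identities can be tested. *)
Definition extend p u : M -> V :=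
  fun q => \sum_i inner g p (sframe Sigma p i p) u *: sframe Sigma p i q.

Lemma smooth_extend p u : smooth_vf A (extend p u) p.
Proof.
apply: smooth_section_sum => i; apply: smooth_sectionZ.
  exact: smooth_fun_cst.
exact: sframe_smooth.
Qed.

Lemma extendE p u : extend p u p = u.
Proof. by rewrite /extend -(onb_expand u (sframe_onb_at Sigma p)). Qed.

(** The Koszul argument. F, the difference of the two connections, is skew in its last two arguments
    because both are metric, and its skew part in the first two is T; total skewness of T then
    forces F = T / 2. *)
Lemma nabla_torsion (nabla nablag : (M -> V) -> M -> V -> V) T p Y u :
  metric_connection A g nabla -> has_torsion A nabla T ->
  (forall p u v w, inner g p (T p u v) w = - inner g p (T p v u) w /\
                   inner g p (T p u v) w = - inner g p (T p u w) v) ->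
  levi_civita A g nablag -> smooth_vf A Y p ->
  nablag Y p u = nabla Y p u - 2^-1 *: T p u (Y p).
Proof.
move=> [cn mn] tn Ts [[cg mg] tg] sY.
pose D X Z := nabla Z p (X p) - nablag Z p (X p).
pose F X Y Z := inner g p (D X Y) (Z p).
have F23 X1 Y1 Z1 : smooth_vf A X1 p -> smooth_vf A Y1 p -> smooth_vf A Z1 p ->
    F X1 Y1 Z1 = - F X1 Z1 Y1.
  move=> sX1 sY1 sZ1; have := mn _ _ p (X1 p) sY1 sZ1; rewrite mg // => E.
  rewrite /F /D !(innerBl rg) (innerC rg _ (nabla Z1 _ _)).
  by rewrite (innerC rg _ (nablag Z1 _ _)); move/eqP: E; rewrite -subr_eq0 =>
    /eqP E; lra.
have F12 X1 Y1 Z1 : smooth_vf A X1 p -> smooth_vf A Y1 p -> smooth_vf A Z1 p ->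
    F X1 Y1 Z1 = F Y1 X1 Z1 + inner g p (T p (X1 p) (Y1 p)) (Z1 p).
  move=> sX1 sY1 sZ1; have E1 := tn _ _ _ sX1 sY1; have E2 := tg _ _ _ sX1 sY1.
  rewrite E1 /F -(innerDl rg); congr (inner _ _ _ _); rewrite /D.
  have -> : nablag Y1 p (X1 p) = nablag X1 p (Y1 p) + lie A X1 Y1 p.
    by apply/eqP; rewrite addrC -subr_eq -subr_eq0 -E2.
  by rewrite opprD addrA [RHS]addrC addrA [_ - nabla X1 p _ - _]addrAC subrK
    addrAC.
apply: (@inner_inj _ _ _ _ rg p) => w.
set X := extend p u; set Z := extend p w.
have sX : smooth_vf A X p by exact: smooth_extend.
have sZ : smooth_vf A Z p by exact: smooth_extend.
have Xp : X p = u by exact: extendE.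
have Zp : Z p = w by exact: extendE.
(* The alternating swaps run through all six orders of X, Y, Z. They return to the start after three
   sign changes, which yields an equation for 2 F. *)
have A1 := F12 _ _ _ sX sY sZ; have A2 := F23 _ _ _ sY sX sZ.
have A3 := F12 _ _ _ sY sZ sX; have A4 := F23 _ _ _ sZ sY sX.
have A5 := F12 _ _ _ sZ sX sY; have A6 := F23 _ _ _ sX sZ sY.
have T1 := (Ts p (Y p) w u).1; have T2 := (Ts p (Y p) w u).2.
have T3 := (Ts p w (Y p) u).2; have T4 := (Ts p w u (Y p)).1.
have T5 := (Ts p u (Y p) w).1.
rewrite (innerBl rg) (innerZl rg).
have H : F X Y Z = inner g p (nabla Y p u) w - inner g p (nablag Y p u) w.
  by rewrite /F /D (innerBl rg) Xp Zp.
rewrite !Xp ?Zp in A1 A3 A5 H.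
by lra.
Qed.

(** * The spin connection and its Leibniz rule *)

Section SpinLeibniz.
Variable nablag : (M -> V) -> M -> V -> V.
Variable nablaS : (M -> 'cV[R]_8) -> M -> V -> 'cV[R]_8.
Hypothesis lc : levi_civita A g nablag.
Hypothesis sc : spin_connection Sigma nablag nablaS.
Variable p : M.
Local Notation c := (clif Sigma p).
Local Notation f i := (sframe Sigma p i).
Local Notation C q := (scoord Sigma p q).

Definition spin_sframe a : M -> 'cV[R]_8 := fun q => (C q)^T *m delta_mx a 0.

Lemma near_scoord_orthr : \forall q \near p, (C q)^T *m C q = 1%:M.
Proof. by apply: filterS (scoord_orth Sigma p) => q; exact: mulmx1C. Qed.

Lemma smooth_spin_sframe a : smooth_section A (scoord Sigma) (spin_sframe a) p.
Proof.
move=> b; apply: smooth_fun_eq (smooth_fun_cst A ((delta_mx a 0 : 'cV[R]_8) b 0)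
  p).
by apply: filterS (scoord_orth Sigma p) => q E; rewrite /spin_sframe mulmxA E
  mul1mx.
Qed.

Definition conn_form u i j := inner g p (nablag (f i) p u) (f j p).

Definition spin_form u : 'M[R]_8 :=
  4^-1 *: \sum_i \sum_j conn_form u i j *: (c (f i p) *m c (f j p)).

Lemma nablaS_frame a u : nablaS (spin_sframe a) p u = spin_form u *m spin_sframe
  a p.
Proof.
have [_ /(_ p)/nbhs_singleton/(_ u a) ->] := sc.
rewrite -scalemxAl; congr (_ *: _).
rewrite mulmx_suml; apply: eq_bigr => i _; rewrite mulmx_suml.
by apply: eq_bigr => j _; rewrite -scalemxAl.
Qed.

(** In the spinor frame covering the orthonormal frame, the connection is the ordinary derivative of
    the coordinates plus the matrix [spin_form]. *)
Lemma nablaS_coord psi u : smooth_section A (scoord Sigma) psi p ->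
  nablaS psi p u =
  (C p)^T *m \col_a dfun A (fun q => (C q *m psi q) a 0) p u + spin_form u *m
    psi p.
Proof.
move=> sp; have [cS _] := sc.
have E : \forall q \near p, psi q = \sum_a (C q *m psi q) a 0 *: spin_sframe a
  q.
  apply: filterS near_scoord_orthr => q E.
  rewrite -[LHS]mul1mx -E -mulmxA {1}[C q *m psi q]matrix_sum_delta mulmx_sumr.
  by apply: eq_bigr => a _; rewrite big_ord1 -scalemxAr.
have ss a : smooth_section A (scoord Sigma)
    (fun q => (C q *m psi q) a 0 *: spin_sframe a q) p.
  by apply: smooth_sectionZ; [exact: sp|exact: smooth_spin_sframe].
rewrite (nabla_eq cS u E) // (nabla_sum cS) //.
have E1 : psi p = (C p)^T *m (C p *m psi p).
  by rewrite mulmxA (nbhs_singleton near_scoord_orthr) mul1mx.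
rewrite [X in spin_form u *m X]E1 [X in (C p)^T *m X + _]matrix_sum_delta.
rewrite [X in spin_form u *m (_ *m X)]matrix_sum_delta !mulmx_sumr.
rewrite -big_split; apply: eq_bigr => a _ /=.
rewrite (nabla_leibniz cS u (sp a) (smooth_spin_sframe a)).
rewrite nablaS_frame !big_ord1 mxE -!scalemxAr; congr (_ *: _ + _ *: _).
Qed.

Lemma near_frame_expand Y : \forall q \near p,
  Y q = \sum_i inner g q (f i q) (Y q) *: f i q.
Proof.
by apply: filterS (sframe_onb Sigma p) => q oq; rewrite -(onb_expand _ oq).
Qed.

Lemma nablag_coord Y u : smooth_vf A Y p ->
  nablag Y p u = \sum_i (dfun A (fun q => inner g q (f i q) (Y q)) p u *: f i p
                   + inner g p (f i p) (Y p) *: nablag (f i) p u).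
Proof.
move=> sY; have [[cg _] _] := lc.
have si i : smooth_fun A (fun q => inner g q (f i q) (Y q)) p.
  by apply: (Defs.metric_smooth rg) => //; exact: sframe_smooth.
rewrite (nabla_eq cg u (near_frame_expand Y) sY) (nabla_sum cg) => [|i].
  by apply: eq_bigr => i _; rewrite (nabla_leibniz cg) //; exact: sframe_smooth.
by apply: smooth_sectionZ => //; exact: sframe_smooth.
Qed.

Lemma conn_form_skew u i j : conn_form u i j = - conn_form u j i.
Proof.
have [[_ mg] _] := lc.
have := mg _ _ p u (sframe_smooth Sigma p i) (sframe_smooth Sigma p j).
rewrite (@dfun_eq _ _ A _ (fun=> (i == j)%:R)); last first.
  by apply: filterS (sframe_onb Sigma p) => q ->.
rewrite dfun_cst (innerC rg p (f i p)) => /esym/eqP.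
by rewrite addr_eq0 => /eqP.
Qed.

(** This expresses that the spin connection lifts the orthogonal one. Moving e_k through e_i e_j
    leaves -2 delta_jk e_i + 2 delta_ik e_j; since the connection form is skew, both parts sum to
    twice nabla^g e_k, and the factor 1/4 together with the double sum gives exactly nabla^g e_k. *)
Lemma spin_form_comm u k :
  spin_form u *m c (f k p) = c (nablag (f k) p u) + c (f k p) *m spin_form u.
Proof.
have oc i j : c (f i p) *m c (f j p) = - (c (f j p) *m c (f i p)) +
    (- 2 * (i == j)%:R)%:M.
  rewrite -(sframe_onb_at Sigma p i j) -(clif_anti Sigma rg).
  by rewrite addrC -addrA addrN addr0.
have E i j : c (f i p) *m c (f j p) *m c (f k p) =
    c (f k p) *m (c (f i p) *m c (f j p)) + ((- 2 * (j == k)%:R) *: c (f i p)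
      + (2 * (i == k)%:R) *: c (f j p)).
  rewrite -mulmxA oc mulmxDr mulmxN !mulmxA (oc i k) mulmxDl mulNmx.
  rewrite mul_mx_scalar mul_scalar_mx opprD opprK addrAC -addrA; congr (_ + _).
  by rewrite -scaleNr; congr (_ + _ *: _); ring.
pose k4 : R := 4^-1.
have -> : spin_form u =
  k4 *: \sum_i \sum_j conn_form u i j *: (c (f i p) *m c (f j p)) by [].
rewrite -scalemxAl -scalemxAr mulmx_suml mulmx_sumr.
have -> : c (nablag (f k) p u) = k4 *: \sum_i \sum_j conn_form u i j *:
   ((- 2 * (j == k)%:R) *: c (f i p) + (2 * (i == k)%:R) *: c (f j p)).
  rewrite {1}[nablag _ _ _](onb_expand _ (sframe_onb_at Sigma p)) clif_sum.
  under [X in _ = k4 *: X]eq_bigr => i _ do under eq_bigr => j _ do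
    rewrite scalerDr !scalerA.
  under [X in _ = k4 *: X]eq_bigr => i _ do rewrite big_split /=.
  rewrite big_split /=.
  have S1 : \sum_i \sum_j (conn_form u i j * (- 2 * (j == k)%:R)) *: c (f i p) =
      \sum_i (2 * conn_form u k i) *: c (f i p).
    apply: eq_bigr => i _; rewrite (bigD1 k) //= big1 => [|j /negPf ->].
      by rewrite eqxx mulr1 addr0 conn_form_skew; congr (_ *: _); ring.
    by rewrite !mulr0 scale0r.
  have S2 : \sum_i \sum_j (conn_form u i j * (2 * (i == k)%:R)) *: c (f j p) =
      \sum_i (2 * conn_form u k i) *: c (f i p).
    rewrite (bigD1 k) //= [X in _ + X]big1 => [|i /negPf E0].
      rewrite addr0; apply: eq_bigr => j _; by rewrite eqxx mulr1 mulrC.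
    by rewrite big1 // => j _; rewrite E0 !mulr0 scale0r.
  rewrite S1 S2 -big_split scaler_sumr; apply: eq_bigr => i _ /=.
  rewrite -scalerDl scalerA clifZ /conn_form (innerC rg); congr (_ *: _).
  by rewrite /k4; field.
rewrite -scalerDr -big_split; congr (_ *: _); apply: eq_bigr => i _ /=.
rewrite mulmx_suml mulmx_sumr -big_split; apply: eq_bigr => j _ /=.
by rewrite -scalemxAl -scalemxAr E scalerDr addrC.
Qed.

Lemma clif_coord Y (psi : M -> 'cV[R]_8) : \forall q \near p,
  C q *m (clif Sigma q (Y q) *m psi q) =
  \sum_i inner g q (f i q) (Y q) *: (gamma Sigma i *m (C q *m psi q)).
Proof.
apply: filterS2 (near_frame_expand Y) (clif_frame Sigma p) => q EY Ec.
rewrite {1}EY clif_sum mulmx_suml mulmx_sumr; apply: eq_bigr => i _.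
by rewrite clifZ -scalemxAl -scalemxAr !mulmxA Ec.
Qed.

Lemma smooth_clif Y (psi : M -> 'cV[R]_8) : smooth_vf A Y p ->
  smooth_section A (scoord Sigma) psi p ->
  smooth_section A (scoord Sigma) (fun q => clif Sigma q (Y q) *m psi q) p.
Proof.
move=> sY sp b.
apply: (@smooth_fun_eq _ _ _ (fun q => \sum_i inner g q (f i q) (Y q) *
   \sum_a gamma Sigma i b a * (C q *m psi q) a 0)).
  apply: filterS (clif_coord Y psi) => q ->.
  by rewrite summxE; apply: eq_bigr => i _; rewrite !mxE.
apply: smooth_fun_sum => i; apply: smooth_funM.
  by apply: (Defs.metric_smooth rg) => //; exact: sframe_smooth.
apply: smooth_fun_sum => a; apply: smooth_funM; first exact: smooth_fun_cst.
exact: sp.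
Qed.

(** In spinor coordinates the frame vectors act by constant matrices, so the ordinary derivative
    only sees the coefficients of Y and the coordinates of psi. The derivatives of the frame itself
    come from [spin_form_comm]. *)
Lemma nablaS_clif Y (psi : M -> 'cV[R]_8) u : smooth_vf A Y p ->
  smooth_section A (scoord Sigma) psi p ->
  nablaS (fun q => clif Sigma q (Y q) *m psi q) p u =
  c (nablag Y p u) *m psi p + c (Y p) *m nablaS psi p u.
Proof.
move=> sY sp; rewrite !nablaS_coord //; last exact: smooth_clif.
set y := fun i q => inner g q (f i q) (Y q).
have sy i : smooth_fun A (y i) p.
  by apply: (Defs.metric_smooth rg) => //; exact: sframe_smooth.
pose dF := \col_a dfun A (fun q => (C q *m psi q) a 0) p u.
have -> : \col_b dfun A (fun q => (C q *m (clif Sigma q (Y q) *m psi q)) b 0) p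
  u =
    \sum_i (dfun A (y i) p u *: (gamma Sigma i *m (C p *m psi p)) +
       y i p *: (gamma Sigma i *m dF)).
  apply/colP => b; rewrite mxE summxE.
  rewrite (@dfun_eq _ _ A _ (fun q => \sum_i y i q *
    \sum_a gamma Sigma i b a * (C q *m psi q) a 0)); last first.
    apply: filterS (clif_coord Y psi) => q ->.
    by rewrite summxE; apply: eq_bigr => i _; rewrite !mxE.
  have sG i : smooth_fun A
      (fun q => \sum_a gamma Sigma i b a * (C q *m psi q) a 0) p.
    apply: smooth_fun_sum => a; apply: smooth_funM; last exact: sp.
    exact: smooth_fun_cst.
  rewrite dfun_sum => [|i]; last exact: smooth_funM.
  apply: eq_bigr => i _; rewrite dfunM // addrC dfun_sum => [|a]; last first.
    by apply: smooth_funM; [exact: smooth_fun_cst|exact: sp].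
  rewrite !mxE [X in X + _]mulrC; congr (_ * _ + _ * _).
    apply: eq_bigr => a _; rewrite mxE dfunZ //; exact: sp.
rewrite mulmx_sumr.
have cE i : c (f i p) = (C p)^T *m gamma Sigma i *m C p := clif_sframe Sigma p
  i.
have CC : C p *m (C p)^T = 1%:M by apply: mulmx1C; exact: scoord_orth_at.
have E : forall i, (C p)^T *m (dfun A (y i) p u *: (gamma Sigma i *m (C p *m psi
  p)) +
      y i p *: (gamma Sigma i *m dF)) =
   c (dfun A (y i) p u *: f i p) *m psi p + c (y i p *: f i p) *m ((C p)^T *m
     dF).
  move=> i; rewrite mulmxDr -!scalemxAr !clifZ -!scalemxAl cE !mulmxA.
  by rewrite -[_ *m C p *m (C p)^T]mulmxA CC mulmx1.
under eq_bigr do rewrite E.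
rewrite big_split /= -!mulmx_suml -!clif_sum.
have YE : \sum_i y i p *: f i p = Y p by rewrite -(nbhs_singleton
  (near_frame_expand Y)).
rewrite YE (nablag_coord u sY) big_split /= clifD mulmxDl -addrA -[RHS]addrA.
congr (_ + _); rewrite mulmxDr [RHS]addrCA; congr (_ + _).
(* With the derivative terms matched, the rest is the commutator of [spin_form] with multiplication
   by Y, computed frame vector by frame vector. *)
rewrite !mulmxA -mulmxDl; congr (_ *m _).
rewrite -YE !clif_sum mulmx_sumr mulmx_suml -big_split; apply: eq_bigr => i _
  /=.
by rewrite !clifZ YE -/(y i p) -[spin_form u *m _]scalemxAr -[_ *m spin_form
  u]scalemxAl -scalerDr
  spin_form_comm.
Qed.

End SpinLeibniz.
End Connections.

(** * The canonical connection *)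

Section ThreeSasaki.
Variables (R : realType) (M : topologicalType) (A : manifold7 R M).
Local Notation V := 'cV[R]_7.
Variables (phi : 'I_3 -> M -> 'M[R]_7) (xi : 'I_3 -> M -> V).
Variables (eta : 'I_3 -> M -> 'rV[R]_7) (g : M -> 'M[R]_7).
Variables (alpha delta : R).
Variables (nabla nablag : (M -> V) -> M -> V -> V) (T : M -> V -> V -> V).
Variable Sigma : spin_bundle A g.
Hypothesis rg : riemannian A g.
Hypothesis sa : sasaki_3ad A phi xi eta g alpha delta.
Hypothesis lc : levi_civita A g nablag.
Hypothesis cc : canonical_connection A phi eta g alpha delta nabla T.
Variable p : M.
Implicit Types (u v w : V) (X Y Z : M -> V) (i : 'I_3).
Local Notation ip := (inner g p).
Local Notation et i := (ev (eta i p)).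
Local Notation beta := (2 * (delta - 2 * alpha)).

Let a3 : almost_3contact_metric A phi xi eta g.
Proof. by case: sa. Qed.

Lemma smooth_xi i q : smooth_vf A (xi i) q.
Proof. by have [_ H _ _ _ _] := acm_each a3 i; exact: H. Qed.

Lemma smooth_phi i Y : smooth_vf A Y p -> smooth_vf A (fun q => phi i q *m Y q)
  p.
Proof. by have [H _ _ _ _ _] := acm_each a3 i; exact: H. Qed.

Lemma inner_xiE i Y : (fun q => ev (eta i q) (Y q)) = (fun q => inner g q (xi i
  q) (Y q)).
Proof. by apply/funext => q; rewrite (inner_xi rg a3). Qed.

(** Differentiating phi_i xi_i = 0 gives phi_i (nabla xi_i). As xi_i has constant length, nabla xi_i
    is orthogonal to xi_i, where phi_i^2 = -1, so a second application of phi_i recovers it. *)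
Lemma nabla_xi i u : let j := ordS i in let k := ordS j in
  nabla (xi i) p u = beta *: (et k u *: xi j p - et j u *: xi k p).
Proof.
move=> j k; have [[cn mn] _ _ /(_ i p u _ (smooth_xi i p))] := cc.
have -> : (fun q => phi i q *m xi i q) = (fun=> 0).
  by apply/funext => q; exact: (phi_xi_self a3 q i).
rewrite (nabla0 cn) sub0r -/j -/k; set N := nabla _ _ _.
have [_ ->] := phi_xi a3 p i.
have [/= H1 H2] := phi_xi a3 p k; rewrite /k /j !ordS3 in H1 H2.
rewrite -/j in H1 H2; rewrite -/k in H1 H2; rewrite -/k H1 => H.
have N0 : et i N = 0.
  have := mn _ _ p u (smooth_xi i p) (smooth_xi i p).
  have -> : (fun q => inner g q (xi i q) (xi i q)) = (fun=> 1).
    by apply/funext => q; rewrite (inner_xi rg a3) (eta_xi_self a3).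
  by rewrite dfun_cst (innerC rg p _ (xi i p)) (inner_xi rg a3) -/N => E; lra.
have := phi2E a3 p i N; rewrite N0 scale0r addr0 => E.
rewrite -[LHS]opprK -E -[phi i p *m N]opprK H mulmxN opprK -scalemxAr.
rewrite mulmxDr mulmxN -!scalemxAr mulmxN H2.
have [-> _] := phi_xi a3 p i.
by rewrite opprK.
Qed.

(** Smoothness and the value of the derivative travel together, so that the derivative of a
    polynomial expression in eta_i and Phi_i is built by following its syntax. *)
Definition has_dfun (f : M -> R) u d := smooth_fun A f p /\ dfun A f p u = d.

Lemma has_dfun_eq f u d d' : has_dfun f u d -> d = d' -> has_dfun f u d'.
Proof. by move=> H <-. Qed.

Lemma has_dfunD f h u d e : has_dfun f u d -> has_dfun h u e ->
  has_dfun (fun q => f q + h q) u (d + e).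
Proof. by move=> [sf <-] [sh <-]; split; [exact: smooth_funD|exact: dfunD]. Qed.

Lemma has_dfunM f h u d e : has_dfun f u d -> has_dfun h u e ->
  has_dfun (fun q => f q * h q) u (f p * e + h p * d).
Proof. by move=> [sf <-] [sh <-]; split; [exact: smooth_funM|exact: dfunM]. Qed.

Lemma has_dfun_cst (k : R) u : has_dfun (fun=> k) u 0.
Proof. by split; [exact: smooth_fun_cst|exact: dfun_cst]. Qed.

Lemma has_dfunB f h u d e : has_dfun f u d -> has_dfun h u e ->
  has_dfun (fun q => f q - h q) u (d - e).
Proof.
move=> Hf Hh; have := has_dfunD Hf (has_dfunM (has_dfun_cst (-1) u) Hh).
under [X in has_dfun X]funext do rewrite mulN1r.
by move/has_dfun_eq; apply; ring.
Qed.

Lemma has_dfun_inner X Y u : smooth_vf A X p -> smooth_vf A Y p ->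
  has_dfun (fun q => inner g q (X q) (Y q)) u
    (ip (nabla X p u) (Y p) + ip (X p) (nabla Y p u)).
Proof.
move=> sX sY; have [[_ mn] _ _ _] := cc; split; last exact: mn.
exact: (Defs.metric_smooth rg).
Qed.

Lemma has_dfun_eta i Y u : smooth_vf A Y p -> let j := ordS i in let k := ordS j
  in
  has_dfun (fun q => ev (eta i q) (Y q)) u
    (beta * (et k u * et j (Y p) - et j u * et k (Y p)) + et i (nabla Y p u)).
Proof.
move=> sY j k; rewrite inner_xiE; apply: has_dfun_eq (has_dfun_inner u
  (smooth_xi i p) sY) _.
rewrite nabla_xi (innerZl rg) (innerBl rg) !(innerZl rg) !(inner_xi rg a3) //.
Qed.

Lemma has_dfun_Phi i X Y u : smooth_vf A X p -> smooth_vf A Y p ->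
  let j := ordS i in let k := ordS j in
  has_dfun (fun q => Phi phi g i q (X q) (Y q)) u
    (Phi phi g i p (nabla X p u) (Y p) + Phi phi g i p (X p) (nabla Y p u)
     + beta * (et k u * Phi phi g j p (X p) (Y p)
               - et j u * Phi phi g k p (X p) (Y p))).
Proof.
move=> sX sY j k.
apply: has_dfun_eq (has_dfun_inner u sX (smooth_phi i sY)) _.
have [_ _ _ /(_ i p u _ sY)/eqP] := cc; rewrite subr_eq => /eqP ->.
rewrite -/j -/k /Phi innerDr innerZr innerBr !innerZr; ring.
Qed.

Lemma torsionE X Y : smooth_vf A X p -> smooth_vf A Y p ->
  T p (X p) (Y p) = nabla Y p (X p) - nabla X p (Y p) - lie A X Y p.
Proof. by have [_ H _ _] := cc; exact: H. Qed.

(** Written with nabla, d eta_i is eta_i(T) plus the antisymmetrized nabla eta_i, which equals -2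
    beta eta_j /\ eta_k; and 2 (alpha - delta) + 2 beta = 2 delta - 6 alpha. *)
Lemma torsion_xi i u v : let j := ordS i in let k := ordS j in
  ip (T p u v) (xi i p) = 2 * alpha * Phi phi g i p u v
  + (2 * delta - 6 * alpha) * wedge11 (et j) (et k) u v.
Proof.
move=> j k; set X := extend Sigma p u; set Y := extend Sigma p v.
have sX : smooth_vf A X p by exact: smooth_extend.
have sY : smooth_vf A Y p by exact: smooth_extend.
have Xp : X p = u by exact: extendE.
have Yp : Y p = v by exact: extendE.
have [_ _ /(_ i p X Y sX sY)] := sa; rewrite -/j -/k /d1.
have [_ ->] := has_dfun_eta i (X p) sY; have [_ ->] := has_dfun_eta i (Y p) sX.
rewrite -/j -/k Xp Yp => H; have TE := torsionE sX sY; rewrite Xp Yp in TE.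
rewrite (innerC rg) (inner_xi rg a3) TE !evD !evN.
by move: H; rewrite /wedge11; lra.
Qed.

(** This is d(d eta_1) = 0 on commuting extensions of u, v, w. The derivatives of the fields occur
    in the combinations nabla_X Y - nabla_Y X = T(X, Y), and alpha nonzero allows division by 2
    alpha. *)
Lemma torsion_cyclic u v w : horizontal eta p u -> horizontal eta p v ->
  horizontal eta p w ->
  ip (T p u v) (phi 0 p *m w) + ip (T p v w) (phi 0 p *m u)
  + ip (T p w u) (phi 0 p *m v) = 0.
Proof.
move=> hu hv hw.
have [al0 _ Hd] := sa; have [_ _ Hs _] := cc.
pose B q x y := 2 * alpha * Phi phi g 0 q x y
  + 2 * (alpha - delta) * wedge11 (ev (eta 1 q)) (ev (eta 2 q)) x y.
have HB q X Y : smooth_vf A X q -> smooth_vf A Y q ->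
    d1 A (eta 0) X Y q = B q (X q) (Y q).
  by move=> sX sY; rewrite Hd // !ordS_3.
have se : smooth_form1 A (eta 0) by have [_ _ H _ _ _] := acm_each a3 0; exact:
  H.
(* Three properties are retained of the coordinate fields: their values at p, their vanishing
   brackets there, and the cyclic identity. *)
have [F [sF Fp lF]] : exists F : V -> M -> V, [/\ forall x, smooth_vf A (F x) p,
    forall x, F x p = x & (forall x y, lie A (F x) (F y) p = 0) /\
    dfun A (fun q => B q (F v q) (F w q)) p u
    + dfun A (fun q => B q (F w q) (F u q)) p v
    + dfun A (fun q => B q (F u q) (F v q)) p w = 0].
  exists (chart_field A p); split=> [x|x|]; last split.
  - by apply: smooth_chart_field; exact: dom_self.
  - exact: chart_field_id.
  - by move=> x y; apply: lie_chart_field; exact: dom_self.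
  - exact: (dd_chart_field p u v w se HB).
move: lF => [lF]; clear se HB.
(* Along horizontal x the form Phi_1 is parallel. Every term of the derivative of eta_2 /\ eta_3
   keeps one undifferentiated factor, which vanishes on the horizontal vectors y and z. *)
have dB x y z : horizontal eta p x -> horizontal eta p y -> horizontal eta p z
  ->
    dfun A (fun q => B q (F y q) (F z q)) p x = 2 * alpha *
      (Phi phi g 0 p (nabla (F y) p x) z + Phi phi g 0 p y (nabla (F z) p x)).
  move=> hx hy hz.
  suff [] : has_dfun (fun q => B q (F y q) (F z q)) x (2 * alpha *
      (Phi phi g 0 p (nabla (F y) p x) z + Phi phi g 0 p y (nabla (F z) p x)))
        by [].
  apply: has_dfun_eq.
    apply: has_dfunD; apply: has_dfunM; try exact: has_dfun_cst.
      by apply: has_dfun_Phi.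
    by apply: has_dfunB; apply: has_dfunM; apply: has_dfun_eta.
  by rewrite !ordS_3 !Fp !hx !hy !hz; ring.
rewrite !dB // => H.
have TE x y : T p x y = nabla (F y) p x - nabla (F x) p y.
  have := torsionE (sF x) (sF y); rewrite !Fp => ->.
  by rewrite lF subr0.
have PhiC x y : Phi phi g 0 p x y = - Phi phi g 0 p y x.
  by rewrite /Phi -(phi_skew rg a3) (innerC rg).
move: H; rewrite (PhiC v) (PhiC w) (PhiC u) => H.
rewrite !TE !(innerBl rg); apply: (mulfI (_ : 2 * alpha != 0)).
  by rewrite mulf_neq0 // pnatr_eq0.
by rewrite mulr0 -[RHS]H /Phi; ring.
Qed.

Lemma torsion_omega u v w :
  ip (T p u v) w = 2 * alpha * omega phi eta g p u v w
    + 2 * (delta - 5 * alpha) * wedge111 (et 0) (et 1) (et 2) u v w.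
Proof.
have [e fe] := exists_contact_frame rg a3 p; have [_ _ Hs _] := cc.
exact: (torsion_formula rg a3 fe (Hs p) torsion_xi torsion_cyclic).
Qed.

(** Subtracting T / 2 from nabla xi_i contributes -alpha phi_i and lowers the vertical coefficient
    from beta to beta - (delta - 3 alpha) = delta - alpha. *)
Lemma nablag_xi i u : let j := ordS i in let k := ordS j in
  nablag (xi i) p u = - alpha *: (phi i p *m u)
    + (delta - alpha) *: (et k u *: xi j p - et j u *: xi k p).
Proof.
move=> j k; have [mn tn Ts _] := cc.
rewrite (nabla_torsion Sigma rg u mn tn Ts lc (smooth_xi i p)) nabla_xi -/j -/k.
apply: (inner_inj rg (p := p)) => w.
rewrite (innerBl rg) (innerDl rg) !(innerZl rg) !(innerBl rg) !(innerZl rg).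
rewrite (Ts p u (xi i p) w).2 torsion_xi -/j -/k !(inner_xi rg a3) /wedge11
  /Phi.
by rewrite (phi_skew rg a3); field.
Qed.

(** This is nabla omega = 0. The connection turns the triples eta_i and Phi_i by the same
    infinitesimal rotation, so the beta terms cancel in the invariant combinations of which omega
    consists. *)
Lemma has_dfun_omega X Y Z u : smooth_vf A X p -> smooth_vf A Y p ->
  smooth_vf A Z p ->
  has_dfun (fun q => omega phi eta g q (X q) (Y q) (Z q)) u
    (omega phi eta g p (nabla X p u) (Y p) (Z p)
     + omega phi eta g p (X p) (nabla Y p u) (Z p)
     + omega phi eta g p (X p) (Y p) (nabla Z p u)).
Proof.
move=> sX sY sZ.
have -> : (fun q => omega phi eta g q (X q) (Y q) (Z q)) = (fun q =>
  wedge12 (ev (eta 0 q)) (Phi phi g 0 q) (X q) (Y q) (Z q)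
  + wedge12 (ev (eta 1 q)) (Phi phi g 1 q) (X q) (Y q) (Z q)
  + wedge12 (ev (eta 2 q)) (Phi phi g 2 q) (X q) (Y q) (Z q)
  + 4 * wedge111 (ev (eta 0 q)) (ev (eta 1 q)) (ev (eta 2 q)) (X q) (Y q) (Z
      q)).
  by apply/funext => q; rewrite omegaE.
apply: has_dfun_eq.
  rewrite /wedge111 /wedge12 /wedge11.
  by do ![apply: has_dfunB|apply: has_dfunD|exact: has_dfun_cst|
    apply: has_dfun_eta => //|apply: has_dfun_Phi => //|apply: has_dfunM].
cbv beta; rewrite !ordS_3 !omegaE /wedge111 /wedge12 /wedge11.
move: (nabla X p u) (nabla Y p u) (nabla Z p u) (X p) (Y p) (Z p) => dX dY dZ x
  y z.
ring.
Qed.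

End ThreeSasaki.

(** * The Hodge dual of omega *)

Section Laplace.
Variable R : realType.

Definition skip (h k : nat) := if Nat.leb h k then k.+1 else k.

Lemma bumpE h k : bump h k = skip h k.
Proof.
rewrite /bump /skip; case: (@idP (h <= k)%N) => H.
  by have -> : Nat.leb h k by apply/PeanoNat.Nat.leb_le/ssrnat.leP.
case E : (Nat.leb h k) => //; case: H; apply/ssrnat.leP;
  exact/PeanoNat.Nat.leb_le.
Qed.

(* Unlike \det, the Laplace expansion reduces on concrete indices; this is also
   why skip replaces bump. *)
Fixpoint ndet (n : nat) (F : nat -> nat -> R) : R :=
  if n is m.+1 then foldr (fun i s => (-1) ^+ i * F i 0%N *
    ndet m (fun a b => F (skip i a) b.+1) + s) 0 (iota 0 n)
  else 1.

Lemma det_ndet n (F : nat -> nat -> R) : \det (\matrix_(i < n, j < n) F i j) =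
  ndet n F.
Proof.
elim: n F => [|n IH] F; first by rewrite det_mx00.
rewrite (expand_det_col _ ord0).
transitivity (\sum_(i < n.+1) (-1) ^+ i * F i 0%N * ndet n (fun a b => F (skip i
  a) b.+1)).
  apply: eq_bigr => i _; rewrite mxE /cofactor addn0 mulrCA mulrA -IH.
  congr (_ * \det _); apply/matrixP => a b; rewrite !mxE /= -bumpE.
  by rewrite [bump 0 b]bumpE.
rewrite -(big_mkord xpredT (fun i => (-1) ^+ i * F i 0%N * ndet n (fun a b => F
  (skip i a) b.+1))).
by rewrite /index_iota subn0 unlock.
Qed.

(** Only one cofactor survives. Applied three times, it removes the frame vectors from a volume and
    leaves a 4 by 4 minor. *)
Lemma ndet_unit n (F : nat -> nat -> R) i : (i < n.+1)%N ->
  (forall a, (a < n.+1)%N -> F a 0%N = (a == i)%:R) ->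
  ndet n.+1 F = (-1) ^+ i * ndet n (fun a b => F (skip i a) b.+1).
Proof.
move=> ltin H.
have : ndet n.+1 F = \sum_(0 <= a < n.+1) (-1) ^+ a * F a 0%N * ndet n (fun a' b
  => F (skip a a') b.+1).
  by rewrite /index_iota subn0 unlock.
move=> ->; rewrite (bigD1_seq i) ?mem_index_iota ?iota_uniq //=.
rewrite H // eqxx mulr1 big_seq_cond big1 ?addr0 // => a.
rewrite mem_index_iota => /andP[/andP[_ an] /negPf ai].
by rewrite H // ai mulr0 mul0r.
Qed.

End Laplace.

Section Hodge.
Variables (R : realType) (M : topologicalType) (A : manifold7 R M).
Local Notation V := 'cV[R]_7.
Variable (g : M -> 'M[R]_7) .
Hypothesis rg : riemannian A g.
Variables (p : M) (e : 'I_7 -> V).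
Hypothesis oe : onb g p e.
Local Notation ip := (inner g p).
Local Notation t k u := (ip (e (inord k)) u).
Variables x0 x1 x2 x3 : V.

Definition vol u v w : R := \det (\matrix_(a < 7, b < 7)
  ip (e a) (tnth [tuple u; v; w; x0; x1; x2; x3] b)).

Lemma det_xcol n (i j : 'I_n) (B : 'M[R]_n) : i != j -> \det (xcol i j B) = -
  \det B.
Proof.
by move=> ij; rewrite xcolE det_mulmx det_perm perm.odd_tperm ij expr1 mulrN1.
Qed.

Lemma vol_swap12 u v w : vol v u w = - vol u v w.
Proof.
rewrite /vol -(@det_xcol _ (inord 0) (inord 1)); last first.
  by rewrite -val_eqE /= !inordK.
congr (\det _); apply/matrixP => a; apply: I7_case; rewrite !mxE;
  rewrite ?perm.tpermL ?perm.tpermR ?perm.tpermD -?val_eqE /= ?inordK //=;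
  by rewrite !(tnth_nth 0) /= !inordK.
Qed.

Lemma vol_swap23 u v w : vol u w v = - vol u v w.
Proof.
rewrite /vol -(@det_xcol _ (inord 1) (inord 2)); last first.
  by rewrite -val_eqE /= !inordK.
congr (\det _); apply/matrixP => a; apply: I7_case; rewrite !mxE;
  rewrite ?perm.tpermL ?perm.tpermR ?perm.tpermD -?val_eqE /= ?inordK //=;
  by rewrite !(tnth_nth 0) /= !inordK.
Qed.

Lemma sum_onb (i : 'I_7) (F : 'I_7 -> R) : \sum_a ip (e i) (e a) * F a = F i.
Proof.
rewrite (bigD1 i) //= big1 => [|a /negPf ai]; first by rewrite oe eqxx mul1r
  addr0.
by rewrite oe eq_sym ai mul0r.
Qed.

Lemma sum_onb3 i j k : \sum_a \sum_b \sum_d ip (e i) (e a) * ip (e j) (e b)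
   * ip (e k) (e d) * vol (e a) (e b) (e d) = vol (e i) (e j) (e k).
Proof.
rewrite -[RHS](sum_onb i (fun a => vol (e a) (e j) (e k))); apply: eq_bigr => a
  _.
rewrite -[vol _ _ _ in RHS](sum_onb j (fun b => vol (e a) (e b) (e k)))
  mulr_sumr.
apply: eq_bigr => b _.
rewrite -[vol _ _ _ in RHS](sum_onb k (fun d => vol (e a) (e b) (e d)))
  !mulr_sumr.
by apply: eq_bigr => d _; ring.
Qed.

(** Summation against the orthonormal frame substitutes e_i, e_j, e_k in each of the six signed
    orders. By alternation of the volume these agree, which cancels the factor 1/6. *)
Lemma hodge3_wedge i j k :
  hodge3 g p e (wedge111 (ip (e i)) (ip (e j)) (ip (e k))) x0 x1 x2 x3 =
  vol (e i) (e j) (e k).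
Proof.
pose D a b d := vol (e a) (e b) (e d).
pose P i j k a b d := ip (e i) (e a) * ip (e j) (e b) * ip (e k) (e d) * D a b
  d.
have E : D i j k = 6^-1 * (D i j k - D i k j + D k i j - D j i k + D j k i - D k
  j i).
  have s12 a b d : D b a d = - D a b d by exact: vol_swap12.
  have s23 a b d : D a d b = - D a b d by exact: vol_swap23.
  rewrite (s23 i j k) (s12 i k j) (s23 i j k) (s12 i j k).
  rewrite (s23 j i k) (s12 i j k) (s12 j k i) (s23 j i k) (s12 i j k).
  by field.
rewrite [RHS]E /hodge3; congr (_ * _).
rewrite /D -!sum_onb3 -!(sumrB, big_split) /=; apply: eq_bigr => a _.
rewrite -!(sumrB, big_split) /=; apply: eq_bigr => b _.
rewrite -!(sumrB, big_split) /=; apply: eq_bigr => d _.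
rewrite -/(vol (e a) (e b) (e d)) /wedge111 /wedge12 /wedge11.
by move: (vol _ _ _) => q; ring.
Qed.

Lemma hodge3D w1 w2 : hodge3 g p e (fun u v w => w1 u v w + w2 u v w) x0 x1 x2
  x3 =
  hodge3 g p e w1 x0 x1 x2 x3 + hodge3 g p e w2 x0 x1 x2 x3.
Proof.
rewrite /hodge3 -mulrDr; congr (_ * _); rewrite -big_split; apply: eq_bigr => a
  _ /=.
rewrite -big_split; apply: eq_bigr => b _ /=; rewrite -big_split.
by apply: eq_bigr => d _ /=; rewrite mulrDl.
Qed.

Lemma hodge3Z (s : R) w1 : hodge3 g p e (fun u v w => s * w1 u v w) x0 x1 x2 x3
  =
  s * hodge3 g p e w1 x0 x1 x2 x3.
Proof.
rewrite /hodge3 mulrCA; congr (_ * _); rewrite mulr_sumr; apply: eq_bigr => a _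
  /=.
rewrite mulr_sumr; apply: eq_bigr => b _ /=; rewrite mulr_sumr.
by apply: eq_bigr => d _ /=; rewrite mulrA.
Qed.

Lemma hodge3_eq w1 w2 : (forall u v w, w1 u v w = w2 u v w) ->
  hodge3 g p e w1 x0 x1 x2 x3 = hodge3 g p e w2 x0 x1 x2 x3.
Proof. by move=> H; congr (_ * _); do 3!apply: eq_bigr => ? _; rewrite H. Qed.

(** Rows i, j, k are deleted in turn: j' is the position of j once row i is gone, and k' that of k
    once both are gone. The two boolean conditions verify these positions by computation. *)
Lemma vol_frame (i j k j' k' : nat) : (i < 7)%N -> (j < 7)%N -> (k < 7)%N ->
  (j' < 6)%N -> (k' < 5)%N ->
  all (fun a => (skip i a < 7)%N && ((skip i a == j) == (a == j'))) (iota 0 6)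
    ->
  all (fun a => (skip i (skip j' a) < 7)%N && ((skip i (skip j' a) == k) == (a
    == k')))
    (iota 0 5) ->
  vol (e (inord i)) (e (inord j)) (e (inord k)) = (-1) ^+ i * ((-1) ^+ j' *
  ((-1) ^+ k' * ndet 4 (fun a b => t (skip i (skip j' (skip k' a)))
     (nth 0 [:: x0; x1; x2; x3] b)))).
Proof.
move=> i7 j7 k7 j6 k5 /allP Hj /allP Hk.
have onb a b : (a < 7)%N -> (b < 7)%N -> t a (e (inord b)) = (a == b)%:R.
  by move=> a7 b7; rewrite oe -val_eqE /= !inordK.
pose F (a b : nat) := t a (nth 0 [:: e (inord i); e (inord j); e (inord k); x0;
  x1; x2; x3] b).
have -> : vol (e (inord i)) (e (inord j)) (e (inord k)) = ndet 7 F.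
  rewrite -det_ndet /vol; congr (\det _); apply/matrixP => a b; rewrite !mxE.
  by rewrite /F inord_val (tnth_nth 0).
rewrite (@ndet_unit _ 6 F i) //; last by move=> a a7; exact: onb.
congr (_ * _); rewrite (@ndet_unit _ 5 _ j') //; last first.
  move=> a a6; have /Hj/andP[b7 /eqP <-] : a \in iota 0 6 by rewrite mem_iota.
  exact: onb.
congr (_ * _); rewrite (@ndet_unit _ 4 _ k') //.
move=> a a5; have /Hk/andP[b7 /eqP <-] : a \in iota 0 5 by rewrite mem_iota.
exact: onb.
Qed.

End Hodge.

(** * The cross product and the Hodge dual of omega *)

Section NearlyParallel.
Variables (R : realType) (M : topologicalType) (A : manifold7 R M).
Local Notation V := 'cV[R]_7.
Variables (phi : 'I_3 -> M -> 'M[R]_7) (xi : 'I_3 -> M -> V).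
Variables (eta : 'I_3 -> M -> 'rV[R]_7) (g : M -> 'M[R]_7).
Hypothesis rg : riemannian A g.
Hypothesis a3 : almost_3contact_metric A phi xi eta g.
Variable p : M.
Local Notation ip := (inner g p).
Local Notation omega := (omega phi eta g p).
Variable e : 'I_7 -> V.
Hypothesis fe : contact_frame phi xi g p e.
Local Notation t k u := (ip (e (inord k)) u).

Definition w2 i j u v := t i u * t j v - t j u * t i v.

(** The coordinates of the G_2 cross product, the vector dual to omega(u, v, -) in the contact
    frame. *)
Definition cross (k : nat) u v : R := nth 0 [:: w2 1 2 u v + w2 3 4 u v + w2 5 6
  u v;
  w2 2 0 u v + w2 3 5 u v - w2 4 6 u v; w2 0 1 u v - w2 3 6 u v - w2 4 5 u v;
  w2 4 0 u v + w2 5 1 u v - w2 6 2 u v; w2 0 3 u v - w2 6 1 u v - w2 5 2 u v;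
  w2 6 0 u v + w2 1 3 u v - w2 2 4 u v; w2 0 5 u v - w2 1 4 u v - w2 2 3 u v] k.

Lemma omega_cross u v w : omega u v w = cross 0 u v * t 0 w + cross 1 u v * t 1
  w
  + cross 2 u v * t 2 w + cross 3 u v * t 3 w + cross 4 u v * t 4 w
  + cross 5 u v * t 5 w + cross 6 u v * t 6 w.
Proof.
rewrite (omega_std rg a3 fe) std_formE; cbv zeta beta.
rewrite /wedge111 /wedge12 /wedge11 /cross /= /w2; ring.
Qed.

Lemma omega_e k u v : (k < 7)%N -> omega u v (e (inord k)) = cross k u v.
Proof.
move=> k7; rewrite omega_cross !(frame_onb fe) //.
by case: k k7 => [|[|[|[|[|[|[|k]]]]]]] //= _; rewrite ?(mulr0, mulr1, addr0,
  add0r).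
Qed.

(** The G_2 identity for the inner product of two cross products: besides the Hodge dual it contains
    a metric part g(a, c) g(b, d) - g(a, d) g(b, c), which cancels in this alternated sum, while the
    dual occurs three times. It is verified as a polynomial identity in the coordinates. *)
Lemma hodge_omega x0 x1 x2 x3 :
  \sum_(k < 7) (cross k x0 x1 * cross k x2 x3 - cross k x0 x2 * cross k x1 x3
    + cross k x0 x3 * cross k x1 x2) = 3 * hodge3 g p e omega x0 x1 x2 x3.
Proof.
have oe := cf_onb fe.
rewrite (@hodge3_eq _ _ _ _ _ _ _ _ _ _ _ (omega_frame rg a3 fe)).
rewrite !hodge3D /frame_wedge !hodge3Z !(hodge3_wedge oe).
(* The last two numbers are the positions of the second and third index after the earlier rows have
   been deleted. *)
rewrite (@vol_frame _ _ _ _ _ oe _ _ _ _ 0 1 2 0 0) //.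
rewrite (@vol_frame _ _ _ _ _ oe _ _ _ _ 0 3 4 2 2) //.
rewrite (@vol_frame _ _ _ _ _ oe _ _ _ _ 0 5 6 4 4) //.
rewrite (@vol_frame _ _ _ _ _ oe _ _ _ _ 1 3 5 2 3) //.
rewrite (@vol_frame _ _ _ _ _ oe _ _ _ _ 1 4 6 3 4) //.
rewrite (@vol_frame _ _ _ _ _ oe _ _ _ _ 2 3 6 2 4) //.
rewrite (@vol_frame _ _ _ _ _ oe _ _ _ _ 2 4 5 3 3) //.
rewrite !big_ord_recl big_ord0 /= /skip /= /cross /= /w2.
move: (t 0 x0) (t 1 x0) (t 2 x0) (t 3 x0) (t 4 x0) (t 5 x0) (t 6 x0) (t 0 x1) (t
  1 x1) (t 2 x1) (t 3 x1) (t 4 x1) (t 5 x1) (t 6 x1) (t 0 x2) (t 1 x2) (t 2 x2)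
  (t 3 x2) (t 4 x2) (t 5 x2) (t 6 x2) (t 0 x3) (t 1 x3) (t 2 x3) (t 3 x3) (t 4
  x3) (t 5 x3) (t 6 x3) =>
  ya0 ya1 ya2 ya3 ya4 ya5 ya6 yb0 yb1 yb2 yb3 yb4 yb5 yb6 yc0 yc1 yc2 yc3 yc4
    yc5 yc6 yd0 yd1 yd2 yd3 yd4 yd5 yd6.
ring.
Qed.

End NearlyParallel.

(** * Killing spinors *)

Section Killing.
Variables (R : realType) (M : topologicalType) (A : manifold7 R M).
Local Notation V := 'cV[R]_7.
Variables (phi : 'I_3 -> M -> 'M[R]_7) (xi : 'I_3 -> M -> V).
Variables (eta : 'I_3 -> M -> 'rV[R]_7) (g : M -> 'M[R]_7).
Variables (alpha delta : R).
Variables (nablag nabla : (M -> V) -> M -> V -> V) (T : M -> V -> V -> V).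
Variable Sigma : spin_bundle A g.
Variable nablaS : (M -> 'cV[R]_8) -> M -> V -> 'cV[R]_8.
Variable psi0 : M -> 'cV[R]_8.
Hypothesis rg : riemannian A g.
Hypothesis sa : sasaki_3ad A phi xi eta g alpha delta.
Hypothesis lc : levi_civita A g nablag.
Hypothesis cc : canonical_connection A phi eta g alpha delta nabla T.
Hypothesis sc : spin_connection Sigma nablag nablaS.
Hypothesis cs : canonical_spinor Sigma nablaS T (omega phi eta g) psi0.
Implicit Types (p : M) (u v w : V) (i j : 'I_3).

Let a3 : almost_3contact_metric A phi xi eta g.
Proof. by case: sa. Qed.

(** * The exterior derivative of omega *)

Lemma omega_alt p u v w :
  omega phi eta g p u v w = - omega phi eta g p v u w /\
  omega phi eta g p u v w = - omega phi eta g p u w v.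
Proof.
have PhiC i x y : Phi phi g i p x y = - Phi phi g i p y x.
  by rewrite /Phi -(phi_skew rg a3) (innerC rg).
rewrite !omegaE /wedge111 /wedge12 /wedge11.
by split; rewrite !(PhiC _ u w) !(PhiC _ w v) !(PhiC _ v u); ring.
Qed.

Lemma omegaBl p u1 u2 v w : omega phi eta g p (u1 - u2) v w =
  omega phi eta g p u1 v w - omega phi eta g p u2 v w.
Proof.
have PhiBl i x y z : Phi phi g i p (y - z) x = Phi phi g i p y x - Phi phi g i p
  z x.
  by rewrite /Phi (innerBl rg).
have PhiBr i x y z : Phi phi g i p x (y - z) = Phi phi g i p x y - Phi phi g i p
  x z.
  by rewrite /Phi mulmxBr innerBr.
rewrite !omegaE /wedge111 /wedge12 /wedge11 !evD !evN !PhiBl !PhiBr; ring.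
Qed.

(** As omega is parallel, only the derivatives of the fields remain; with the bracket terms they
    group into nabla_X Y - nabla_Y X - [X, Y] = T(X, Y). *)
Lemma d3_omega p (X0 X1 X2 X3 : M -> V) : smooth_vf A X0 p -> smooth_vf A X1 p
  ->
  smooth_vf A X2 p -> smooth_vf A X3 p ->
  let w := omega phi eta g p in
  d3 A (omega phi eta g) X0 X1 X2 X3 p =
    w (T p (X0 p) (X1 p)) (X2 p) (X3 p) - w (T p (X0 p) (X2 p)) (X1 p) (X3 p)
  + w (T p (X0 p) (X3 p)) (X1 p) (X2 p) + w (T p (X1 p) (X2 p)) (X0 p) (X3 p)
  - w (T p (X1 p) (X3 p)) (X0 p) (X2 p) + w (T p (X2 p) (X3 p)) (X0 p) (X1 p).
Proof.
move=> s0 s1 s2 s3 w; rewrite /d3 -/w.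
have D (X Y Z : M -> V) u : smooth_vf A X p -> smooth_vf A Y p -> smooth_vf A Z
  p ->
    dfun A (fun q => omega phi eta g q (X q) (Y q) (Z q)) p u =
    w (nabla X p u) (Y p) (Z p) - w (nabla Y p u) (X p) (Z p)
     + w (nabla Z p u) (X p) (Y p).
  move=> sX sY sZ; have [_ ->] := has_dfun_omega rg sa cc u sX sY sZ.
  rewrite -/w; congr (_ + _ + _); first by rewrite /w (omega_alt _ _ _ _).1.
  by rewrite /w (omega_alt _ _ _ _).2 (omega_alt _ _ _ _).1 opprK.
(* D has moved every derivative to the first slot, so additivity in that slot is the one property of
   omega still to be invoked. *)
have wB u1 u2 v x : w (u1 - u2) v x = w u1 v x - w u2 v x by exact: omegaBl.
clearbody w.
have T01 := torsionE cc s0 s1; have T02 := torsionE cc s0 s2.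
have T03 := torsionE cc s0 s3; have T12 := torsionE cc s1 s2.
have T13 := torsionE cc s1 s3; have T23 := torsionE cc s2 s3.
rewrite T01 T02 T03 T12 T13 T23 (D _ _ _ _ s1 s2 s3) (D _ _ _ _ s0 s2 s3).
rewrite (D _ _ _ _ s0 s1 s3) (D _ _ _ _ s0 s1 s2).
clear D T01 T02 T03 T12 T13 T23.
move: (nabla X0 p) (nabla X1 p) (nabla X2 p) (nabla X3 p) => n0 n1 n2 n3.
move: (lie A X0 X1 p) (lie A X0 X2 p) (lie A X0 X3 p) (lie A X1 X2 p)
  (lie A X1 X3 p) (lie A X2 X3 p) => l01 l02 l03 l12 l13 l23.
move: (X0 p) (X1 p) (X2 p) (X3 p) => x0 x1 x2 x3.
rewrite !wB; ring.
Qed.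

(** Here T = 2 alpha omega, so omega(T(u, v), x, y) is 2 alpha times the inner product of the cross
    products of u, v and of x, y. Its symmetry pairs the six terms of d omega into 4 alpha times the
    sum in [hodge_omega], hence 4 alpha times 3 times the Hodge dual. *)
Lemma nearly_parallel : delta = 5 * alpha ->
  nearly_parallel_G2 A g (omega phi eta g).
Proof.
move=> d5; have [al0 _ _] := sa; exists (12 * alpha).
  by rewrite mulf_neq0 // pnatr_eq0.
move=> p; have [e fe] := exists_contact_frame rg a3 p; exists e.
  by split; [exact: cf_onb fe|exact: (omega_std rg a3 fe)].
move=> X0 X1 X2 X3 s0 s1 s2 s3; rewrite d3_omega //.
have E u v x y : omega phi eta g p (T p u v) x y =
    2 * alpha * \sum_(k < 7) cross g p e k u v * cross g p e k x y.
  have tT k : (k < 7)%N -> inner g p (e (inord k)) (T p u v) = 2 * alpha * cross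
    g p e k u v.
    move=> k7; rewrite (innerC rg) (torsion_omega Sigma rg sa cc) d5 subrr mulr0
      mul0r addr0.
    by rewrite (omega_e rg a3 fe).
  rewrite (omega_alt _ _ _ _).1 (omega_alt _ _ _ _).2 opprK (omega_cross rg a3
    fe) !tT //.
  rewrite !big_ord_recl big_ord0 /=; ring.
pose S x y z v : R := \sum_(k < 7) cross g p e k x y * cross g p e k z v.
have SC x y z v : S z v x y = S x y z v by apply: eq_bigr => k _; rewrite mulrC.
have := hodge_omega rg a3 fe (X0 p) (X1 p) (X2 p) (X3 p).
rewrite big_split /= sumrB => H.
rewrite -/(S _ _ _ _) -/(S _ _ _ _) -/(S _ _ _ _) in H; rewrite !E -!/(S _ _ _
  _).
rewrite (SC (X0 p) (X3 p)) (SC (X0 p) (X2 p)) (SC (X0 p) (X1 p)).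
have -> : 12 * alpha * hodge3 g p e (omega phi eta g p) (X0 p) (X1 p) (X2 p) (X3
  p) =
  4 * alpha * (3 * hodge3 g p e (omega phi eta g p) (X0 p) (X1 p) (X2 p) (X3 p))
    by ring.
rewrite -H; ring.
Qed.

(** * Block endomorphisms and their Killing numbers *)

Lemma sum3 (U : nmodType) i (F : 'I_3 -> U) :
  \sum_l F l = F i + F (ordS i) + F (ordS (ordS i)).
Proof.
have S0 : \sum_l F l = F 0 + F 1 + F 2.
  rewrite !big_ord_recl big_ord0 addr0 addrA.
  by do !congr (_ + _); congr F; apply: val_inj.
rewrite S0; move: i; apply: (@I3_case _ 0); rewrite !ordS_3 //.
  by rewrite -addrA addrC.
by rewrite addrC addrA.
Qed.

(* a on H and a + b i on xi_i *)
Definition block_endo (a : R) (b : 'I_3 -> R) p : 'M[R]_7 :=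
  a%:M + \sum_i b i *: (xi i p *m eta i p).

Lemma block_endoE a b p u : block_endo a b p *m u =
  a *: u + \sum_i (b i * ev (eta i p) u) *: xi i p.
Proof.
rewrite /block_endo mulmxDl mul_scalar_mx mulmx_suml; congr (_ + _).
by apply: eq_bigr => i _; rewrite -scalemxAl ev_mul scalerA.
Qed.

Lemma block_endo_xi a b p j : block_endo a b p *m xi j p = (a + b j) *: xi j p.
Proof.
rewrite block_endoE (bigD1 j) //= big1 => [|i /negPf ij].
  by rewrite (eta_xi_self a3) mulr1 addr0 scalerDl.
by rewrite (eta_xi_delta rg a3) ij mulr0 scale0r.
Qed.

Lemma block_endo_horizontal a b p u : horizontal eta p u ->
  block_endo a b p *m u = a *: u.
Proof.
move=> hu; rewrite block_endoE big1 ?addr0 // => i _.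
by rewrite hu mulr0 scale0r.
Qed.

Lemma smooth_block_endo a b : smooth_endo A (block_endo a b).
Proof.
move=> p X sX.
have -> : (fun q => block_endo a b q *m X q) = (fun q => a *: X q +
    \sum_i (b i * ev (eta i q) (X q)) *: xi i q).
  by apply/funext => q; exact: block_endoE.
apply: smooth_sectionD; first by apply: smooth_sectionZ => //; exact:
  smooth_fun_cst.
apply: smooth_section_sum => i; apply: smooth_sectionZ; last exact: (smooth_xi
  sa).
apply: smooth_funM; first exact: smooth_fun_cst.
by have [_ _ H _ _ _] := acm_each a3 i; exact: H.
Qed.

Lemma block_endo_sym a b p u v :
  inner g p (block_endo a b p *m u) v = inner g p u (block_endo a b p *m v).
Proof.
rewrite !block_endoE (innerDl rg) innerDr (innerZl rg) innerZr; congr (_ + _).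
rewrite (inner_suml rg) inner_sumr; apply: eq_bigr => i _.
rewrite (innerZl rg) innerZr (innerC rg p u) !(inner_xi rg a3); ring.
Qed.

Section BlockKilling.
Variables (psi : M -> 'cV[R]_8) (a : R) (b : 'I_3 -> R).
Hypothesis psi_neq0 : forall p, psi p != 0.
Hypothesis nablaS_block : forall p u,
  nablaS psi p u = clif Sigma p (block_endo a b p *m u) *m psi p.

Lemma block_killing_endo : killing_endo Sigma nablaS psi (block_endo a b).
Proof.
split=> //; [exact: smooth_block_endo|exact: block_endo_sym].
Qed.

(** Injectivity of Clifford multiplication identifies any admissible S with the block endomorphism
    on the eigenvector. If u is not horizontal, some eta_i(u) is nonzero, and pairing with xi_i,
    itself an eigenvector of a symmetric endomorphism, gives a + b_i. Conversely, a horizontal unit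
    vector and the xi_i at a point of M realize all the values. *)
Lemma block_killing_number (k : R) : (exists p : M, True) ->
  killing_number Sigma nablaS psi k <-> k = a \/ exists i, k = a + b i.
Proof.
move=> [p0 _]; split.
  move=> [S [_ _ HS] [p [u [u0 Su]]]].
  have SE : block_endo a b p *m u = k *: u.
    apply/eqP; rewrite -subr_eq0; apply/eqP; apply: (clif_inj (Sigma := Sigma)
      rg (p := p) (psi_neq0 p)).
    rewrite -Su clifD clifN mulmxDl mulNmx -nablaS_block -HS subrr //.
  have [Hh|] := pselect (horizontal eta p u).
    left; move/eqP: SE; rewrite block_endo_horizontal // -subr_eq0 -scalerBl.
    by rewrite scaler_eq0 (negPf u0) orbF subr_eq0 => /eqP.
  move=> /existsNP[i /eqP ui]; right; exists i.
  have := congr1 (inner g p (xi i p)) SE.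
  rewrite -block_endo_sym block_endo_xi (innerZl rg) innerZr (inner_xi rg a3).
  by move/(mulIf ui).
have S := block_killing_endo.
case=> [->|[i ->]]; exists (block_endo a b) => //; exists p0.
  have [x xx hx] := exists_horizontal eta rg p0; exists x; split.
    by apply: contra_eq_neq xx => ->; rewrite inner0r eq_sym oner_eq0.
  by rewrite block_endo_horizontal // => i; exact: hx.
exists (xi i p0); split; last exact: block_endo_xi.
apply: contra_eq_neq (eta_xi_self a3 p0 i) => ->.
by rewrite /ev mulmx0 mxE eq_sym oner_eq0.
Qed.

End BlockKilling.

(** * The derivatives of the canonical spinor and of its products with xi_i *)

Lemma psi0_neq0 p : psi0 p != 0.
Proof.
have [_ _ _ /(_ p) H] := cs; apply: contra_eq_neq H => ->.
by rewrite mulmx0 mxE eq_sym oner_eq0.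
Qed.

(** Parallelism of psi_0 gives nabla^g psi_0 as -1/4 times the action of u _| T. The two summands of
    T act by 2 alpha times 3 u and by 2 (delta - 5 alpha) times the vertical part of u. *)
Lemma nablaS_psi0 p u : nablaS psi0 p u = clif Sigma p (block_endo
  (- (3 * alpha / 2)) (fun=> - ((delta - 5 * alpha) / 2)) p *m u) *m psi0 p.
Proof.
have [_ /(_ p u)/eqP + Ho _] := cs; rewrite addr_eq0 => /eqP ->.
have [e fe] := exists_contact_frame rg a3 p.
pose w1 v w := 2 * alpha * omega phi eta g p u v w.
pose w2 v w := 2 * (delta - 5 * alpha) *
  wedge111 (ev (eta 0 p)) (ev (eta 1 p)) (ev (eta 2 p)) u v w.
rewrite (@clif2_eq _ _ _ _ Sigma p _ (fun v w => w1 v w + w2 v w)); last first.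
  by move=> v w; exact: (torsion_omega Sigma rg sa cc).
have scl (l : R) (X : 'M[R]_8) : (l *: X) *m psi0 p = l *: (X *m psi0 p).
  by rewrite -scalemxAl.
rewrite clif2D /w1 /w2 !clif2Z mulmxDl (scl (2 * alpha)) (scl (2 * (delta - 5 *
  alpha))).
rewrite (clif2_omega rg a3 fe (Ho p)) (clif2_vertical rg a3 fe (Ho p)).
rewrite block_endoE clifD clifZ mulmxDl -scalemxAl clif_sum mulmx_suml.
rewrite scalerDr opprD; congr (_ + _).
  rewrite !scalerA -scaleNr; congr (_ *: _); by field.
rewrite !scaler_sumr -sumrN; apply: eq_bigr => i _.
rewrite clifZ -scalemxAl !scalerA -scaleNr; congr (_ *: _); by field.
Qed.

Definition xi_spinor i p := clif Sigma p (xi i p) *m psi0 p.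

Lemma xi_spinor_neq0 i p : xi_spinor i p != 0.
Proof.
apply: contra_eq_neq (eta_xi_self a3 p i) => H.
rewrite (clif_inj (Sigma := Sigma) rg (p := p) (psi0_neq0 p) H).
by rewrite /ev mulmx0 mxE eq_sym oner_eq0.
Qed.

(** [block_endo] adds its vertical coefficients to the horizontal one, so these are the expected
    Killing numbers minus alpha / 2. *)
Definition psi_coef i j := if j == i then (2 * alpha - delta) / 2 - alpha / 2
  else (3 * delta - 2 * alpha) / 2 - alpha / 2.

(** The derivative is (nabla^g xi_i) psi_0 + xi_i nabla^g psi_0, and [clif_xi] reduces both sides to
    multiples of psi_0 and of vectors times psi_0. For horizontal X, xi_i X psi_0 = -(phi_i X)
    psi_0, so the coefficients -alpha and 3 alpha / 2 add up to alpha / 2. *)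
Lemma nablaS_xi_spinor i p u : nablaS (xi_spinor i) p u =
  clif Sigma p (block_endo (alpha / 2) (psi_coef i) p *m u) *m xi_spinor i p.
Proof.
have [sp _ Ho _] := cs; have [e fe] := exists_contact_frame rg a3 p.
pose j := ordS i; pose k := ordS j.
have ij : (j == i) = false by rewrite /j; case: i {j k} => [[|[|[|i]]] Hi].
have ik : (k == i) = false by rewrite /k /j; case: i {j k ij} => [[|[|[|i]]]
  Hi].
pose P v := clif Sigma p v *m psi0 p.
have PD v w : P (v + w) = P v + P w by rewrite /P clifD mulmxDl.
have PZ (a : R) v : P (a *: v) = a *: P v by rewrite /P clifZ -scalemxAl.
have cP v : clif Sigma p (xi i p) *m P v = - ev (eta i p) v *: psi0 p
   - P (phi i p *m v) + (2 * ev (eta j p) v) *: P (xi k p)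
   - (2 * ev (eta k p) v) *: P (xi j p).
  exact: (clif_xi rg a3 fe (Ho p)).
(* The Clifford relation brings xi_i to the left, where [cP] applies. *)
have Pc v : clif Sigma p v *m xi_spinor i p = - (clif Sigma p (xi i p) *m P v)
    - (2 * ev (eta i p) v) *: psi0 p.
  rewrite /xi_spinor mulmxA; have := clif_anti Sigma rg p v (xi i p).
  move/eqP; rewrite eq_sym -subr_eq => /eqP <-.
  rewrite mulmxBl mul_scalar_mx (innerC rg) (inner_xi rg a3) -mulmxA.
  by rewrite addrC mulNr scaleNr.
rewrite (nablaS_clif rg lc sc u (smooth_xi sa i p) (sp p)).
rewrite nablaS_psi0 (nablag_xi Sigma rg sa lc cc) Pc -/j -/k.
rewrite -/(P _) -/(P _) !block_endoE !(sum3 i) -/j -/k /psi_coef eqxx ij ik.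
have [e1 e2] : phi i p *m xi j p = xi k p /\ phi i p *m xi k p = - xi j p.
  have [H _] := phi_xi a3 p i; have [_ H2] := phi_xi a3 p k.
  by split; [exact: H|move: H2; rewrite /k /j ordS3].
have ji : (i == j) = false by rewrite eq_sym.
have ki : (i == k) = false by rewrite eq_sym.
have jk : (j == k) = false.
  by rewrite /k /j; case: i {ij ik cP Pc j k e1 e2 ji ki} => [[|[|[|i]]] Hi].
have kj : (k == j) = false by rewrite eq_sym.
have PN v : P (- v) = - P v by rewrite -scaleN1r PZ scaleN1r.
have P0 : P 0 = 0 by rewrite /P clif0 mul0mx.
rewrite !(PD, PZ, PN) !mulmxDr -!scalemxAr !cP.
rewrite !(evD, evZ, evN) !(eta_xi_delta rg a3) !eqxx ?ij ?ik ?ji ?ki ?jk ?kj.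
rewrite (phi_xi_self a3) e1 e2 PN P0.
move: (psi0 p) (P (phi i p *m u)) (P (xi j p)) (P (xi k p)) (P (xi i p)) (P u).
move: (ev (eta i p) u) (ev (eta j p) u) (ev (eta k p) u) => h1 h2 h3 q1 q2 q3 q4
  q5 q6.
by apply/colP => l; rewrite !mxE /=; field.
Qed.

End Killing.

Theorem theorem4p5p2 (R : realType) (M : topologicalType) (A : manifold7 R M)
    (phi : 'I_3 -> M -> 'M[R]_7) (xi : 'I_3 -> M -> 'cV[R]_7)
    (eta : 'I_3 -> M -> 'rV[R]_7) (g : M -> 'M[R]_7) (alpha delta : R)
    (nablag : (M -> 'cV[R]_7) -> M -> 'cV[R]_7 -> 'cV[R]_7)
    (nabla : (M -> 'cV[R]_7) -> M -> 'cV[R]_7 -> 'cV[R]_7)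
    (T : M -> 'cV[R]_7 -> 'cV[R]_7 -> 'cV[R]_7)
    (Sigma : spin_bundle A g)
    (nablaS : (M -> 'cV[R]_8) -> M -> 'cV[R]_7 -> 'cV[R]_8)
    (psi0 : M -> 'cV[R]_8) :
  simply_connected R M ->
  riemannian A g ->
  sasaki_3ad A phi xi eta g alpha delta ->
  levi_civita A g nablag ->
  canonical_connection A phi eta g alpha delta nabla T ->
  spin_connection Sigma nablag nablaS ->
  clif_normalized Sigma (omega phi eta g) ->
  canonical_spinor Sigma nablaS T (omega phi eta g) psi0 ->
  let psi i p := clif Sigma p (xi i p) *m psi0 p in
  [/\ (* 1) *)
      [/\ generalized_killing Sigma nablaS psi0,
          forall p X, horizontal eta p X ->
            nablaS psi0 p X = - (3 * alpha / 2) *: (clif Sigma p X *m psi0 p),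
          forall p Y, vertical xi p Y ->
            nablaS psi0 p Y =
            ((2 * alpha - delta) / 2) *: (clif Sigma p Y *m psi0 p),
          forall a, killing_number Sigma nablaS psi0 a <->
            (a = - (3 * alpha / 2) \/ a = (2 * alpha - delta) / 2) &
          (- (3 * alpha / 2) = (2 * alpha - delta) / 2 <-> delta = 5 * alpha)
          /\ (delta = 5 * alpha -> nearly_parallel_G2 A g (omega phi eta g))],
      (* 2) *)
      forall i,
        [/\ generalized_killing Sigma nablaS (psi i),
            forall p, nablaS (psi i) p (xi i p) =
              ((2 * alpha - delta) / 2) *: (clif Sigma p (xi i p) *m psi i p),
            forall j p, i != j -> nablaS (psi i) p (xi j p) =
              ((3 * delta - 2 * alpha) / 2)
                *: (clif Sigma p (xi j p) *m psi i p),
            forall p X, horizontal eta p X ->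
              nablaS (psi i) p X =
              (alpha / 2) *: (clif Sigma p X *m psi i p) &
            forall a, killing_number Sigma nablaS (psi i) a <->
              [\/ a = (2 * alpha - delta) / 2,
                  a = (3 * delta - 2 * alpha) / 2 | a = alpha / 2]] &
      [/\ (2 * alpha - delta) / 2 = (3 * delta - 2 * alpha) / 2
            <-> alpha = delta,
          (2 * alpha - delta) / 2 = alpha / 2 <-> alpha = delta &
          (3 * delta - 2 * alpha) / 2 = alpha / 2 <-> alpha = delta]].
Proof.
move=> [M0 _ _] rg sa lc cc sc _ cs psi.
have [al0 a3 _] := sa; have [sp0 _ _ _] := cs.
have N0 := nablaS_psi0 rg sa cc cs.
have Z0 := psi0_neq0 cs.
have K0 := block_killing_endo rg sa N0.
have spsi i : smooth_spinor Sigma (psi i).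
  by move=> p; apply: smooth_clif => //; exact: (smooth_xi sa).
split.
- split.
  + by split=> //; exists (block_endo xi eta (- (3 * alpha / 2))
      (fun=> - ((delta - 5 * alpha) / 2))).
  + move=> p X hX; rewrite N0 block_endo_horizontal //.
    by rewrite clifZ -scalemxAl.
  + move=> p _ [k ->]; rewrite N0 mulmx_sumr !clif_sum !mulmx_suml scaler_sumr.
    apply: eq_bigr => i _; rewrite -scalemxAr (block_endo_xi rg sa) !clifZ.
    rewrite -!scalemxAl !scalerA; congr (_ *: _); by field.
  + move=> a; apply: iff_trans (block_killing_number rg sa Z0 N0 a M0) _.
    have E : - (3 * alpha / 2) + - ((delta - 5 * alpha) / 2) = (2 * alpha - delta) / 2.
      by field.
    split=> [[->|[_ ->]]|[->|->]]; [by left|by right; exact: E|by left|right].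
    (* The vertical coefficient is the same for the three indices, so any index serves as
       witness. *)
    by exists 0; rewrite E.
  + split; first by split=> H; lra.
    exact: (nearly_parallel Sigma rg sa cc).
- move=> i.
  have N p u : nablaS (psi i) p u = clif Sigma p
      (block_endo xi eta (alpha / 2) (psi_coef alpha delta i) p *m u) *m psi i p.
    exact: (nablaS_xi_spinor rg sa lc cc sc cs).
  have Z p : psi i p != 0 by exact: (xi_spinor_neq0 rg sa cs).
  have Ei : alpha / 2 + psi_coef alpha delta i i = (2 * alpha - delta) / 2.
    by rewrite /psi_coef eqxx; field.
  have Ej j : i != j -> alpha / 2 + psi_coef alpha delta i j =
      (3 * delta - 2 * alpha) / 2.
    by rewrite /psi_coef eq_sym => /negPf ->; field.
  split.
  + split=> //; exists (block_endo xi eta (alpha / 2) (psi_coef alpha delta i)).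
    exact: (block_killing_endo rg sa N).
  + by move=> p; rewrite N (block_endo_xi rg sa) Ei clifZ -scalemxAl.
  + by move=> j p ij; rewrite N (block_endo_xi rg sa) Ej // clifZ -scalemxAl.
  + by move=> p X hX; rewrite N block_endo_horizontal // clifZ -scalemxAl.
  + move=> a; apply: iff_trans (block_killing_number rg sa Z N a M0) _; split.
      case=> [->|[j ->]]; first by constructor 3.
      have [<-|ij] := eqVneq i j; first by constructor 1.
      by constructor 2; exact: Ej.
    (* The second value requires an index different from i, and [ordS i] is one. *)
    case=> ->; [right; exists i|right; exists (ordS i)|by left]; rewrite ?Ei ?Ej //.
    by case: (i) => [[|[|[|k]]] Hk].
- by split; split=> H; lra.
Qed.
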